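(* Let $\chi$ be a non-principal even primitive Dirichlet character modulo $q$, and let $a,x>0$ with $\frac{a^2 q x}{16 \pi^2}\notin \mathbb{Z}_{>0}$. Then \begin{align*} \sum_{n=1}^\infty d_{\chi}(n) K_0(a\sqrt{nx})= \frac{2}{a^2x} L(1,\chi)-\frac{\tau(\chi)}{8 }L (1,\bar{\chi}) + \frac{a^2q\, x}{32\pi^4} \tau( \chi ) \sum_{n=1}^\infty d_{\bar{\chi} }(n) \frac{\log \left(\frac{16\pi^2 n}{a^2q x} \right) }{n^2-\left(\frac{a^2qx}{16\pi^2 } \right)^2}. \end{align*}
   Context: $d_\chi(n)=\sum_{d\mid n}\chi(d)$. $\tau(\chi)=\sum_{h=1}^q\chi(h)e^{2\pi i h/q}$ is the Gauss sum, $L(s,\chi)$ the Dirichlet $L$-function, and $K_0$ the modified Bessel function of the second kind of order $0$. *)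

(* Defs.v *)
From Stdlib Require Import Reals Lra ZArith Znumtheory List.
From Coquelicot Require Import Coquelicot.
Open Scope R_scope.

Definition is_dirichlet_char (q : Z) (chi : Z -> C) : Prop :=
  (1 <= q)%Z /\
  (forall m n : Z, chi (m * n)%Z = Cmult (chi m) (chi n)) /\
  (forall n : Z, chi (n + q)%Z = chi n) /\
  (forall n : Z, chi n = RtoC 0 <-> Z.gcd n q <> 1%Z) /\
  chi 1%Z = RtoC 1.

Definition is_principal (q : Z) (chi : Z -> C) : Prop :=
  forall n : Z, Z.gcd n q = 1%Z -> chi n = RtoC 1.

Definition is_even_char (chi : Z -> C) : Prop := chi (-1)%Z = RtoC 1.

(** Primitive: chi is not induced by a character of a proper divisor modulus d,
    i.e. for no d | q with d < q is chi(n) = 1 for all n coprime to q with n = 1 mod d. *)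
Definition is_primitive (q : Z) (chi : Z -> C) : Prop :=
  forall d : Z, (1 <= d)%Z -> (d | q)%Z -> (d < q)%Z ->
    exists n : Z, Z.gcd n q = 1%Z /\ (n mod d = 1 mod d)%Z /\ chi n <> RtoC 1.

Definition conj_char (chi : Z -> C) : Z -> C := fun n => Cconj (chi n).

Definition d_chi (chi : Z -> C) (n : nat) : C :=
  fold_right Cplus (RtoC 0)
    (map (fun d => chi (Z.of_nat d))
       (filter (fun d => Nat.eqb (n mod d) 0) (seq 1 n))).

Definition e_q (q : Z) (h : nat) : C :=
  (cos (2 * PI * INR h / IZR q), sin (2 * PI * INR h / IZR q)).

Definition gauss_sum (q : Z) (chi : Z -> C) : C :=
  fold_right Cplus (RtoC 0)
    (map (fun h => Cmult (chi (Z.of_nat h)) (e_q q h)) (seq 1 (Z.to_nat q))).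

Definition CSeries (a : nat -> C) : C :=
  (Series (fun n => fst (a n)), Series (fun n => snd (a n))).

(** L(1, chi) = sum_{n >= 1} chi(n)/n (convergent for non-principal chi). *)
Definition L1 (chi : Z -> C) : C :=
  CSeries (fun n => Cdiv (chi (Z.of_nat (S n))) (RtoC (INR (S n)))).

Definition K0 (x : R) : R :=
  RInt_gen (fun t => exp (- x * cosh t)) (at_point 0) (Rbar_locally p_infty).

(* Main.v *)
Require Import Defs.
From Stdlib Require Import Reals ZArith Znumtheory.
From Stdlib Require Import Lra Lia Psatz List Permutation FinFun Classical.
From Coquelicot Require Import Coquelicot.
Open Scope R_scope.

(**
  Write α = a √x / 2, A(y) = Σ χ(d) e^{-dy} and B(w) = 1/(e^w - 1).  From
  K_0(2α √(dm)) = ½ ∫_ℝ exp(-α(d e^s + m e^{-s})) ds the left-hand side is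
  ½ ∫_ℝ A(α e^s) B(α e^{-s}) ds.  The partial fraction expansion
  B(w) = 1/w - 1/2 + Σ_k 2w/(w² + 4π²k²) splits this integral into three.  The first
  is a multiple of ∫ A, which is L(1, χ).  For the others, the Gauss sum identity
  q χ(d) = τ(χ) Σ_h χ̄(h) cos(2πhd/q) gives
  A(y) = (τ(χ)/q) Σ_n χ̄(n) 2y/(y² + (2πn/q)²); the second integral is then a
  sum of arctangents, equal to a multiple of τ(χ) L(1, χ̄), and the third a double
  series whose (n, k) term integrates to an elementary logarithm depending only on nk.
  The character enters only through a pair (u, v) of real sequences, the real or the
  imaginary parts of χ and of τ(χ) χ̄.
*)

(** The delicate point is each exchange of sum and integral, and the series are of two kinds. The
    double series for $A B$ and for $A$ times the regular part of $B$ have a majorant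
    [wt d * wt m * / cosh (s / 2)] up to a constant, with $n^{-3/2}$ weights, so grouping by $n =
    dm$ is a Dirichlet convolution of absolutely convergent series. The terms $1/w$ and $-1/2$ of
    $B$ instead give $u(n)/n$ and $v(n)/n$, in general only conditionally summable; there summation
    by parts bounds the tail of the integrand by $2C f_N(s)$, where the integral of $f_N$ tends to
    0. Hence these two terms are split off before the third expansion.

    The excluded values of the parameter are the zeros of the denominators: the $(n,k)$ integral has
    denominator proportional to $(nk)^2 - c^2$.

    The factor $\tau(\chi)$ is kept inside $v$ because the cosine kernel is real: the identity
    between $\chi$ and $\tau(\chi)\bar\chi$ then splits into real and imaginary parts, whereas the
    parts of $\bar\chi$ alone would be mixed by the complex factor. Division by $\tau(\chi) \neq 0$
    comes only at the end. *)

(** * Finite sums over lists and real series *)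

Definition rsum {A : Type} (f : A -> R) (l : list A) : R :=
  fold_right Rplus 0 (map f l).

Lemma rsum_cons {A} (f : A -> R) a l : rsum f (a :: l) = f a + rsum f l.
Proof. reflexivity. Qed.

Lemma rsum_app {A} (f : A -> R) l1 l2 : rsum f (l1 ++ l2) = rsum f l1 + rsum f l2.
Proof.
  induction l1 as [|a l1 IH]; simpl; [unfold rsum at 2; simpl; lra|].
  rewrite !rsum_cons, IH; lra.
Qed.

Lemma rsum_ext {A} (f g : A -> R) l :
  (forall a, In a l -> f a = g a) -> rsum f l = rsum g l.
Proof.
  intros H; induction l as [|a l IH]; [reflexivity|].
  rewrite !rsum_cons, IH, H; simpl; auto.
  intros b Hb; apply H; simpl; auto.
Qed.

Lemma rsum_plus {A} (f g : A -> R) l : rsum (fun a => f a + g a) l = rsum f l + rsum g l.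
Proof. induction l as [|a l IH]; [unfold rsum; simpl; lra|]. rewrite !rsum_cons, IH; lra. Qed.

Lemma rsum_scal {A} c (f : A -> R) l : rsum (fun a => c * f a) l = c * rsum f l.
Proof. induction l as [|a l IH]; [unfold rsum; simpl; lra|]. rewrite !rsum_cons, IH; lra. Qed.

Lemma rsum_scal_r {A} c (f : A -> R) l : rsum (fun a => f a * c) l = rsum f l * c.
Proof. induction l as [|a l IH]; [unfold rsum; simpl; lra|]. rewrite !rsum_cons, IH; lra. Qed.

Lemma rsum_0 {A} (l : list A) : rsum (fun _ => 0) l = 0.
Proof. induction l as [|a l IH]; [reflexivity|]. rewrite rsum_cons, IH; lra. Qed.

Lemma rsum_le {A} (f g : A -> R) l :
  (forall a, In a l -> f a <= g a) -> rsum f l <= rsum g l.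
Proof.
  intros H; induction l as [|a l IH]; [unfold rsum; simpl; lra|].
  rewrite !rsum_cons; apply Rplus_le_compat; [apply H; simpl; auto|].
  apply IH; intros b Hb; apply H; simpl; auto.
Qed.

Lemma rsum_pos {A} (f : A -> R) l : (forall a, In a l -> 0 <= f a) -> 0 <= rsum f l.
Proof. intros H; rewrite <- (rsum_0 l); now apply rsum_le. Qed.

Lemma rsum_Rabs {A} (f : A -> R) l : Rabs (rsum f l) <= rsum (fun a => Rabs (f a)) l.
Proof.
  induction l as [|a l IH]; [unfold rsum; simpl; rewrite Rabs_R0; lra|].
  rewrite !rsum_cons. eapply Rle_trans; [apply Rabs_triang|lra].
Qed.

Lemma rsum_swap {A B} (f : A -> B -> R) l m :
  rsum (fun a => rsum (f a) m) l = rsum (fun b => rsum (fun a => f a b) l) m.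
Proof.
  induction l as [|a l IH].
  - unfold rsum at 1; simpl. symmetry. apply rsum_0.
  - rewrite rsum_cons, IH, <- rsum_plus. apply rsum_ext; intros b _; now rewrite rsum_cons.
Qed.

Lemma rsum_filter {A} (p : A -> bool) (f : A -> R) l :
  rsum f (filter p l) = rsum (fun a => if p a then f a else 0) l.
Proof.
  induction l as [|a l IH]; [reflexivity|]; simpl.
  destruct (p a) eqn:E; rewrite !rsum_cons, E, IH; lra.
Qed.

Lemma rsum_map {A B} (h : A -> B) (f : B -> R) l :
  rsum f (map h l) = rsum (fun a => f (h a)) l.
Proof. unfold rsum; now rewrite map_map. Qed.

Lemma rsum_seq_S (f : nat -> R) s n : rsum f (seq s (S n)) = rsum f (seq s n) + f (s + n)%nat.
Proof. rewrite seq_S, rsum_app. unfold rsum at 2; simpl; lra. Qed.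

Lemma rsum_shift (f : nat -> R) s n :
  rsum f (seq (S s) n) = rsum (fun k => f (S k)) (seq s n).
Proof. now rewrite <- seq_shift, rsum_map. Qed.

Lemma sum_n_rsum (f : nat -> R) n : sum_n f n = rsum f (seq 0 (S n)).
Proof.
  induction n as [|n IH].
  - rewrite sum_O; unfold rsum; simpl; lra.
  - rewrite sum_Sn, IH, (rsum_seq_S f 0 (S n)); reflexivity.
Qed.

Lemma is_series_rsum (f : nat -> R) l :
  is_series f l <-> is_lim_seq (fun n => rsum f (seq 0 n)) l.
Proof.
  rewrite (is_lim_seq_incr_1 (fun n => rsum f (seq 0 n))).
  unfold is_series. split; intros H.
  - apply (is_lim_seq_ext (sum_n f)); [apply sum_n_rsum|exact H].
  - apply (is_lim_seq_ext _ (sum_n f)) in H; [exact H|]. intros n; symmetry; apply sum_n_rsum.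
Qed.

Lemma is_series_ext_R (a b : nat -> R) (l : R) :
  (forall n, a n = b n) -> is_series a l -> is_series b l.
Proof. apply is_series_ext. Qed.

Lemma is_lim_seq_Rabs_iff (f : nat -> R) (l : R) :
  is_lim_seq f l <->
  forall eps, 0 < eps -> exists N, forall n, (N <= n)%nat -> Rabs (f n - l) < eps.
Proof.
  rewrite <- is_lim_seq_spec. simpl. split.
  - intros H eps He. exact (H (mkposreal eps He)).
  - intros H eps. exact (H eps (cond_pos eps)).
Qed.

Lemma rsum_le_Series (f : nat -> R) l n :
  (forall k, 0 <= f k) -> is_series f l -> rsum f (seq 0 n) <= l.
Proof.
  intros Hf H. apply is_series_rsum in H.
  apply (is_lim_seq_incr_compare _ l H).
  intros m; rewrite (rsum_seq_S f 0 m). generalize (Hf (0 + m)%nat); lra.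
Qed.

Lemma ex_series_bounded (f : nat -> R) K :
  (forall k, 0 <= f k) -> (forall n, rsum f (seq 0 n) <= K) -> ex_series f.
Proof.
  intros Hf HK.
  destruct (ex_finite_lim_seq_incr (fun n => rsum f (seq 0 n)) K) as [l Hl].
  - intros n; rewrite (rsum_seq_S f 0 n); generalize (Hf (0 + n)%nat); lra.
  - exact HK.
  - exists l; now apply is_series_rsum.
Qed.

Lemma Series_tail (f : nat -> R) l :
  is_series f l ->
  is_lim_seq (fun N => l - rsum f (seq 0 N)) 0.
Proof.
  intros H; apply is_series_rsum in H.
  replace (Finite 0) with (Rbar_plus l (- l)) by (simpl; f_equal; lra).
  apply (is_lim_seq_plus' (fun _ => l) (fun N => - rsum f (seq 0 N)) l (- l)).
  - apply is_lim_seq_const.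
  - now apply is_lim_seq_opp in H.
Qed.

(** * Dirichlet convolution *)

Definition divisors (n : nat) : list nat :=
  filter (fun d => Nat.eqb (n mod d) 0) (seq 1 n).

Definition dconv (x y : nat -> R) (n : nat) : R :=
  rsum (fun d => x d * y (n / d)%nat) (divisors n).

Lemma in_divisors n d : In d (divisors n) -> exists m, (1 <= d /\ 1 <= m /\ n = d * m /\ n / d = m)%nat.
Proof.
  unfold divisors. rewrite filter_In, in_seq, Nat.eqb_eq. intros [[H1 H2] H3].
  apply Nat.Div0.mod_divides in H3. destruct H3 as [m Hm]. exists m.
  assert (m <> 0)%nat by (intros ->; lia).
  repeat split; try lia. rewrite Hm. rewrite Nat.mul_comm. apply Nat.div_mul. lia.
Qed.

Lemma rsum_multiples (g : nat -> R) d M : (1 <= d)%nat ->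
  rsum (fun n => if Nat.eqb (n mod d) 0 then g (n / d)%nat else 0) (seq 1 M)
  = rsum g (seq 1 (M / d)).
Proof.
  intros Hd. induction M as [|M IH].
  - rewrite Nat.Div0.div_0_l. reflexivity.
  - rewrite rsum_seq_S, IH. replace (1 + M)%nat with (S M) by lia.
    pose proof (Nat.div_mod_eq M d) as E1. pose proof (Nat.div_mod_eq (S M) d) as E2.
    pose proof (Nat.mod_upper_bound M d ltac:(lia)) as B1.
    pose proof (Nat.mod_upper_bound (S M) d ltac:(lia)) as B2.
    set (p := (M / d)%nat) in *. set (p' := (S M / d)%nat) in *.
    destruct (Nat.eqb_spec (S M mod d) 0) as [E|E].
    + assert (p' = S p) by nia. rewrite H, rsum_seq_S. f_equal.
    + assert (p' = p) by nia. rewrite H. lra.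
Qed.

Lemma rsum_seq_split (f : nat -> R) s n m :
  rsum f (seq s (n + m)) = rsum f (seq s n) + rsum f (seq (s + n) m).
Proof. now rewrite seq_app, rsum_app. Qed.

(* The hyperbola sum over d m <= M is read as a sum over d of partial sums of y. *)
Lemma rsum_dconv x y M :
  rsum (dconv x y) (seq 1 M) = rsum (fun d => x d * rsum y (seq 1 (M / d))) (seq 1 M).
Proof.
  transitivity (rsum (fun n => rsum (fun d => x d *
     (if Nat.eqb (n mod d) 0 then y (n / d)%nat else 0)) (seq 1 M)) (seq 1 M)).
  - apply rsum_ext; intros n Hn; apply in_seq in Hn.
    unfold dconv, divisors. rewrite rsum_filter.
    replace M with (n + (M - n))%nat by lia. rewrite rsum_seq_split.
    rewrite (rsum_ext _ (fun _ => 0) (seq (1 + n) (M - n))).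
    2:{ intros d Hd; apply in_seq in Hd. rewrite Nat.mod_small by lia.
        destruct (Nat.eqb_spec n 0); [lia|lra]. }
    rewrite rsum_0, Rplus_0_r. apply rsum_ext; intros d _.
    destruct (Nat.eqb _ _); lra.
  - rewrite rsum_swap. apply rsum_ext; intros d Hd; apply in_seq in Hd.
    rewrite rsum_scal. f_equal. apply rsum_multiples; lia.
Qed.

Lemma is_lim_seq_bounded (f : nat -> R) (l : R) :
  is_lim_seq f l -> exists B, 0 < B /\ forall n, Rabs (f n) <= B.
Proof.
  intros H. destruct (filterlim_bounded f) as [B HB].
  { exists l. exact H. }
  exists (Rabs B + 1). split; [generalize (Rabs_pos B); lra|].
  intros n. eapply Rle_trans; [apply HB|]. generalize (Rle_abs B); lra.
Qed.

(** Analogue of Mertens' theorem. For $d \le D$ the inner partial sum of [y] up to $n/d$ is close to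
    [Y]; for $d > D$ it is merely bounded, but the tail of $\sum |x|$ is small. *)
Lemma is_series_dconv (x y : nat -> R) X Y :
  ex_series (fun n => Rabs (x (S n))) ->
  is_series (fun n => x (S n)) X -> is_series (fun n => y (S n)) Y ->
  is_series (fun n => dconv x y (S n)) (X * Y).
Proof.
  intros [Z HZ] HX HY.
  apply is_series_rsum. apply is_series_rsum in HX. apply is_series_rsum in HY.
  assert (Hsh : forall f n, rsum (fun k => f (S k)) (seq 0 n) = rsum f (seq 1 n))
    by (intros; symmetry; apply rsum_shift).
  apply (is_lim_seq_ext (fun n => rsum (fun d => x d * (rsum y (seq 1 (n / d)) - Y)) (seq 1 n)
     + rsum (fun k => x (S k)) (seq 0 n) * Y)).
  { intros n. rewrite !Hsh, rsum_dconv.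
    rewrite <- rsum_scal_r, <- rsum_plus. apply rsum_ext; intros d _; ring. }
  replace (X * Y) with (0 + X * Y) by ring.
  apply is_lim_seq_plus'; [|apply (is_lim_seq_scal_r _ Y X), HX].
  set (y' := fun n => rsum (fun k => y (S k)) (seq 0 n) - Y).
  assert (Hy' : is_lim_seq y' 0).
  { replace (Finite 0) with (Rbar_plus Y (- Y)) by (simpl; f_equal; lra).
    apply (is_lim_seq_plus' _ _ Y (- Y)); [exact HY|apply is_lim_seq_const]. }
  destruct (is_lim_seq_bounded _ _ Hy') as [B [HB0 HB]].
  assert (HZ0 : 0 <= Z).
  { eapply Rle_trans; [|apply (rsum_le_Series _ Z 0 (fun k => Rabs_pos _) HZ)].
    unfold rsum; simpl; lra. }
  apply is_lim_seq_Rabs_iff. intros eps He.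
  pose proof (Series_tail _ _ HZ) as HT.
  rewrite is_lim_seq_Rabs_iff in HT.
  destruct (HT (eps / (2 * B))) as [D HD].
  { apply Rdiv_lt_0_compat; lra. }
  rewrite is_lim_seq_Rabs_iff in Hy'.
  destruct (Hy' (eps / (2 * (Z + 1)))) as [K HK].
  { apply Rdiv_lt_0_compat; lra. }
  (* This threshold makes $n/d \ge K$ for every $d \le D$ at once. *)
  exists (S D * S K)%nat. intros n Hn. rewrite Rminus_0_r.
  eapply Rle_lt_trans; [apply rsum_Rabs|].
  assert (HDn : (D <= n)%nat) by nia.
  replace (seq 1 n) with (seq 1 (D + (n - D))) by (f_equal; lia). rewrite rsum_seq_split.
  assert (Hd : forall d, (rsum y (seq 1 (n / d)) - Y) = y' (n / d)%nat)
    by (intros d; unfold y'; now rewrite Hsh).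
  apply Rle_lt_trans with
    (rsum (fun d => Rabs (x d) * (eps / (2 * (Z + 1)))) (seq 1 D)
     + rsum (fun d => Rabs (x d) * B) (seq (1 + D) (n - D))).
  - apply Rplus_le_compat; apply rsum_le; intros d Hin; apply in_seq in Hin;
      rewrite Rabs_mult, Hd; apply Rmult_le_compat_l; try apply Rabs_pos.
    + left. replace (y' (n / d)%nat) with (y' (n / d)%nat - 0) by ring. apply HK.
      apply Nat.div_le_lower_bound; nia.
    + apply HB.
  - rewrite !rsum_scal_r.
    assert (E1 : rsum (fun d => Rabs (x d)) (seq 1 D) <= Z).
    { rewrite <- Hsh. apply rsum_le_Series; [intros; apply Rabs_pos|exact HZ]. }
    assert (E2 : rsum (fun d => Rabs (x d)) (seq (1 + D) (n - D)) < eps / (2 * B)).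
    { assert (E3 : rsum (fun d => Rabs (x d)) (seq 1 n) <= Z).
      { rewrite <- Hsh. apply rsum_le_Series; [intros; apply Rabs_pos|exact HZ]. }
      specialize (HD D (le_n _)). rewrite (Hsh (fun d => Rabs (x d))), Rminus_0_r in HD.
      apply Rabs_def2 in HD.
      replace n with (D + (n - D))%nat in E3 by lia. rewrite rsum_seq_split in E3. lra. }
    apply Rle_lt_trans with (Z * (eps / (2 * (Z + 1))) + rsum (fun d => Rabs (x d)) (seq (1 + D) (n - D)) * B).
    + apply Rplus_le_compat_r. apply Rmult_le_compat_r; [|exact E1].
      left; apply Rdiv_lt_0_compat; lra.
    + apply Rlt_le_trans with (Z * (eps / (2 * (Z + 1))) + eps / (2 * B) * B).
      * apply Rplus_lt_compat_l. apply Rmult_lt_compat_r; lra.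
      * replace (eps / (2 * B) * B) with (eps / 2) by (field; lra).
        replace (Z * (eps / (2 * (Z + 1)))) with (eps / 2 * (Z / (Z + 1))) by (field; lra).
        assert (Z / (Z + 1) <= 1).
        { apply Rmult_le_reg_r with (Z + 1); [lra|]. unfold Rdiv; rewrite Rmult_assoc, Rinv_l; lra. }
        nra.
Qed.

(** * Summation by parts *)

Lemma rsum_abel (w f : nat -> R) N n :
  rsum (fun k => w k * f k) (seq N n)
  = rsum w (seq N n) * f (N + n)%nat
    + rsum (fun k => rsum w (seq N (S (k - N))) * (f k - f (S k))) (seq N n).
Proof.
  induction n as [|n IH]; [unfold rsum; simpl; lra|].
  rewrite !(rsum_seq_S _ N n), IH.
  replace (N + n - N)%nat with n by lia.
  rewrite (rsum_seq_S w N n). replace (N + S n)%nat with (S (N + n)) by lia. ring.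
Qed.

(** The factor 2 arises because a block of [w] starting at [N] is a difference of two partial sums
    from 0; after Abel summation the decrements of [f] telescope to at most [f N]. *)
Lemma dirichlet_bound (w f : nat -> R) C N n :
  (forall k, Rabs (rsum w (seq 0 k)) <= C) ->
  (forall k, 0 <= f k) -> (forall k, f (S k) <= f k) ->
  Rabs (rsum (fun k => w k * f k) (seq N n)) <= 2 * C * f N.
Proof.
  intros HC Hf Hd.
  assert (HP : forall k, Rabs (rsum w (seq N k)) <= 2 * C).
  { intros k. pose proof (HC N) as H1. pose proof (HC (N + k)%nat) as H2.
    rewrite rsum_seq_split in H2. simpl in H2.
    replace (rsum w (seq N k)) with
      ((rsum w (seq 0 N) + rsum w (seq N k)) - rsum w (seq 0 N)) by ring.
    eapply Rle_trans; [apply Rabs_triang|]. rewrite Rabs_Ropp. lra. }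
  assert (HC0 : 0 <= 2 * C) by (eapply Rle_trans; [apply Rabs_pos|apply (HP 0%nat)]).
  rewrite rsum_abel. eapply Rle_trans; [apply Rabs_triang|].
  assert (T : forall m, rsum (fun k => f k - f (S k)) (seq N m) = f N - f (N + m)%nat).
  { induction m as [|m IH]; [unfold rsum; simpl; rewrite Nat.add_0_r; lra|].
    rewrite rsum_seq_S, IH. replace (N + S m)%nat with (S (N + m)) by lia. ring. }
  replace (2 * C * f N) with (2 * C * f (N + n)%nat + 2 * C * (f N - f (N + n)%nat)) by ring.
  rewrite <- T, <- rsum_scal.
  apply Rplus_le_compat.
  - rewrite Rabs_mult, (Rabs_pos_eq (f _)) by apply Hf.
    apply Rmult_le_compat_r; [apply Hf|apply HP].
  - eapply Rle_trans; [apply rsum_Rabs|]. apply rsum_le; intros k _.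
    rewrite Rabs_mult, (Rabs_pos_eq (_ - _)) by (generalize (Hd k); lra).
    apply Rmult_le_compat_r; [generalize (Hd k); lra|apply HP].
Qed.

Lemma ex_series_dirichlet (w f : nat -> R) C :
  (forall k, Rabs (rsum w (seq 0 k)) <= C) ->
  (forall k, 0 <= f k) -> (forall k, f (S k) <= f k) -> is_lim_seq f 0 ->
  ex_series (fun k => w k * f k).
Proof.
  intros HC Hf Hd H0.
  destruct (proj2 (ex_lim_seq_cauchy_corr (fun n => rsum (fun k => w k * f k) (seq 0 n))))
    as [l Hl].
  2:{ exists l. now apply is_series_rsum. }
  intros eps.
  assert (HC0 : 0 <= C) by (eapply Rle_trans; [apply Rabs_pos|apply (HC 0%nat)]).
  rewrite is_lim_seq_Rabs_iff in H0.
  destruct (H0 (eps / (2 * C + 1))) as [N HN].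
  { apply Rdiv_lt_0_compat; [apply cond_pos|lra]. }
  assert (G : forall n m, (N <= n)%nat -> (n <= m)%nat ->
     Rabs (rsum (fun k => w k * f k) (seq 0 m) - rsum (fun k => w k * f k) (seq 0 n)) < eps).
  { intros n m Hn Hm. replace m with (n + (m - n))%nat by lia. rewrite rsum_seq_split. simpl.
    match goal with |- Rabs ?t < _ =>
      replace t with (rsum (fun k => w k * f k) (seq n (m - n))) by ring end.
    eapply Rle_lt_trans; [apply (dirichlet_bound w f C); auto|].
    specialize (HN n Hn). rewrite Rminus_0_r, Rabs_pos_eq in HN by apply Hf.
    apply Rmult_lt_compat_r with (r := 2 * C + 1) in HN; [|lra].
    unfold Rdiv in HN; rewrite Rmult_assoc, Rinv_l in HN by lra.
    generalize (Hf n); nra. }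
  exists N. intros n m Hn Hm. destruct (Nat.le_ge_cases n m) as [H|H].
  - rewrite Rabs_minus_sym. now apply G.
  - now apply G.
Qed.

Lemma dirichlet_tail (w f : nat -> R) C l N :
  (forall k, Rabs (rsum w (seq 0 k)) <= C) ->
  (forall k, 0 <= f k) -> (forall k, f (S k) <= f k) ->
  is_series (fun k => w k * f k) l ->
  Rabs (l - rsum (fun k => w k * f k) (seq 0 N)) <= 2 * C * f N.
Proof.
  intros HC Hf Hd Hl. apply is_series_rsum in Hl.
  apply (is_lim_seq_incr_n _ N) in Hl.
  apply (is_lim_seq_le (fun n => Rabs (rsum (fun k => w k * f k) (seq 0 (n + N))
      - rsum (fun k => w k * f k) (seq 0 N))) (fun _ => 2 * C * f N)
      (Rabs (l - rsum (fun k => w k * f k) (seq 0 N))) (2 * C * f N)).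
  - intros n. rewrite Nat.add_comm, rsum_seq_split. simpl.
    match goal with |- Rabs ?t <= _ =>
      replace t with (rsum (fun k => w k * f k) (seq N n)) by ring end.
    now apply dirichlet_bound.
  - apply (is_lim_seq_abs _ (Finite (l - _))). apply is_lim_seq_minus'; [exact Hl|apply is_lim_seq_const].
  - apply is_lim_seq_const.
Qed.

(** * Improper integrals over the real line *)

(** The two endpoints tend to infinity independently, so that the integral is invariant under
    translation. Continuity is bundled in so that every [RInt] over a bounded interval exists. *)
Definition is_intR (f : R -> R) (l : R) : Prop :=
  (forall s, continuous f s) /\
  forall eps, 0 < eps -> exists M, 0 <= M /\
    forall a b, a <= - M -> M <= b -> Rabs (RInt f a b - l) < eps.

Lemma ex_RInt_everywhere_continuous (f : R -> R) a b :
  (forall s, continuous f s) -> ex_RInt f a b.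
Proof. intros H; apply (ex_RInt_continuous (V := R_CompleteNormedModule)); auto. Qed.

Lemma is_intR_ext f g l : (forall s, f s = g s) -> is_intR f l -> is_intR g l.
Proof.
  intros E [Hc H]. split.
  - intros s. apply (continuous_ext f); auto.
  - intros eps He. destruct (H eps He) as [M [HM0 HM]]. exists M; split; auto.
    intros a b Ha Hb. rewrite <- (RInt_ext f g) by auto. auto.
Qed.

Lemma is_intR_unique f l l' : is_intR f l -> is_intR f l' -> l = l'.
Proof.
  intros [_ H] [_ H']. apply Rminus_diag_uniq. apply NNPP; intros Hn.
  assert (He : 0 < Rabs (l - l') / 2) by (generalize (Rabs_pos_lt _ Hn); lra).
  destruct (H _ He) as [M [HM0 HM]], (H' _ He) as [M' [HM0' HM']].
  pose proof (Rmax_l M M'). pose proof (Rmax_r M M').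
  specialize (HM (- Rmax M M') (Rmax M M') ltac:(lra) ltac:(lra)).
  specialize (HM' (- Rmax M M') (Rmax M M') ltac:(lra) ltac:(lra)).
  set (I := RInt f _ _) in *.
  assert (Rabs (l - l') <= Rabs (I - l) + Rabs (I - l')).
  { replace (l - l') with (- (I - l) + (I - l')) by ring.
    eapply Rle_trans; [apply Rabs_triang|]. rewrite Rabs_Ropp; lra. }
  lra.
Qed.

Lemma is_intR_plus f g lf lg :
  is_intR f lf -> is_intR g lg -> is_intR (fun s => f s + g s) (lf + lg).
Proof.
  intros [Cf Hf] [Cg Hg]. split.
  - intros s. apply (continuous_plus f g); auto.
  - intros eps He.
    destruct (Hf (eps / 2)) as [M [HM0 HM]]; [lra|].
    destruct (Hg (eps / 2)) as [M' [HM0' HM']]; [lra|].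
    pose proof (Rmax_l M M'). pose proof (Rmax_r M M').
    exists (Rmax M M'); split; [lra|]. intros a b Ha Hb.
    specialize (HM a b ltac:(lra) ltac:(lra)). specialize (HM' a b ltac:(lra) ltac:(lra)).
    assert (E : RInt (fun s => f s + g s) a b = RInt f a b + RInt g a b)
      by (apply (RInt_plus f g); now apply ex_RInt_everywhere_continuous).
    rewrite E.
    replace (RInt f a b + RInt g a b - (lf + lg))
      with ((RInt f a b - lf) + (RInt g a b - lg)) by ring.
    eapply Rle_lt_trans; [apply Rabs_triang|lra].
Qed.

Lemma is_intR_scal k f l : is_intR f l -> is_intR (fun s => k * f s) (k * l).
Proof.
  intros [Cf Hf]. split.
  - intros s. apply (continuous_scal_r k f); auto.
  - intros eps He. assert (Hk := Rabs_pos k).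
    destruct (Hf (eps / (Rabs k + 1))) as [M [HM0 HM]]; [apply Rdiv_lt_0_compat; lra|].
    exists M; split; auto. intros a b Ha Hb. specialize (HM a b Ha Hb).
    assert (E : RInt (fun s => k * f s) a b = k * RInt f a b)
      by (apply (RInt_scal f); now apply ex_RInt_everywhere_continuous).
    rewrite E, <- Rmult_minus_distr_l, Rabs_mult.
    apply Rmult_lt_compat_r with (r := Rabs k + 1) in HM; [|lra].
    unfold Rdiv in HM; rewrite Rmult_assoc, Rinv_l in HM by lra.
    generalize (Rabs_pos (RInt f a b - l)); nra.
Qed.

Lemma is_intR_0 : is_intR (fun _ => 0) 0.
Proof.
  split; [intros s; apply continuous_const|].
  intros eps He; exists 0; split; [lra|]. intros a b _ _.
  rewrite RInt_const. unfold scal; simpl; unfold mult; simpl.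
  rewrite Rmult_0_r, Rminus_0_r, Rabs_R0; exact He.
Qed.

Lemma is_intR_rsum {A} (f : A -> R -> R) (c : A -> R) l :
  (forall a, In a l -> is_intR (f a) (c a)) ->
  is_intR (fun s => rsum (fun a => f a s) l) (rsum c l).
Proof.
  intros H; induction l as [|a l IH]; [apply is_intR_0|].
  apply (is_intR_ext (fun s => f a s + rsum (fun a => f a s) l)); [reflexivity|].
  rewrite rsum_cons. apply is_intR_plus; [apply H; simpl; auto|].
  apply IH; intros b Hb; apply H; simpl; auto.
Qed.

Lemma RInt_Rabs_le (f g : R -> R) a b : a <= b ->
  (forall s, continuous f s) -> (forall s, continuous g s) ->
  (forall s, Rabs (f s) <= g s) -> Rabs (RInt f a b) <= RInt g a b.
Proof.
  intros Hab Cf Cg H.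
  eapply Rle_trans; [apply abs_RInt_le; [exact Hab|now apply ex_RInt_everywhere_continuous]|].
  apply RInt_le; auto; apply ex_RInt_everywhere_continuous; auto.
  intros s; apply continuous_comp; [apply Cf|]. apply continuous_Rabs.
Qed.

Lemma RInt_minus_continuous (f g : R -> R) a b :
  (forall s, continuous f s) -> (forall s, continuous g s) ->
  RInt (fun s => f s - g s) a b = RInt f a b - RInt g a b.
Proof.
  intros Hf Hg. apply (RInt_minus f g); now apply ex_RInt_everywhere_continuous.
Qed.

Lemma RInt_le_is_intR (g : R -> R) L a b : a <= b ->
  (forall s, 0 <= g s) -> is_intR g L -> RInt g a b <= L.
Proof.
  intros Hab Hg [Cg H]. apply Rnot_lt_le; intros Hlt.
  destruct (H (RInt g a b - L)) as [M [HM0 HM]]; [lra|].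
  set (a' := Rmin a (- M)). set (b' := Rmax b M).
  assert (Ha1 : a' <= a) by apply Rmin_l. assert (Ha2 : a' <= - M) by apply Rmin_r.
  assert (Hb1 : b <= b') by apply Rmax_l. assert (Hb2 : M <= b') by apply Rmax_r.
  specialize (HM a' b' Ha2 Hb2).
  assert (E : RInt g a' b' = RInt g a' a + RInt g a b + RInt g b b').
  { assert (E0 := RInt_Chasles g a' a b (ex_RInt_everywhere_continuous g a' a Cg)
       (ex_RInt_everywhere_continuous g a b Cg)).
    assert (E1 := RInt_Chasles g a' b b' (ex_RInt_everywhere_continuous g a' b Cg)
       (ex_RInt_everywhere_continuous g b b' Cg)).
    unfold plus in E0, E1; simpl in E0, E1. lra. }
  assert (0 <= RInt g a' a) by (apply RInt_ge_0; auto; now apply ex_RInt_everywhere_continuous).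
  assert (0 <= RInt g b b') by (apply RInt_ge_0; auto; now apply ex_RInt_everywhere_continuous).
  apply Rabs_def2 in HM. lra.
Qed.

Lemma is_intR_Rabs_le f g lf lg :
  is_intR f lf -> is_intR g lg -> (forall s, Rabs (f s) <= g s) -> Rabs lf <= lg.
Proof.
  intros Hf Hg H. apply Rnot_lt_le; intros Hlt.
  destruct (proj2 Hf (Rabs lf - lg)) as [M [HM0 HM]]; [lra|].
  specialize (HM (- M) M ltac:(lra) ltac:(lra)).
  assert (Rabs (RInt f (- M) M) <= lg).
  { eapply Rle_trans; [apply (RInt_Rabs_le f g); [lra|apply Hf|apply Hg|exact H]|].
    apply RInt_le_is_intR; [lra| |exact Hg].
    intros s; eapply Rle_trans; [apply Rabs_pos|apply H]. }
  assert (Rabs lf <= Rabs (RInt f (- M) M - lf) + Rabs (RInt f (- M) M)).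
  { replace lf with (- (RInt f (- M) M - lf) + RInt f (- M) M) at 1 by ring.
    eapply Rle_trans; [apply Rabs_triang|]. rewrite Rabs_Ropp; lra. }
  lra.
Qed.

(** Plays the role of dominated convergence: the error is majorised by [gn n], whose integral over
    the whole line is [en n], so the error over any bounded interval is at most [en n], uniformly in
    the endpoints. *)
Lemma is_intR_dominated_lim (F : R -> R) (Fn gn : nat -> R -> R) (ln en : nat -> R) (l : R) :
  (forall s, continuous F s) ->
  (forall n, is_intR (Fn n) (ln n)) -> (forall n, is_intR (gn n) (en n)) ->
  (forall n s, Rabs (F s - Fn n s) <= gn n s) ->
  is_lim_seq ln l -> is_lim_seq en 0 ->
  is_intR F l.
Proof.
  intros CF HF Hg Hb Hl He0. split; [exact CF|]. intros eps He.
  rewrite is_lim_seq_Rabs_iff in Hl, He0.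
  destruct (Hl (eps / 3)) as [N1 HN1]; [lra|].
  destruct (He0 (eps / 3)) as [N2 HN2]; [lra|].
  set (n := Nat.max N1 N2).
  specialize (HN1 n ltac:(lia)). specialize (HN2 n ltac:(lia)).
  destruct (HF n) as [Cn Hn]. destruct (Hn (eps / 3)) as [M [HM0 HM]]; [lra|].
  exists M; split; [exact HM0|]. intros a b Ha Hb'. specialize (HM a b Ha Hb').
  assert (D : Rabs (RInt F a b - RInt (Fn n) a b) <= en n).
  { rewrite <- (RInt_minus_continuous F (Fn n)) by auto.
    eapply Rle_trans; [apply (RInt_Rabs_le _ (gn n)); [lra| |apply Hg|auto]|].
    - intros s. apply (continuous_minus F (Fn n)); auto.
    - apply RInt_le_is_intR; [lra| |apply Hg].
      intros s; eapply Rle_trans; [apply Rabs_pos|apply (Hb n)]. }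
  rewrite Rminus_0_r in HN2. pose proof (Rle_abs (en n)).
  replace (RInt F a b - l) with
    ((RInt F a b - RInt (Fn n) a b) + (RInt (Fn n) a b - ln n) + (ln n - l)) by ring.
  eapply Rle_lt_trans; [apply Rabs_triang|].
  eapply Rle_lt_trans; [apply Rplus_le_compat_r, Rabs_triang|]. lra.
Qed.

Lemma is_intR_antiderivative (G f : R -> R) (la lb : R) :
  (forall s, is_derive G s (f s)) -> (forall s, continuous f s) ->
  is_lim G m_infty la -> is_lim G p_infty lb -> is_intR f (lb - la).
Proof.
  intros HG Cf Ha Hb. split; [exact Cf|]. intros eps He.
  apply is_lim_spec in Ha. apply is_lim_spec in Hb.
  assert (He2 : 0 < eps / 2) by lra.
  destruct (Ha (mkposreal _ He2)) as [M1 H1]. destruct (Hb (mkposreal _ He2)) as [M2 H2].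
  simpl in H1, H2.
  exists (Rabs M1 + Rabs M2 + 1). pose proof (Rabs_pos M1). pose proof (Rabs_pos M2).
  split; [lra|]. intros a b Hle Hge.
  pose proof (Rle_abs M2). pose proof (Rle_abs (- M1)). rewrite Rabs_Ropp in H4.
  specialize (H1 a ltac:(lra)). specialize (H2 b ltac:(lra)).
  assert (E : RInt f a b = G b - G a).
  { apply is_RInt_unique. apply (is_RInt_derive G f); auto. }
  rewrite E. replace (G b - G a - (lb - la)) with ((G b - lb) + - (G a - la)) by ring.
  eapply Rle_lt_trans; [apply Rabs_triang|]. rewrite Rabs_Ropp. lra.
Qed.

(** The integrals over $[-M, M]$ increase with $M$ and are bounded by [L]; their supremum is the
    value. This serves $K_0$, where no elementary primitive supplies the limit and the definition by
    [RInt_gen] carries no convergence statement. *)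
Lemma ex_intR_dominated (f g : R -> R) L :
  (forall s, continuous f s) -> (forall s, 0 <= f s <= g s) -> is_intR g L ->
  exists l, is_intR f l.
Proof.
  intros Cf H Hg.
  assert (Hf0 : forall s, 0 <= f s) by (intros s; apply H).
  assert (Hb : forall a b, a <= b -> RInt f a b <= L).
  { intros a b Hab. eapply Rle_trans; [|apply (RInt_le_is_intR g L a b Hab); auto].
    - apply RInt_le; auto; try apply ex_RInt_everywhere_continuous; auto; try apply Hg.
      intros s _; apply H.
    - intros s; destruct (H s); lra. }
  assert (Hmono : forall a b a' b', a' <= a -> a <= b -> b <= b' -> RInt f a b <= RInt f a' b').
  { intros a b a' b' Ha Hab Hb'.
    assert (E0 := RInt_Chasles f a' a b (ex_RInt_everywhere_continuous f a' a Cf)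
       (ex_RInt_everywhere_continuous f a b Cf)).
    assert (E1 := RInt_Chasles f a' b b' (ex_RInt_everywhere_continuous f a' b Cf)
       (ex_RInt_everywhere_continuous f b b' Cf)).
    unfold plus in E0, E1; simpl in E0, E1.
    assert (0 <= RInt f a' a) by (apply RInt_ge_0; auto; now apply ex_RInt_everywhere_continuous).
    assert (0 <= RInt f b b') by (apply RInt_ge_0; auto; now apply ex_RInt_everywhere_continuous).
    lra. }
  destruct (completeness (fun v => exists M, 0 <= M /\ v = RInt f (- M) M)) as [l [Hu Hl]].
  - exists L. intros v [M [HM ->]]. apply Hb; lra.
  - exists (RInt f (- 0) 0), 0. split; [lra|reflexivity].
  - exists l. split; [exact Cf|]. intros eps He.
    assert (Hex : exists M, 0 <= M /\ l - eps < RInt f (- M) M).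
    { apply NNPP; intros Hn. apply (Rlt_irrefl l).
      apply Rle_lt_trans with (l - eps); [|lra]. apply Hl.
      intros v [M [HM ->]]. apply Rnot_lt_le; intros Hlt. apply Hn; exists M; auto. }
    destruct Hex as [M [HM0 HM]]. exists M; split; [exact HM0|]. intros a b Ha Hb'.
    assert (RInt f (- M) M <= RInt f a b) by (apply Hmono; lra).
    assert (RInt f a b <= l).
    { set (K := Rmax (- a) b).
      assert (- a <= K) by apply Rmax_l. assert (b <= K) by apply Rmax_r.
      apply Rle_trans with (RInt f (- K) K); [apply Hmono; lra|].
      apply Hu; exists K; split; [lra|reflexivity]. }
    apply Rabs_def1; lra.
Qed.

Lemma is_intR_shift f l t : is_intR f l -> is_intR (fun s => f (s + t)) l.
Proof.
  intros [Cf H]. split.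
  - intros s. apply (continuous_comp (fun s => s + t) f); [|apply Cf].
    apply (continuous_plus (fun s => s) (fun _ => t)); [apply continuous_id|apply continuous_const].
  - intros eps He. destruct (H eps He) as [M [HM0 HM]].
    exists (M + Rabs t). pose proof (Rabs_pos t). pose proof (Rle_abs t).
    pose proof (Rle_abs (- t)). rewrite Rabs_Ropp in H2.
    split; [lra|]. intros a b Ha Hb.
    assert (E : RInt (fun s => f (s + t)) a b = RInt f (a + t) (b + t)).
    { assert (E0 := RInt_comp_lin f 1 t a b (ex_RInt_everywhere_continuous f _ _ Cf)).
      rewrite !Rmult_1_l in E0. rewrite <- E0. apply RInt_ext; intros s _.
      unfold scal; simpl; unfold mult; simpl. now rewrite !Rmult_1_l. }
    rewrite E. apply HM; lra.
Qed.

Lemma RInt_gen_even (f : R -> R) l :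
  is_intR f l -> (forall s, f (- s) = f s) ->
  RInt_gen f (at_point 0) (Rbar_locally p_infty) = l / 2.
Proof.
  intros [Cf H] Hev. apply is_RInt_gen_unique.
  apply filterlimi_locally. intros [eps He]; simpl.
  destruct (H eps He) as [M [HM0 HM]].
  apply Filter_prod with (fun u => u = 0) (fun b => M < b); [reflexivity|now exists M|].
  intros u b -> Hb. exists (RInt f 0 b). simpl. split.
  - apply (RInt_correct f). now apply ex_RInt_everywhere_continuous.
  - assert (E0 := RInt_Chasles f (- b) 0 b (ex_RInt_everywhere_continuous f _ _ Cf)
       (ex_RInt_everywhere_continuous f _ _ Cf)).
    unfold plus in E0; simpl in E0.
    assert (E1 : RInt f (- b) 0 = RInt f 0 b).
    { apply is_RInt_unique.
      apply (is_RInt_ext (fun y => opp (opp (f (- y))))).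
      { intros y _. now rewrite opp_opp, Hev. }
      rewrite <- (opp_opp (RInt f 0 b)).
      apply (is_RInt_opp (V := R_NormedModule)), (is_RInt_swap (V := R_NormedModule)).
      apply (is_RInt_comp_opp (V := R_NormedModule)).
      rewrite Ropp_0, Ropp_involutive. apply (RInt_correct f).
      now apply ex_RInt_everywhere_continuous. }
    specialize (HM (- b) b ltac:(lra) ltac:(lra)).
    unfold ball; simpl; unfold AbsRing_ball, abs, minus, plus, opp; simpl.
    replace (RInt f 0 b + - (l / 2)) with (/ 2 * (RInt f (- b) b - l)) by lra.
    rewrite Rabs_mult, (Rabs_pos_eq (/ 2)) by lra.
    generalize (Rabs_pos (RInt f (- b) b - l)); lra.
Qed.

(** Every primitive used below is a function of $E = e^{cs}$. Its limit at $-\infty$ is then its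
    value at $E = 0$, and at $+\infty$ one passes to $1/E$ first. *)
Lemma is_lim_comp_exp_m (h : R -> R) c :
  0 < c -> continuous h 0 -> is_lim (fun s => h (exp (c * s))) m_infty (h 0).
Proof.
  intros Hc Hh. unfold is_lim.
  apply (filterlim_comp _ _ _ (fun s => exp (c * s)) h _ (locally 0)); [|exact Hh].
  assert (L : is_lim (fun s => exp (c * s)) m_infty 0); [|exact L].
  apply (is_lim_comp exp (fun s => c * s) m_infty 0 m_infty).
  - apply is_lim_exp_m.
  - assert (L := is_lim_scal_l (fun s => s) c m_infty m_infty (is_lim_id m_infty)).
    assert (E : Rbar_mult c m_infty = m_infty); [|now rewrite E in L].
    simpl. case Rle_dec; intros H; [|exfalso; lra].
    case Rle_lt_or_eq_dec; intros H'; [reflexivity|exfalso; lra].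
  - now exists 0.
Qed.

Lemma is_lim_comp_exp_p (h : R -> R) c :
  0 < c -> continuous h 0 -> is_lim (fun s => h (exp (- (c * s)))) p_infty (h 0).
Proof.
  intros Hc Hh.
  apply (is_lim_ext (fun s => (fun t => h (exp (c * t))) (- s))).
  { intros s; f_equal; f_equal; ring. }
  apply (is_lim_comp (fun t => h (exp (c * t))) (fun s => - s) p_infty (h 0) m_infty).
  - now apply is_lim_comp_exp_m.
  - apply (is_lim_opp (fun s => s) p_infty p_infty), is_lim_id.
  - now exists 0.
Qed.

Lemma exp_le_inv z : 0 < z -> exp (- z) <= / z.
Proof.
  intros Hz. rewrite exp_Ropp. apply Rinv_le_contravar; [exact Hz|].
  generalize (exp_ineq1_le z); lra.
Qed.

Lemma is_lim_atan_exp_m k c : 0 < c -> is_lim (fun s => atan (k * exp (c * s))) m_infty 0.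
Proof.
  intros Hc. replace 0 with (atan (k * 0)) by (rewrite Rmult_0_r; apply atan_0).
  apply (is_lim_comp_exp_m (fun E => atan (k * E))); [exact Hc|].
  apply (ex_derive_continuous (fun E => atan (k * E))). auto_derive. auto.
Qed.

Lemma is_lim_atan_exp_p k c : 0 < k -> 0 < c ->
  is_lim (fun s => atan (k * exp (c * s))) p_infty (PI / 2).
Proof.
  intros Hk Hc.
  apply (is_lim_ext (fun s => PI / 2 - atan (/ k * exp (- (c * s))))).
  { intros s. rewrite exp_Ropp, <- Rinv_mult, atan_inv; [lra|].
    apply Rmult_lt_0_compat; [exact Hk|apply exp_pos]. }
  assert (L := is_lim_comp_exp_p (fun E => PI / 2 - atan (/ k * E)) c Hc).
  cbv beta in L. rewrite Rmult_0_r, atan_0, Rminus_0_r in L. apply L.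
  apply (ex_derive_continuous (fun E => PI / 2 - atan (/ k * E))). auto_derive. auto.
Qed.

(** * The integral representation of $K_0$ over the real line *)

Lemma cosh_ge_1 s : 1 <= cosh s.
Proof.
  unfold cosh. generalize (exp_pos s) (exp_pos (- s)). intros H1 H2.
  assert (exp s * exp (- s) = 1) by (rewrite <- exp_plus, Rplus_opp_r; apply exp_0).
  generalize (pow2_ge_0 (exp s - exp (- s))); nra.
Qed.

Lemma cosh_double s : cosh s = 2 * cosh (s / 2) ^ 2 - 1.
Proof.
  unfold cosh. replace s with (s / 2 + s / 2) at 1 by field.
  replace (- s) with (- (s / 2) + - (s / 2)) by field. rewrite !exp_plus.
  assert (exp (s / 2) * exp (- (s / 2)) = 1) by (rewrite <- exp_plus, Rplus_opp_r; apply exp_0).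
  nra.
Qed.

Lemma cosh_half_le s : cosh (s / 2) <= cosh s.
Proof.
  rewrite (cosh_double s). generalize (cosh_ge_1 (s / 2)); nra.
Qed.

Lemma continuous_sech_half s : continuous (fun s => / cosh (s / 2)) s.
Proof.
  apply (ex_derive_continuous (fun s => / cosh (s / 2))). auto_derive.
  generalize (cosh_ge_1 (s / 2)). unfold Rdiv. lra.
Qed.

(** This is the one integrable profile in [s] behind all absolute majorants. The half argument is
    dictated by [lorentz_denominators], where only $\sqrt y + \sqrt w$ can be spared for decay in
    [s]. *)
Lemma is_intR_sech_half : is_intR (fun s => / cosh (s / 2)) (2 * PI).
Proof.
  replace (2 * PI) with (4 * (PI / 2) - 4 * 0) by field.
  apply (is_intR_antiderivative (fun s => 4 * atan (1 * exp (/ 2 * s)))).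
  - intros s. auto_derive; [auto|]. unfold cosh, Rsqr.
    replace (- (s / 2)) with (- (/ 2 * s)) by field. replace (s / 2) with (/ 2 * s) by field.
    rewrite exp_Ropp. assert (H := exp_pos (/ 2 * s)). field; repeat split; apply Rgt_not_eq; nra.
  - apply continuous_sech_half.
  - apply (is_lim_scal_l _ 4 m_infty 0). apply is_lim_atan_exp_m; lra.
  - apply (is_lim_scal_l _ 4 p_infty (PI / 2)). apply is_lim_atan_exp_p; lra.
Qed.

Lemma is_intR_K0_cosh y : 0 < y -> is_intR (fun s => exp (- (y * cosh s))) (2 * K0 y).
Proof.
  intros Hy.
  destruct (ex_intR_dominated (fun s => exp (- (y * cosh s))) (fun s => / y * / cosh (s / 2)) (/ y * (2 * PI)))
    as [l Hl].
  - intros s. apply (ex_derive_continuous (fun s => exp (- (y * cosh s)))). auto_derive. auto.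
  - intros s. split; [left; apply exp_pos|].
    assert (H1 := cosh_ge_1 (s / 2)). assert (H2 := cosh_half_le s).
    eapply Rle_trans; [apply exp_le_inv|]; [nra|].
    rewrite <- Rinv_mult. apply Rinv_le_contravar; nra.
  - apply is_intR_scal, is_intR_sech_half.
  - replace (2 * K0 y) with l; [exact Hl|]. unfold K0.
    assert (E' : RInt_gen (fun t => exp (- y * cosh t)) (at_point 0) (Rbar_locally p_infty) = l / 2).
    { apply RInt_gen_even.
      - revert Hl. apply is_intR_ext. intros s. f_equal; ring.
      - intros s. f_equal. f_equal. unfold cosh. rewrite Ropp_involutive. lra. }
    rewrite E'. field.
Qed.

(** Completing to a hyperbolic cosine: $d e^s + m e^{-s} = 2\sqrt{dm}\,\cosh(s + \ln\sqrt{d/m})$,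
    and the integral over the line does not see the shift. *)
Lemma is_intR_K0 al d m : 0 < al -> 0 < d -> 0 < m ->
  is_intR (fun s => exp (- (al * (d * exp s + m * exp (- s))))) (2 * K0 (2 * al * sqrt (d * m))).
Proof.
  intros Ha Hd Hm.
  assert (HD := sqrt_lt_R0 d Hd). assert (HM := sqrt_lt_R0 m Hm).
  assert (ED := sqrt_sqrt d ltac:(lra)). assert (EM := sqrt_sqrt m ltac:(lra)).
  rewrite sqrt_mult by lra. set (D := sqrt d) in *. set (M := sqrt m) in *.
  assert (HDM : 0 < D / M) by (apply Rdiv_lt_0_compat; lra).
  assert (H := is_intR_shift _ _ (ln (D / M)) (is_intR_K0_cosh (2 * al * (D * M)) ltac:(repeat apply Rmult_lt_0_compat; lra))).
  revert H. apply is_intR_ext. intros s. f_equal. f_equal. unfold cosh.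
  rewrite Ropp_plus_distr, !exp_plus, (exp_Ropp (ln _)), exp_ln by exact HDM.
  rewrite <- ED, <- EM. field. lra.
Qed.

(** * Termwise integration of Dirichlet products *)

Lemma series_tail_le (a M : nat -> R) A W N :
  is_series a A -> is_series M W -> (forall n, Rabs (a n) <= M n) ->
  Rabs (A - rsum a (seq 0 N)) <= W - rsum M (seq 0 N).
Proof.
  intros Ha HM H. apply is_series_rsum in Ha. apply is_series_rsum in HM.
  apply (is_lim_seq_incr_n _ N) in Ha. apply (is_lim_seq_incr_n _ N) in HM.
  apply (is_lim_seq_le (fun n => Rabs (rsum a (seq 0 (n + N)) - rsum a (seq 0 N)))
     (fun n => rsum M (seq 0 (n + N)) - rsum M (seq 0 N))
     (Rabs (A - rsum a (seq 0 N))) (W - rsum M (seq 0 N))).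
  - intros n. rewrite Nat.add_comm, !rsum_seq_split. simpl.
    replace (rsum a (seq 0 N) + rsum a (seq N n) - rsum a (seq 0 N)) with (rsum a (seq N n)) by ring.
    replace (rsum M (seq 0 N) + rsum M (seq N n) - rsum M (seq 0 N)) with (rsum M (seq N n)) by ring.
    eapply Rle_trans; [apply rsum_Rabs|]. apply rsum_le; auto.
  - apply (is_lim_seq_abs _ (Finite (A - _))). apply is_lim_seq_minus'; [exact Ha|apply is_lim_seq_const].
  - apply is_lim_seq_minus'; [exact HM|apply is_lim_seq_const].
Qed.

(** The exponent 3/2 is a compromise: a Lorentzian offers two powers of its frequency, half a power
    is traded for decay in [s], and the rest is still summable. *)
Definition wt (n : nat) : R := / (INR n * sqrt (INR n)).

Lemma wt_pos n : (1 <= n)%nat -> 0 < wt n.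
Proof.
  intros Hn. assert (0 < INR n) by (apply lt_0_INR; lia).
  apply Rinv_0_lt_compat, Rmult_lt_0_compat; [lra|now apply sqrt_lt_R0].
Qed.

(** Telescoping: $(n+1)^{-3/2} \le 2/\sqrt n - 2/\sqrt{n+1}$. The bound 3 is the first term 1 plus
    the telescoped total 2. *)
Lemma ex_series_wt : ex_series (fun n => wt (S n)).
Proof.
  apply ex_series_bounded with 3.
  { intros k. left. apply wt_pos; lia. }
  assert (H : forall n, rsum (fun n => wt (S n)) (seq 0 (S n)) <= 3 - 2 / sqrt (INR (S n))).
  { induction n as [|n IH].
    - unfold rsum, wt; simpl. rewrite sqrt_1. lra.
    - rewrite rsum_seq_S. simpl (0 + S n)%nat.
      enough (wt (S (S n)) <= 2 / sqrt (INR (S n)) - 2 / sqrt (INR (S (S n)))) by lra.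
      unfold wt. rewrite (S_INR (S n)). assert (Hp : 0 < INR (S n)) by (apply lt_0_INR; lia).
      set (z := INR (S n)) in *.
      assert (Hu := sqrt_lt_R0 z Hp). assert (Eu := sqrt_sqrt z ltac:(lra)).
      assert (Hv := sqrt_lt_R0 (z + 1) ltac:(lra)). assert (Ev := sqrt_sqrt (z + 1) ltac:(lra)).
      assert (Huv : sqrt z <= sqrt (z + 1)) by (apply sqrt_le_1; lra).
      set (u := sqrt z) in *. set (v := sqrt (z + 1)) in *. rewrite <- Ev.
      replace (2 / u - 2 / v) with (2 / (u * v * (u + v))).
      2:{ assert ((v - u) * (v + u) = 1) by nra.
          apply Rmult_eq_reg_r with (u * v * (u + v)); [|apply Rgt_not_eq; repeat apply Rmult_lt_0_compat; lra].
          field_simplify; [|lra|lra]. nra. }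
      apply Rmult_le_reg_r with ((v * v * v) * (u * v * (u + v))); [repeat apply Rmult_lt_0_compat; lra|].
      replace (/ (v * v * v) * (v * v * v * (u * v * (u + v)))) with (u * v * (u + v)) by (field; lra).
      replace (2 / (u * v * (u + v)) * (v * v * v * (u * v * (u + v)))) with (2 * (v * v * v)) by (field; lra).
      assert (u * (u + v) <= v * (v + v)) by nra. nra. }
  intros n. destruct n as [|n]; [unfold rsum; simpl; lra|].
  eapply Rle_trans; [apply H|].
  assert (0 < 2 / sqrt (INR (S n))) by (apply Rdiv_lt_0_compat; [lra|apply sqrt_lt_R0, lt_0_INR; lia]).
  lra.
Qed.

(** The terms with $dm = n$ are grouped into one. The group is bounded by [K * dconv wt wt n] times
    the sech profile, and [is_series_dconv] applied to [wt] sums these bounds; the error of the N-th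
    partial sum is then the tail of that series times the profile. *)
Lemma is_intR_dconv (X Y : nat -> R -> R) (XF YF : R -> R) (c : nat -> nat -> R) K :
  (forall s, continuous (fun s => XF s * YF s) s) ->
  (forall s, ex_series (fun n => Rabs (X (S n) s))) ->
  (forall s, is_series (fun n => X (S n) s) (XF s)) ->
  (forall s, is_series (fun n => Y (S n) s) (YF s)) ->
  (forall d m, (1 <= d)%nat -> (1 <= m)%nat -> is_intR (fun s => X d s * Y m s) (c d m)) ->
  (forall d m s, (1 <= d)%nat -> (1 <= m)%nat ->
     Rabs (X d s * Y m s) <= K * (wt d * wt m) * / cosh (s / 2)) ->
  exists l,
    is_series (fun n => rsum (fun d => c d (S n / d)%nat) (divisors (S n))) l /\
    is_intR (fun s => XF s * YF s) l.
Proof.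
  intros Hc HXa HX HY Hint Hb.
  destruct ex_series_wt as [w Hw].
  assert (HW : is_series (fun n => dconv wt wt (S n)) (w * w)).
  { apply is_series_dconv; auto. exists w. revert Hw. apply is_series_ext.
    intros n. symmetry; apply Rabs_pos_eq. left; apply wt_pos; lia. }
  set (M := fun n => K * dconv wt wt (S n)).
  assert (HM : is_series M (K * (w * w))) by exact (is_series_scal_l K _ _ HW).
  set (phi := fun n s => dconv (fun d => X d s) (fun m => Y m s) (S n)).
  assert (Hphi : forall n s, Rabs (phi n s) <= M n * / cosh (s / 2)).
  { intros n s. unfold phi, M, dconv. eapply Rle_trans; [apply rsum_Rabs|].
    rewrite <- rsum_scal, <- rsum_scal_r. apply rsum_le. intros d Hd.
    apply in_divisors in Hd. destruct Hd as [m [H1 [H2 [H3 H4]]]]. rewrite H4. now apply Hb. }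
  set (cn := fun n => rsum (fun d => c d (S n / d)%nat) (divisors (S n))).
  assert (Hcn : forall n, is_intR (phi n) (cn n)).
  { intros n. unfold phi, cn, dconv.
    apply (is_intR_rsum (fun d s => X d s * Y (S n / d)%nat s) (fun d => c d (S n / d)%nat)).
    intros d Hd. apply in_divisors in Hd. destruct Hd as [m [H1 [H2 [H3 H4]]]].
    rewrite H4. now apply Hint. }
  (* Integrating the pointwise majorant bounds [cn n] by [M n * (2 * PI)]. *)
  assert (Hex : ex_series cn).
  { apply (ex_series_le cn (fun n => M n * (2 * PI))).
    - intros n. unfold norm; simpl; unfold abs; simpl.
      apply (is_intR_Rabs_le (phi n) (fun s => M n * / cosh (s / 2))); auto.
      apply is_intR_scal, is_intR_sech_half.
    - exists (K * (w * w) * (2 * PI)). exact (is_series_scal_r (2 * PI) _ _ HM). }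
  destruct Hex as [l Hl]. exists l. split; [exact Hl|].
  apply (is_intR_dominated_lim _ (fun N s => rsum (fun n => phi n s) (seq 0 N))
    (fun N s => (K * (w * w) - rsum M (seq 0 N)) * / cosh (s / 2))
    (fun N => rsum cn (seq 0 N))
    (fun N => (K * (w * w) - rsum M (seq 0 N)) * (2 * PI))).
  - exact Hc.
  - intros N. apply is_intR_rsum. auto.
  - intros N. apply is_intR_scal, is_intR_sech_half.
  - intros N s. rewrite Rmult_minus_distr_r, <- rsum_scal_r.
    apply (series_tail_le (fun n => phi n s) (fun n => M n * / cosh (s / 2))).
    + apply is_series_dconv; auto.
    + exact (is_series_scal_r (/ cosh (s / 2)) _ _ HM).
    + auto.
  - now apply is_series_rsum.
  - replace (Finite 0) with (Rbar_mult 0 (2 * PI)) by (simpl; f_equal; ring).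
    apply (is_lim_seq_scal_r _ (2 * PI) 0), Series_tail, HM.
Qed.

(** * Partial fractions of the Poisson kernel *)

(** The Poisson kernel of the disc: with $r = e^{-y}$ it equals $(1 - r^2)/(1 - 2r\cos\theta + r^2)
    = 1 + 2\sum_{n \ge 1} r^n \cos n\theta$. *)
Definition poisson (y th : R) : R := sinh y / (cosh y - cos th).

Definition lorentz (y t : R) : R := 2 * y / (y ^ 2 + t ^ 2).

(** Over $k \ge 0$ the points $\theta + 2\pi k$ and $\theta - 2\pi(k+1)$ run once through $\theta +
    2\pi\mathbb{Z}$, which turns the bilateral sum into an ordinary series. *)
Definition lorentz_pair (y th : R) (k : nat) : R :=
  lorentz y (th + 2 * PI * INR k) + lorentz y (th - 2 * PI * INR (S k)).

Lemma nondecreasing_from_0 (f df : R -> R) y : 0 <= y ->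
  (forall s, is_derive f s (df s)) -> (forall s, 0 <= s <= y -> 0 <= df s) -> f 0 <= f y.
Proof.
  intros Hy Hd Hpos.
  destruct (MVT_gen f 0 y df) as [c [Hc E]].
  - intros s _; apply Hd.
  - intros s _. apply continuity_pt_filterlim.
    apply (ex_derive_continuous f). eexists; apply Hd.
  - rewrite Rmin_left, Rmax_right in Hc by lra. specialize (Hpos c Hc). nra.
Qed.

Lemma cosh_le_2 y : 0 <= y <= 1 -> cosh y <= 2.
Proof.
  intros Hy. unfold cosh.
  assert (exp y <= exp 1) by (destruct (Req_dec y 1) as [->|]; [lra|left; apply exp_increasing; lra]).
  assert (exp (- y) <= exp 0) by (destruct (Req_dec y 0) as [->|]; [rewrite Ropp_0; lra|left; apply exp_increasing; lra]).
  rewrite exp_0 in H0. generalize exp_le_3; lra.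
Qed.

Lemma sinh_ge_id y : 0 <= y -> y <= sinh y.
Proof.
  intros Hy. assert (H := nondecreasing_from_0 (fun s => sinh s - s) (fun s => cosh s - 1) y Hy).
  cbv beta in H. rewrite sinh_0 in H. enough (0 - 0 <= sinh y - y) by lra. apply H.
  - intros s. auto_derive; [auto|ring].
  - intros s _. generalize (cosh_ge_1 s); lra.
Qed.

Lemma cosh_ge_quadratic y : 0 <= y -> 1 + y ^ 2 / 2 <= cosh y.
Proof.
  intros Hy. assert (H := nondecreasing_from_0 (fun s => cosh s - s ^ 2 / 2) (fun s => sinh s - s) y Hy).
  cbv beta in H. rewrite cosh_0 in H. enough (1 - 0 ^ 2 / 2 <= cosh y - y ^ 2 / 2) by lra. apply H.
  - intros s. auto_derive; [auto|field].
  - intros s Hs. generalize (sinh_ge_id s); lra.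
Qed.

(** Bootstrap from $\cosh \le 2$ on $[0,1]$: integrating from 0 improves the bounds on sinh and cosh
    alternately, with coefficients rounded up. *)
Lemma sinh_cosh_upper y : 0 <= y <= 1 ->
  sinh y <= y + y ^ 3 /\ cosh y <= 1 + y ^ 2 / 2 + y ^ 4 / 2.
Proof.
  intros Hy.
  assert (S1 : forall z, 0 <= z <= 1 -> sinh z <= 2 * z).
  { intros z Hz. assert (H := nondecreasing_from_0 (fun s => 2 * s - sinh s) (fun s => 2 - cosh s) z (proj1 Hz)).
    cbv beta in H. rewrite sinh_0 in H. enough (2 * 0 - 0 <= 2 * z - sinh z) by lra. apply H.
    - intros s. auto_derive; [auto|ring].
    - intros s Hs. generalize (cosh_le_2 s); lra. }
  assert (C1 : forall z, 0 <= z <= 1 -> cosh z <= 1 + z ^ 2).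
  { intros z Hz. assert (H := nondecreasing_from_0 (fun s => 1 + s ^ 2 - cosh s) (fun s => 2 * s - sinh s) z (proj1 Hz)).
    cbv beta in H. rewrite cosh_0 in H. enough (1 + 0 ^ 2 - 1 <= 1 + z ^ 2 - cosh z) by lra. apply H.
    - intros s. auto_derive; [auto|ring].
    - intros s Hs. generalize (S1 s); lra. }
  assert (S2 : forall z, 0 <= z <= 1 -> sinh z <= z + z ^ 3).
  { intros z Hz. assert (H := nondecreasing_from_0 (fun s => s + s ^ 3 - sinh s) (fun s => 1 + 3 * s ^ 2 - cosh s) z (proj1 Hz)).
    cbv beta in H. rewrite sinh_0 in H. enough (0 + 0 ^ 3 - 0 <= z + z ^ 3 - sinh z) by lra. apply H.
    - intros s. auto_derive; [auto|ring].
    - intros s Hs. generalize (C1 s) (pow2_ge_0 s); lra. }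
  split; [now apply S2|].
  assert (H := nondecreasing_from_0 (fun s => 1 + s ^ 2 / 2 + s ^ 4 / 2 - cosh s) (fun s => s + 2 * s ^ 3 - sinh s) y (proj1 Hy)).
  cbv beta in H. rewrite cosh_0 in H.
  enough (1 + 0 ^ 2 / 2 + 0 ^ 4 / 2 - 1 <= 1 + y ^ 2 / 2 + y ^ 4 / 2 - cosh y) by lra. apply H.
  - intros s. auto_derive; [auto|field].
  - intros s Hs. assert (0 <= s ^ 3) by (apply pow_le; lra). generalize (S2 s); lra.
Qed.

Lemma sin_cubic_lower x : 0 <= x <= PI / 2 -> x - x ^ 3 / 6 <= sin x.
Proof.
  intros Hx. assert (P4 := PI_4). assert (PG := PI_RGT_0).
  destruct (SIN x) as [H _]; [lra|lra|].
  eapply Rle_trans; [|exact H].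
  (* The lower Taylor polynomial has degree 7; its last two terms contribute $x^5/120 - x^7/5040 \ge
     0$ because $x^2 \le 42$. *)
  unfold sin_lb, sin_approx, sin_term; simpl. field_simplify.
  assert (0 <= x ^ 5) by (apply pow_le; lra).
  assert (x ^ 7 <= 42 * x ^ 5).
  { replace (x ^ 7) with (x ^ 2 * x ^ 5) by ring. apply Rmult_le_compat_r; [assumption|]. nra. }
  lra.
Qed.

Lemma cos_quadratic_bounds t : 0 <= t <= PI ->
  t ^ 2 / 9 <= 2 - 2 * cos t /\ t ^ 2 - t ^ 4 <= 2 - 2 * cos t <= t ^ 2.
Proof.
  intros Ht. assert (P4 := PI_4). assert (PG := PI_RGT_0).
  set (x := t / 2). assert (Et : t = 2 * x) by (unfold x; field).
  assert (Hx : 0 <= x <= PI / 2) by (unfold x; lra).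
  assert (H1 := sin_cubic_lower x Hx).
  assert (H2 : sin x <= x) by (destruct (Req_dec x 0) as [->|]; [rewrite sin_0; lra|left; apply sin_lt_x; lra]).
  assert (H0 : 0 <= sin x) by (apply sin_ge_0; lra).
  assert (E : 2 - 2 * cos t = 4 * sin x ^ 2).
  { rewrite Et, cos_2a_sin. ring. }
  rewrite E, Et. set (S := sin x) in *.
  (* Here $x \le \pi/2 \le 2$, so $x - x^3/6 \ge x/3$; squaring is the source of the 9. *)
  assert (Hx3 : x / 3 <= S) by nra.
  split; [nra|]. split; [|nra].
  assert (x - S <= x ^ 3) by (assert (0 <= x ^ 3) by (apply pow_le; lra); lra).
  assert ((x - S) * (x + S) <= x ^ 3 * (2 * x)) by (apply Rmult_le_compat; lra).
  assert (0 <= x ^ 4) by (apply pow_le; lra). nra.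
Qed.

(** With $P = y^2 + t^2$ and $Q = 2(\cosh y - \cos t)$ the two kernels are $2y/P$ and $2\sinh y/Q$.
    Since $|P - Q| \le P^2$ and $Q \ge P/9$, the numerator of the difference is at most $4yP^2$ and
    the denominator at least $P^2/9$, whence 36. *)
Lemma poisson_near_pole y t : 0 < y <= 1 -> 0 <= t <= PI ->
  Rabs (poisson y t - lorentz y t) <= 36 * y.
Proof.
  intros Hy Ht.
  destruct (cos_quadratic_bounds t Ht) as [C1 [C2 C3]].
  destruct (sinh_cosh_upper y ltac:(lra)) as [S1 S2].
  assert (S3 := sinh_ge_id y ltac:(lra)). assert (S4 := cosh_ge_quadratic y ltac:(lra)).
  set (P := y ^ 2 + t ^ 2). set (Q := 2 * (cosh y - cos t)).
  assert (Hy2 : 0 < y ^ 2) by (apply pow_lt; lra). assert (Ht2 := pow2_ge_0 t).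
  assert (HP : 0 < P) by (unfold P; lra).
  assert (HQP : P / 9 <= Q) by (unfold P, Q; lra).
  assert (HPQ : Rabs (P - Q) <= P ^ 2).
  { assert (0 <= y ^ 2 * t ^ 2) by nra.
    assert (P ^ 2 = y ^ 4 + t ^ 4 + 2 * (y ^ 2 * t ^ 2)) by (unfold P; ring).
    assert (0 <= y ^ 4) by (apply pow_le; lra). assert (0 <= t ^ 4) by (apply pow_le; lra).
    rewrite H0. apply Rabs_le. unfold Q, P; split; lra. }
  assert (E : poisson y t - lorentz y t = 2 * ((sinh y - y) * P + y * (P - Q)) / (Q * P)).
  { unfold poisson, lorentz. fold P. replace (cosh y - cos t) with (Q / 2) by (unfold Q; field).
    field. lra. }
  assert (HQPP : 0 < Q * P) by (apply Rmult_lt_0_compat; lra).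
  rewrite E. unfold Rdiv at 1. rewrite Rabs_mult, (Rabs_pos_eq (/ _)) by (left; now apply Rinv_0_lt_compat).
  apply Rmult_le_reg_r with (Q * P); [exact HQPP|].
  rewrite Rmult_assoc, Rinv_l, Rmult_1_r by lra.
  rewrite Rabs_mult, (Rabs_pos_eq 2) by lra.
  apply Rle_trans with (2 * (2 * y * P ^ 2)).
  - apply Rmult_le_compat_l; [lra|]. eapply Rle_trans; [apply Rabs_triang|].
    rewrite !Rabs_mult, (Rabs_pos_eq (sinh y - y)), (Rabs_pos_eq P), (Rabs_pos_eq y) by lra.
    assert ((sinh y - y) * P <= y * P ^ 2).
    { replace (y * P ^ 2) with (y * P * P) by ring. apply Rmult_le_compat_r; [lra|].
      assert (y * y ^ 2 <= y * P) by (apply Rmult_le_compat_l; unfold P; lra). lra. }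
    assert (y * Rabs (P - Q) <= y * P ^ 2) by (apply Rmult_le_compat_l; lra).
    lra.
  - assert (P / 9 * P <= Q * P) by (apply Rmult_le_compat_r; lra).
    assert (36 * y * (P / 9 * P) <= 36 * y * (Q * P)) by (apply Rmult_le_compat_l; lra).
    replace (2 * (2 * y * P ^ 2)) with (36 * y * (P / 9 * P)) by field. lra.
Qed.

Lemma lorentz_pos y t : 0 < y -> 0 <= lorentz y t.
Proof.
  intros Hy. unfold lorentz. left. apply Rdiv_lt_0_compat; [lra|].
  assert (0 < y ^ 2) by (apply pow_lt; lra). generalize (pow2_ge_0 t); lra.
Qed.

Lemma lorentz_le y t c : 0 < y -> 0 < c -> c <= t ^ 2 -> lorentz y t <= 2 * y / c.
Proof.
  intros Hy Hc Ht. unfold lorentz, Rdiv. apply Rmult_le_compat_l; [lra|].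
  apply Rinv_le_contravar; [exact Hc|]. generalize (pow2_ge_0 y); lra.
Qed.

Lemma lorentz_opp y t : lorentz y (- t) = lorentz y t.
Proof. unfold lorentz. f_equal. ring. Qed.

Lemma lorentz_half y t : 0 < y -> lorentz (y / 2) (t / 2) = 2 * lorentz y t.
Proof.
  intros Hy. unfold lorentz. assert (0 < y ^ 2) by (apply pow_lt; lra).
  assert (H1 := pow2_ge_0 t). field. nra.
Qed.

Lemma inv_sqr_le_wt n : (1 <= n)%nat -> / INR n ^ 2 <= wt n.
Proof.
  intros Hn. assert (1 <= INR n) by (apply (le_INR 1); lia).
  unfold wt. apply Rinv_le_contravar.
  - apply Rmult_lt_0_compat; [lra|apply sqrt_lt_R0; lra].
  - simpl. rewrite Rmult_1_r. apply Rmult_le_compat_l; [lra|].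
    assert (H1 := sqrt_lt_R0 (INR n) ltac:(lra)). assert (E := sqrt_sqrt (INR n) ltac:(lra)).
    assert (1 <= sqrt (INR n)) by (rewrite <- sqrt_1; apply sqrt_le_1; lra). nra.
Qed.

Lemma lorentz_pair_pos y th k : 0 < y -> 0 <= lorentz_pair y th k.
Proof. intros Hy. unfold lorentz_pair. generalize (lorentz_pos y (th + 2 * PI * INR k) Hy) (lorentz_pos y (th - 2 * PI * INR (S k)) Hy). lra. Qed.

(** The pair of index 0 is left out since it contains the points $\theta$ and $\theta - 2\pi$, which
    may be at 0, where the Lorentzian is $2/y$. The points of pair $k+1$ are at distance at least
    $2(k+1)$ from 0. *)
Lemma lorentz_pair_le y th k : 0 < y -> 0 <= th <= 2 * PI ->
  lorentz_pair y th (S k) <= y * wt (S k).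
Proof.
  intros Hy Hth. assert (P1 := PI_RGT_0). assert (P3 : 1 <= PI) by (generalize PI2_1; lra).
  assert (Hk : 1 <= INR (S k)) by (apply (le_INR 1); lia).
  assert (H := inv_sqr_le_wt (S k) ltac:(lia)).
  assert (Hn2 : 0 < INR (S k) ^ 2) by (apply pow_lt; lra).
  assert (Hm : 0 <= (PI - 1) * INR (S k)) by (apply Rmult_le_pos; lra).
  set (n := INR (S k)) in *.
  assert (B : forall t, 2 * n <= t -> lorentz y t <= 2 * y / (4 * n ^ 2)).
  { intros t Ht. apply lorentz_le; [exact Hy|lra|nra]. }
  unfold lorentz_pair. fold n.
  assert (B1 := B (th + 2 * PI * n) ltac:(nra)).
  assert (B2 := B (- (th - 2 * PI * INR (S (S k))))). rewrite lorentz_opp in B2.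
  assert (Hs : 2 * n <= - (th - 2 * PI * INR (S (S k)))) by (rewrite S_INR; fold n; nra).
  specialize (B2 Hs).
  replace (2 * y / (4 * n ^ 2)) with (y * / n ^ 2 / 2) in * by (field; lra).
  assert (y * / n ^ 2 <= y * wt (S k)) by (apply Rmult_le_compat_l; lra). lra.
Qed.

Lemma ex_series_lorentz_pair y th : 0 < y -> 0 <= th <= 2 * PI ->
  ex_series (lorentz_pair y th).
Proof.
  intros Hy Hth. apply ex_series_incr_1.
  apply (ex_series_le (V := R_CompleteNormedModule) _ (fun k => y * wt (S k))).
  - intros k. unfold norm; simpl; unfold abs; simpl.
    rewrite Rabs_pos_eq by now apply lorentz_pair_pos. now apply lorentz_pair_le.
  - apply (ex_series_scal_l y (fun k => wt (S k))), ex_series_wt.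
Qed.

(** Halving sends $\theta + 2\pi\mathbb{Z}$ to $\theta/2 + \pi\mathbb{Z}$, which splits by parity
    into the translates of $\theta/2$ and of $\theta/2 + \pi$. The factor 1/2 is the homogeneity of
    [lorentz], of degree $-1$. *)
Lemma rsum_lorentz_pair_dup y th N : 0 < y ->
  rsum (lorentz_pair y th) (seq 0 (2 * N)) =
  / 2 * (rsum (lorentz_pair (y / 2) (th / 2)) (seq 0 N)
         + rsum (lorentz_pair (y / 2) (th / 2 + PI)) (seq 0 N)).
Proof.
  intros Hy. induction N as [|N IH]; [unfold rsum; simpl; lra|].
  replace (2 * S N)%nat with (S (S (2 * N))) by lia.
  rewrite !rsum_seq_S, IH. unfold lorentz_pair. rewrite !Nat.add_0_l.
  rewrite !S_INR, mult_INR. simpl (INR 2).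
  replace (th / 2 + 2 * PI * INR N) with ((th + 2 * PI * (2 * INR N)) / 2) by field.
  replace (th / 2 - 2 * PI * (INR N + 1)) with ((th - 2 * PI * (2 * INR N + 1 + 1)) / 2) by field.
  replace (th / 2 + PI + 2 * PI * INR N) with ((th + 2 * PI * (2 * INR N + 1)) / 2) by field.
  replace (th / 2 + PI - 2 * PI * (INR N + 1)) with ((th - 2 * PI * (2 * INR N + 1)) / 2) by field.
  rewrite !lorentz_half by exact Hy. replace (1 + 1) with 2 by ring. lra.
Qed.

Definition poisson_defect (y th : R) : R := poisson y th - Series (lorentz_pair y th).

(** Partial fractions: $\cosh y - \cos\theta = 2(C - c)(C + c)$ with $C = \cosh(y/2)$ and $c =
    \cos(\theta/2)$, and adding $\pi$ to the angle changes the sign of $c$. *)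
Lemma poisson_dup y th : 0 < y ->
  poisson y th = / 2 * (poisson (y / 2) (th / 2) + poisson (y / 2) (th / 2 + PI)).
Proof.
  intros Hy. unfold poisson. rewrite neg_cos.
  assert (E1 : sinh y = 2 * sinh (y / 2) * cosh (y / 2)).
  { unfold sinh, cosh. replace y with (y / 2 + y / 2) at 1 by field.
    replace (- y) with (- (y / 2) + - (y / 2)) by field. rewrite !exp_plus. field. }
  assert (E2 := cosh_double y).
  assert (E3 : cos th = 2 * cos (th / 2) ^ 2 - 1).
  { replace th with (2 * (th / 2)) at 1 by field. rewrite cos_2a_cos. ring. }
  assert (H1 : 1 < cosh (y / 2)).
  { generalize (cosh_ge_quadratic (y / 2) ltac:(lra)). assert (0 < (y / 2) ^ 2) by (apply pow_lt; lra). lra. }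
  assert (H2 := COS_bound (th / 2)).
  rewrite E1, E2, E3. field. repeat split; try nra.
Qed.

Lemma poisson_defect_dup y th : 0 < y -> 0 <= th <= 2 * PI ->
  poisson_defect y th =
  / 2 * (poisson_defect (y / 2) (th / 2) + poisson_defect (y / 2) (th / 2 + PI)).
Proof.
  intros Hy Hth. assert (P1 := PI_RGT_0). unfold poisson_defect. rewrite (poisson_dup y th Hy).
  enough (E : Series (lorentz_pair y th) =
    / 2 * (Series (lorentz_pair (y / 2) (th / 2)) + Series (lorentz_pair (y / 2) (th / 2 + PI))))
    by (rewrite E; ring).
  assert (A1 := Series_correct _ (ex_series_lorentz_pair y th Hy Hth)).
  assert (A2 := Series_correct _ (ex_series_lorentz_pair (y / 2) (th / 2) ltac:(lra) ltac:(lra))).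
  assert (A3 := Series_correct _ (ex_series_lorentz_pair (y / 2) (th / 2 + PI) ltac:(lra) ltac:(lra))).
  apply is_series_rsum in A1, A2, A3.
  assert (A4 := is_lim_seq_scal_l _ (/ 2) _ (is_lim_seq_plus' _ _ _ _ A2 A3)).
  apply (is_lim_seq_ext _ (fun N => rsum (lorentz_pair y th) (seq 0 (2 * N)))) in A4.
  2:{ intros N. symmetry. now apply rsum_lorentz_pair_dup. }
  (* Duplication of partial sums is stated for an even number of pairs, so the limit is identified
     along $2N$. *)
  assert (A5 : is_lim_seq (fun N => rsum (lorentz_pair y th) (seq 0 (2 * N))) (Series (lorentz_pair y th))).
  { apply (is_lim_seq_subseq _ _ (fun N => (2 * N)%nat)) in A1; [exact A1|].
    apply eventually_subseq. intros n; lia. }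
  apply is_lim_seq_unique in A4. apply is_lim_seq_unique in A5.
  rewrite A4 in A5. simpl in A5. now injection A5.
Qed.

(** Of the pair of index 0, the point nearer to 0 is $\theta$ or $\theta - 2\pi$ according to the
    side of $\pi$; it cancels the pole of the kernel up to $36y$, and the other point contributes at
    most $2y$. The remaining pairs give $wy$, with $w$ the sum of the weights. *)
Lemma poisson_defect_small : exists K, forall y th, 0 < y <= 1 -> 0 <= th <= 2 * PI ->
  Rabs (poisson_defect y th) <= K * y.
Proof.
  destruct ex_series_wt as [w Hw]. exists (36 + 2 + w). intros y th Hy Hth.
  assert (P1 := PI_RGT_0). assert (P3 : 1 <= PI) by (generalize PI2_1; lra).
  assert (Hex := ex_series_lorentz_pair y th ltac:(lra) Hth).
  unfold poisson_defect. rewrite (Series_incr_1 _ Hex).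
  assert (T : 0 <= Series (fun k => lorentz_pair y th (S k)) <= y * w).
  { assert (Hex' := proj1 (ex_series_incr_1 _) Hex). split.
    - assert (B := rsum_le_Series _ _ 0 (fun k => lorentz_pair_pos y th (S k) ltac:(lra)) (Series_correct _ Hex')).
      unfold rsum in B; simpl in B. exact B.
    - replace (y * w) with (Series (fun k => y * wt (S k)))
        by (apply is_series_unique; exact (is_series_scal_l y _ _ Hw)).
      apply Series_le.
      + intros k. split; [apply lorentz_pair_pos; lra|apply lorentz_pair_le; lra].
      + apply (ex_series_scal_l y (fun k => wt (S k))), ex_series_wt. }
  assert (M : Rabs (poisson y th - lorentz_pair y th 0) <= (36 + 2) * y).
  { unfold lorentz_pair. simpl INR. rewrite Rmult_0_r, Rplus_0_r, Rmult_1_r.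
    assert (Far : forall t, PI <= t -> 0 <= lorentz y t <= 2 * y).
    { intros t Ht. split; [apply lorentz_pos; lra|].
      replace (2 * y) with (2 * y / 1) by field. apply lorentz_le; [lra|lra|nra]. }
    destruct (Rle_dec th PI) as [Hle|Hgt].
    - assert (N := poisson_near_pole y th Hy ltac:(lra)).
      assert (F := Far (- (th - 2 * PI)) ltac:(lra)). rewrite lorentz_opp in F.
      replace (poisson y th - (lorentz y th + lorentz y (th - 2 * PI)))
        with ((poisson y th - lorentz y th) + - lorentz y (th - 2 * PI)) by ring.
      eapply Rle_trans; [apply Rabs_triang|]. rewrite Rabs_Ropp, (Rabs_pos_eq (lorentz _ _)) by lra. lra.
    - assert (N := poisson_near_pole y (2 * PI - th) Hy ltac:(lra)).
      assert (F := Far th ltac:(lra)).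
      replace (poisson y (2 * PI - th)) with (poisson y th) in N.
      2:{ unfold poisson. f_equal. f_equal. rewrite <- (cos_neg (2 * PI - th)).
          replace (- (2 * PI - th)) with (th - 2 * PI) by ring.
          rewrite <- (cos_period (th - 2 * PI) 1). f_equal. simpl. ring. }
      replace (th - 2 * PI) with (- (2 * PI - th)) by ring. rewrite lorentz_opp.
      replace (poisson y th - (lorentz y th + lorentz y (2 * PI - th)))
        with ((poisson y th - lorentz y (2 * PI - th)) + - lorentz y th) by ring.
      eapply Rle_trans; [apply Rabs_triang|]. rewrite Rabs_Ropp, (Rabs_pos_eq (lorentz _ _)) by lra. lra. }
  match goal with |- Rabs (poisson y th - (_ + ?t)) <= _ =>
    replace (poisson y th - (lorentz_pair y th 0 + t))
      with ((poisson y th - lorentz_pair y th 0) + - t) by ring end.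
  eapply Rle_trans; [apply Rabs_triang|]. rewrite Rabs_Ropp, (Rabs_pos_eq (Series _)) by lra.
  lra.
Qed.

(* Herglotz' trick: the defect is its own average under (y, th) -> (y/2, th/2), (y/2, th/2 + PI),
   and it tends to 0 with y. *)
Lemma is_series_poisson y th : 0 < y -> 0 <= th <= 2 * PI ->
  is_series (lorentz_pair y th) (poisson y th).
Proof.
  intros Hy Hth. assert (P1 := PI_RGT_0).
  enough (E : poisson_defect y th = 0).
  { unfold poisson_defect in E. replace (poisson y th) with (Series (lorentz_pair y th)) by lra.
    apply Series_correct. now apply ex_series_lorentz_pair. }
  destruct poisson_defect_small as [K HK].
  (* After [n] halvings [y] is at most 1, where the linear bound is available; both new angles stay
     in $[0, 2\pi]$, so the induction closes. *)
  assert (B : forall n y th, 0 < y <= 2 ^ n -> 0 <= th <= 2 * PI ->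
    Rabs (poisson_defect y th) <= K * (y / 2 ^ n)).
  { clear y th Hy Hth. induction n as [|n IH]; intros y th Hy Hth.
    - simpl in *. unfold Rdiv. rewrite Rinv_1, Rmult_1_r. now apply HK.
    - assert (0 < 2 ^ n) by (apply pow_lt; lra). simpl in Hy.
      rewrite poisson_defect_dup by lra.
      assert (B1 := IH (y / 2) (th / 2) ltac:(lra) ltac:(lra)).
      assert (B2 := IH (y / 2) (th / 2 + PI) ltac:(lra) ltac:(lra)).
      rewrite Rabs_mult, (Rabs_pos_eq (/ 2)) by lra.
      replace (y / 2 ^ S n) with (y / 2 / 2 ^ n) by (simpl; field; lra).
      assert (T := Rabs_triang (poisson_defect (y / 2) (th / 2)) (poisson_defect (y / 2) (th / 2 + PI))).
      lra. }
  assert (L : is_lim_seq (fun n => K * (y / 2 ^ n)) 0).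
  { apply (is_lim_seq_ext (fun n => K * y * (/ 2) ^ n)).
    { intros n. rewrite pow_inv. unfold Rdiv. ring. }
    replace (Finite 0) with (Rbar_mult (K * y) 0) by (simpl; f_equal; ring).
    apply is_lim_seq_scal_l, is_lim_seq_geom. rewrite Rabs_pos_eq; lra. }
  destruct (Pow_x_infinity 2 ltac:(rewrite Rabs_pos_eq; lra) y) as [N HN].
  assert (Z : Rabs (poisson_defect y th) <= 0).
  { apply (is_lim_seq_le_loc (fun _ => Rabs (poisson_defect y th)) (fun n => K * (y / 2 ^ n))
      (Rabs (poisson_defect y th)) 0); [|apply is_lim_seq_const|exact L].
    exists N. intros n Hn. apply B; [|exact Hth]. specialize (HN n Hn).
    rewrite Rabs_pos_eq in HN by (apply pow_le; lra). lra. }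
  generalize (Rabs_pos (poisson_defect y th)). intros Z'.
  apply Rabs_eq_0. lra.
Qed.

(** * Periodic coefficients *)

Lemma periodic_mod {A} (f : nat -> A) q :
  (0 < q)%nat -> (forall n, f (n + q)%nat = f n) -> forall n, f n = f (n mod q)%nat.
Proof.
  intros Hq Hp n. rewrite (Nat.div_mod_eq n q) at 1.
  generalize (n mod q)%nat as r. induction (n / q)%nat as [|k IH]; intros r.
  - now rewrite Nat.mul_0_r.
  - rewrite <- (IH r). rewrite <- (Hp (q * k + r)%nat). f_equal. lia.
Qed.

Lemma rsum_ge_term {A} (f : A -> R) l a :
  (forall b, 0 <= f b) -> In a l -> f a <= rsum f l.
Proof.
  intros Hf Ha. induction l as [|b l IH]; [destruct Ha|].
  rewrite rsum_cons. destruct Ha as [->|Ha].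
  - generalize (rsum_pos f l (fun b _ => Hf b)); lra.
  - generalize (IH Ha) (Hf b); lra.
Qed.

Lemma periodic_bounded (f : nat -> R) q :
  (0 < q)%nat -> (forall n, f (n + q)%nat = f n) -> exists C, 0 <= C /\ forall n, Rabs (f n) <= C.
Proof.
  intros Hq Hp. exists (rsum (fun n => Rabs (f n)) (seq 0 q)). split.
  - apply rsum_pos; intros; apply Rabs_pos.
  - intros n. rewrite (periodic_mod f q Hq Hp n).
    apply (rsum_ge_term (fun n => Rabs (f n))); [intros; apply Rabs_pos|].
    apply in_seq. generalize (Nat.mod_upper_bound n q); lia.
Qed.

Lemma rsum_period_shift (f : nat -> R) q k :
  (forall n, f (n + q)%nat = f n) -> rsum f (seq k q) = rsum f (seq 0 q).
Proof.
  intros Hp. induction k as [|k IH]; [reflexivity|].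
  rewrite <- IH. assert (E := rsum_seq_S f k q).
  simpl seq in E. rewrite rsum_cons in E. rewrite Hp in E. lra.
Qed.

(** With zero sum over a period the partial sums are themselves periodic. Since [f 0] vanishes,
    starting at index 1 gives the same sums. *)
Lemma partial_sums_bounded (f : nat -> R) q :
  (0 < q)%nat -> (forall n, f (n + q)%nat = f n) -> rsum f (seq 0 q) = 0 -> f 0%nat = 0 ->
  exists C, forall n, Rabs (rsum (fun k => f (S k)) (seq 0 n)) <= C.
Proof.
  intros Hq Hp H0 Hf0.
  destruct (periodic_bounded (fun n => rsum f (seq 0 n)) q Hq) as [C [_ HC]].
  { intros n. rewrite rsum_seq_split, (rsum_period_shift f q (0 + n)) by exact Hp. lra. }
  exists C. intros n. specialize (HC (S n)). simpl seq in HC.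
  rewrite rsum_cons, rsum_shift, Hf0, Rplus_0_l in HC. exact HC.
Qed.

Lemma rsum_blocks (f : nat -> R) q N :
  rsum f (seq 0 (N * q)) = rsum (fun k => rsum (fun h => f (h + k * q)%nat) (seq 0 q)) (seq 0 N).
Proof.
  induction N as [|N IH]; [reflexivity|].
  rewrite rsum_seq_S, <- IH. replace (S N * q)%nat with (N * q + q)%nat by lia.
  rewrite rsum_seq_split. f_equal. rewrite !Nat.add_0_l.
  generalize (N * q)%nat as m. intros m. clear IH.
  induction q as [|q IH]; [reflexivity|]. rewrite !rsum_seq_S, IH. f_equal. f_equal. lia.
Qed.

Lemma rsum_rev (f : nat -> R) n :
  rsum f (seq 0 n) = rsum (fun k => f (n - 1 - k)%nat) (seq 0 n).
Proof.
  revert f. induction n as [|n IH]; intros f; [reflexivity|].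
  rewrite (rsum_seq_S (fun k => f (S n - 1 - k)%nat)). simpl seq at 1.
  rewrite rsum_cons, rsum_shift, IH, Rplus_comm. f_equal.
  - apply rsum_ext. intros k Hk. apply in_seq in Hk. f_equal. lia.
  - f_equal. lia.
Qed.

(** The reflection $h \mapsto q - h$ permutes $1, \dots, q-1$; the leftover $h = 0$ would be sent to
    $q$, outside the range, but carries the coefficient [v 0 = 0]. *)
Lemma rsum_reflect (v F : nat -> R) q :
  v 0%nat = 0 -> (forall h, (h <= q)%nat -> v (q - h)%nat = v h) ->
  rsum (fun h => v h * F (q - h)%nat) (seq 0 q) = rsum (fun h => v h * F h) (seq 0 q).
Proof.
  intros H0 Hr. destruct q as [|p]; [reflexivity|].
  simpl seq. rewrite !rsum_cons, H0, !rsum_shift. f_equal; [lra|].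
  rewrite rsum_rev. apply rsum_ext. intros k Hk. apply in_seq in Hk.
  rewrite <- (Hr (S (p - 1 - k))) by lia.
  replace (S p - S (p - 1 - k))%nat with (S k) by lia. reflexivity.
Qed.

Lemma is_series_rsum_list {A} (a : A -> nat -> R) (c : A -> R) l :
  (forall h, In h l -> is_series (a h) (c h)) ->
  is_series (fun n => rsum (fun h => a h n) l) (rsum c l).
Proof.
  intros H. apply is_series_rsum.
  apply (is_lim_seq_ext (fun N => rsum (fun h => rsum (a h) (seq 0 N)) l)).
  { intros N. apply rsum_swap. }
  induction l as [|h l IH].
  - unfold rsum; simpl. apply is_lim_seq_const.
  - rewrite rsum_cons. apply (is_lim_seq_plus' (fun N => rsum (a h) (seq 0 N))).
    + apply is_series_rsum, H. simpl; auto.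
    + apply IH. intros k Hk; apply H; simpl; auto.
Qed.

Lemma is_series_skip_0 (f : nat -> R) l :
  f 0%nat = 0 -> is_series f l -> is_series (fun n => f (S n)) l.
Proof.
  intros H0 H. apply is_series_rsum in H. apply is_series_rsum.
  apply (is_lim_seq_incr_1 (fun n => rsum f (seq 0 n))) in H. revert H.
  apply is_lim_seq_ext. intros n. simpl seq. rewrite rsum_cons, rsum_shift, H0. lra.
Qed.

(** * The exponential and the Lorentzian expansion of $A(y)$ *)

Definition angle (q h : nat) : R := 2 * PI * INR h / INR q.

(* In the application q u is the finite Fourier transform of v; evenness of v makes it a cosine sum. *)
Record cosine_dual (q : nat) (u v : nat -> R) : Prop := {
  cd_q : (0 < q)%nat;
  cd_u0 : u 0%nat = 0;
  cd_v0 : v 0%nat = 0;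
  cd_up : forall n, u (n + q)%nat = u n;
  cd_vp : forall n, v (n + q)%nat = v n;
  cd_us : rsum u (seq 0 q) = 0;
  cd_vs : rsum v (seq 0 q) = 0;
  cd_vr : forall h, (h <= q)%nat -> v (q - h)%nat = v h;
  cd_dual : forall d, u d = / INR q * rsum (fun h => v h * cos (INR d * angle q h)) (seq 0 q)
}.

(** The function $A(y)$ in closed form, a finite combination of Poisson kernels. Continuity is then
    elementary, and the two expansions of $A$ become separate statements about one function. *)
Definition lambert (q : nat) (v : nat -> R) (y : R) : R :=
  / (2 * INR q) * rsum (fun h => v h * poisson y (angle q h)) (seq 0 q).

Lemma poisson_denom_pos y th : 0 < y -> 0 < cosh y - cos th.
Proof.
  intros Hy. generalize (cosh_ge_quadratic y ltac:(lra)) (COS_bound th).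
  assert (0 < y ^ 2) by (apply pow_lt; lra). lra.
Qed.

(** Real part of the geometric series of ratio $r e^{i\theta}$, $r = e^{-y}$. The partial sums are
    given exactly, by induction on the recurrence $\cos((n+2)\theta) = 2\cos\theta\cos((n+1)\theta)
    - \cos(n\theta)$, with a remainder of order $r^n$. *)
Lemma is_series_cos_exp y th : 0 < y ->
  is_series (fun n => cos (INR (S n) * th) * exp (- (INR (S n) * y))) (- / 2 + / 2 * poisson y th).
Proof.
  intros Hy. assert (HD := poisson_denom_pos y th Hy).
  set (r := exp (- y)). assert (Hr : 0 < r) by apply exp_pos.
  assert (Hr1 : r < 1) by (unfold r; rewrite <- exp_0; apply exp_increasing; lra).
  assert (Ey : exp y = / r) by (unfold r; now rewrite exp_Ropp, Rinv_inv).
  assert (Er : forall n, exp (- (INR n * y)) = r ^ n).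
  { induction n as [|n IH]; [simpl; rewrite Rmult_0_l, Ropp_0; apply exp_0|].
    rewrite S_INR. replace (- ((INR n + 1) * y)) with (- (INR n * y) + - y) by ring.
    rewrite exp_plus, IH. fold r. simpl; ring. }
  assert (HP : 0 < 1 - 2 * r * cos th + r ^ 2).
  { replace (1 - 2 * r * cos th + r ^ 2) with (2 * r * (cosh y - cos th)).
    - repeat apply Rmult_lt_0_compat; lra.
    - unfold cosh. rewrite Ey. fold r. field. lra. }
  set (P := 1 - 2 * r * cos th + r ^ 2) in *.
  assert (EL : - / 2 + / 2 * poisson y th = (r * cos th - r ^ 2) / P).
  { unfold poisson. replace (cosh y - cos th) with (P / (2 * r)).
    - unfold sinh. rewrite Ey. fold r. unfold P. field. fold P. lra.
    - unfold P, cosh. rewrite Ey. fold r. field. lra. }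
  rewrite EL. apply is_series_rsum.
  assert (T : forall n, rsum (fun n => cos (INR (S n) * th) * exp (- (INR (S n) * y))) (seq 0 n)
     = (r * cos th - r ^ 2) / P
       + / P * ((r ^ 2 * cos (INR n * th) - r * cos (INR (S n) * th)) * r ^ n)).
  { induction n as [|n IH].
    - unfold rsum; simpl. rewrite Rmult_0_l, cos_0, Rmult_1_l. field. lra.
    - rewrite rsum_seq_S, IH, Nat.add_0_l, Er.
      assert (Ec : cos (INR (S (S n)) * th) = 2 * cos th * cos (INR (S n) * th) - cos (INR n * th)).
      { rewrite (S_INR (S n)).
        replace (INR n * th) with (INR (S n) * th - th) by (rewrite S_INR; ring).
        replace ((INR (S n) + 1) * th) with (INR (S n) * th + th) by ring.
        rewrite cos_plus, cos_minus. ring. }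
      rewrite Ec. apply Rmult_eq_reg_r with P; [|lra].
      field_simplify; [|lra|lra]. unfold P. simpl. ring. }
  apply (is_lim_seq_ext (fun n => (r * cos th - r ^ 2) / P
       + / P * ((r ^ 2 * cos (INR n * th) - r * cos (INR (S n) * th)) * r ^ n))).
  { intros n. now rewrite T. }
  assert (G : is_lim_seq (fun n => (r ^ 2 * cos (INR n * th) - r * cos (INR (S n) * th)) * r ^ n) 0).
  { apply (is_lim_seq_le_le (fun n => - 2 * r ^ n) _ (fun n => 2 * r ^ n)).
    - intros n. assert (0 < r ^ n) by (apply pow_lt; lra).
      assert (- 2 <= r ^ 2 * cos (INR n * th) - r * cos (INR (S n) * th) <= 2).
      { generalize (COS_bound (INR n * th)) (COS_bound (INR (S n) * th)).
        intros [A1 A2] [B1 B2]. assert (r ^ 2 < 1) by nra. assert (0 < r ^ 2) by nra. split; nra. }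
      split; nra.
    - replace (Finite 0) with (Rbar_mult (- 2) 0) by (simpl; f_equal; ring).
      apply is_lim_seq_scal_l, is_lim_seq_geom. rewrite Rabs_pos_eq; lra.
    - replace (Finite 0) with (Rbar_mult 2 0) by (simpl; f_equal; ring).
      apply is_lim_seq_scal_l, is_lim_seq_geom. rewrite Rabs_pos_eq; lra. }
  replace (Finite ((r * cos th - r ^ 2) / P)) with (Finite ((r * cos th - r ^ 2) / P + / P * 0)) by (f_equal; ring).
  apply is_lim_seq_plus'; [apply is_lim_seq_const|].
  apply (is_lim_seq_scal_l _ (/ P) 0), G.
Qed.

(** Each cosine series contributes a constant $-1/2$ besides its Poisson kernel; these constants
    cancel because [v] has zero sum over a period. *)
Lemma lambert_exp q u v y : cosine_dual q u v -> 0 < y ->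
  is_series (fun n => u (S n) * exp (- (INR (S n) * y))) (lambert q v y).
Proof.
  intros H Hy. assert (Hq : 0 < INR q) by (apply lt_0_INR, H).
  assert (E : lambert q v y =
    / INR q * rsum (fun h => v h * (- / 2 + / 2 * poisson y (angle q h))) (seq 0 q)).
  { unfold lambert.
    rewrite (rsum_ext (fun h => v h * (- / 2 + / 2 * poisson y (angle q h)))
      (fun h => - / 2 * v h + / 2 * (v h * poisson y (angle q h)))) by (intros; ring).
    rewrite rsum_plus, !rsum_scal, (cd_vs _ _ _ H). field. lra. }
  rewrite E.
  apply (is_series_ext (fun n => / INR q *
    rsum (fun h => v h * (cos (INR (S n) * angle q h) * exp (- (INR (S n) * y)))) (seq 0 q))).
  { intros n. rewrite (cd_dual _ _ _ H (S n)), Rmult_assoc, <- rsum_scal_r. f_equal.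
    apply rsum_ext; intros; ring. }
  apply (is_series_scal_l (V := R_NormedModule) (/ INR q)).
  apply is_series_rsum_list. intros h _.
  apply (is_series_scal_l (V := R_NormedModule) (v h)). now apply is_series_cos_exp.
Qed.

Lemma lorentz_coef_le_wt q v y V : (0 < q)%nat -> 0 < y -> (forall n, Rabs (v n) <= V) ->
  exists K, forall n, (1 <= n)%nat -> Rabs (v n * lorentz y (angle q n)) <= K * wt n.
Proof.
  intros Hq Hy HV. assert (Hq' : 0 < INR q) by now apply lt_0_INR.
  assert (P1 := PI_RGT_0). assert (HV0 : 0 <= V) by (eapply Rle_trans; [apply Rabs_pos|apply (HV 0%nat)]).
  exists (V * (2 * y / (4 * PI ^ 2 / INR q ^ 2))). intros n Hn.
  assert (Hn' : 0 < INR n) by (apply lt_0_INR; lia).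
  assert (HP : 0 < PI ^ 2) by (apply pow_lt; lra). assert (Hq2 : 0 < INR q ^ 2) by (apply pow_lt; lra).
  assert (Hn2 : 0 < INR n ^ 2) by (apply pow_lt; lra).
  assert (HK : 0 < 4 * PI ^ 2 / INR q ^ 2) by (apply Rdiv_lt_0_compat; lra).
  rewrite Rabs_mult, (Rabs_pos_eq (lorentz _ _)) by now apply lorentz_pos.
  rewrite Rmult_assoc. apply Rmult_le_compat; [apply Rabs_pos|now apply lorentz_pos|apply HV|].
  apply Rle_trans with (2 * y / (4 * PI ^ 2 / INR q ^ 2 * INR n ^ 2)).
  - apply lorentz_le; [exact Hy|now apply Rmult_lt_0_compat|].
    unfold angle. right. field. lra.
  - unfold Rdiv at 1. rewrite Rinv_mult, <- Rmult_assoc. apply Rmult_le_compat_l.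
    + left. apply Rdiv_lt_0_compat; lra.
    + now apply inv_sqr_le_wt.
Qed.

Lemma lambert_lorentz_abs q u v y : cosine_dual q u v -> 0 < y ->
  ex_series (fun n => Rabs (v (S n) / INR q * lorentz y (angle q (S n)))).
Proof.
  intros H Hy. assert (Hq := cd_q _ _ _ H). assert (Hq' : 0 < INR q) by now apply lt_0_INR.
  destruct (periodic_bounded v q Hq (cd_vp _ _ _ H)) as [V [_ HV]].
  destruct (lorentz_coef_le_wt q v y V Hq Hy HV) as [K HK].
  apply (ex_series_le (V := R_CompleteNormedModule) _ (fun n => (/ INR q * K) * wt (S n))).
  - intros n. unfold norm; simpl; unfold abs; simpl. rewrite Rabs_Rabsolu.
    replace (v (S n) / INR q * lorentz y (angle q (S n)))
      with (/ INR q * (v (S n) * lorentz y (angle q (S n)))) by (unfold Rdiv; ring).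
    rewrite Rabs_mult, Rabs_pos_eq by (left; now apply Rinv_0_lt_compat).
    rewrite Rmult_assoc. apply Rmult_le_compat_l; [left; now apply Rinv_0_lt_compat|].
    apply HK; lia.
  - apply (ex_series_scal_l (/ INR q * K) (fun n => wt (S n))), ex_series_wt.
Qed.

(** In the pair of index $k$ at the angle of $h$, the first point is the angle of $h + kq$ and the
    second minus the angle of $(q - h) + kq$. As [v] is symmetric under $h \mapsto q - h$, both
    halves agree and cancel the 2 in $1/(2q)$. The blocks of length $q$ identify the limit,
    convergence being known beforehand. *)
Lemma lambert_lorentz q u v y : cosine_dual q u v -> 0 < y ->
  is_series (fun n => v (S n) / INR q * lorentz y (angle q (S n))) (lambert q v y).
Proof.
  intros H Hy. assert (Hq := cd_q _ _ _ H). assert (Hq' : 0 < INR q) by now apply lt_0_INR.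
  assert (P1 := PI_RGT_0).
  set (f := fun n => v n / INR q * lorentz y (angle q n)).
  assert (Hex : ex_series f).
  { apply ex_series_incr_1. apply ex_series_Rabs. exact (lambert_lorentz_abs q u v y H Hy). }
  destruct Hex as [l Hl].
  apply (is_series_skip_0 f).
  { unfold f. rewrite (cd_v0 _ _ _ H). unfold Rdiv. ring. }
  enough (E : l = lambert q v y) by (rewrite <- E; exact Hl).
  apply is_series_rsum in Hl.
  assert (L1 : is_lim_seq (fun N => rsum f (seq 0 (N * q))) l).
  { apply (is_lim_seq_subseq _ _ (fun N => (N * q)%nat)) in Hl; [exact Hl|].
    apply eventually_subseq. intros n; lia. }
  assert (L2 : is_lim_seq (fun N => / (2 * INR q) *
     rsum (fun h => v h * rsum (lorentz_pair y (angle q h)) (seq 0 N)) (seq 0 q)) (lambert q v y)).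
  { unfold lambert. apply (is_lim_seq_scal_l _ (/ (2 * INR q)) (Finite _)).
    assert (S := is_series_rsum_list (fun h n => v h * lorentz_pair y (angle q h) n)
       (fun h => v h * poisson y (angle q h)) (seq 0 q)).
    assert (S' := S ltac:(intros h Hh; apply (is_series_scal_l (V := R_NormedModule) (v h));
        apply is_series_poisson; [exact Hy|];
        apply in_seq in Hh; unfold angle; assert (0 <= INR h < INR q) by (split; [apply pos_INR|apply lt_INR; lia]);
        split; [apply Rmult_le_pos; [nra|left; now apply Rinv_0_lt_compat]|
          apply Rmult_le_reg_r with (INR q); [lra|]; unfold Rdiv; rewrite Rmult_assoc, Rinv_l, Rmult_1_r by lra; nra])).
    apply is_series_rsum in S'. revert S'. apply is_lim_seq_ext.
    intros N. rewrite rsum_swap. apply rsum_ext. intros h _. apply rsum_scal. }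
  apply (is_lim_seq_ext _ (fun N => rsum f (seq 0 (N * q)))) in L2.
  - apply is_lim_seq_unique in L1. apply is_lim_seq_unique in L2. rewrite L1 in L2. now injection L2.
  - intros N. rewrite rsum_blocks.
    rewrite (rsum_ext (fun h => v h * rsum (lorentz_pair y (angle q h)) (seq 0 N))
      (fun h => rsum (fun k => v h * lorentz_pair y (angle q h) k) (seq 0 N)))
      by (intros h _; now rewrite rsum_scal).
    rewrite rsum_swap, <- rsum_scal. apply rsum_ext. intros k _.
    set (F := fun h => lorentz y (angle q (h + k * q))).
    assert (E1 : rsum (fun h => v h * lorentz_pair y (angle q h) k) (seq 0 q)
      = 2 * rsum (fun h => v h * F h) (seq 0 q)).
    { rewrite (rsum_ext _ (fun h => v h * F h + v h * F (q - h)%nat)).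
      - rewrite rsum_plus, (rsum_reflect v F q (cd_v0 _ _ _ H) (cd_vr _ _ _ H)). ring.
      - intros h Hh. apply in_seq in Hh. unfold lorentz_pair, F. rewrite <- Rmult_plus_distr_l. f_equal. f_equal.
        + f_equal. unfold angle. rewrite plus_INR, mult_INR. field. lra.
        + rewrite <- lorentz_opp. f_equal. unfold angle.
          rewrite plus_INR, mult_INR, minus_INR, S_INR by lia. field. lra. }
    rewrite E1. transitivity (/ INR q * rsum (fun h => v h * F h) (seq 0 q)); [field; lra|].
    rewrite <- rsum_scal. apply rsum_ext. intros h _. unfold f, F.
    assert (Ev : v (h + k * q)%nat = v h).
    { rewrite (periodic_mod v q Hq (cd_vp _ _ _ H) (h + k * q)), (periodic_mod v q Hq (cd_vp _ _ _ H) h).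
      f_equal. apply Nat.Div0.mod_add. }
    rewrite Ev. unfold Rdiv. ring.
Qed.

(** The case $\theta = 0$ of the partial fractions, since $\coth(w/2) = 1 + 2/(e^w - 1)$. The point
    0 gives the term $1/w$, and the other points occur in pairs of opposite sign. *)
Lemma bose_lorentz w : 0 < w ->
  is_series (fun k => lorentz w (2 * PI * INR (S k))) (/ (exp w - 1) - / w + / 2).
Proof.
  intros Hw. assert (P1 := PI_RGT_0).
  assert (H := is_series_poisson w 0 Hw ltac:(lra)).
  apply is_series_rsum in H.
  assert (Hew : 1 < exp w) by (rewrite <- exp_0; apply exp_increasing; lra).
  assert (E : / (exp w - 1) - / w + / 2 = / 2 * (poisson w 0 - 2 / w + 0)).
  { unfold poisson, sinh, cosh. rewrite cos_0, exp_Ropp.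
    assert (0 < (exp w - 1) * (exp w - 1)) by (apply Rmult_lt_0_compat; lra).
    field. repeat split; lra. }
  rewrite E. apply is_series_rsum.
  assert (Z : is_lim_seq (fun N => lorentz w (2 * PI * INR N)) 0).
  { apply (is_lim_seq_incr_1 (fun N => lorentz w (2 * PI * INR N))).
    destruct ex_series_wt as [W HW].
    assert (HW0 : is_lim_seq (fun n => wt (S n)) 0) by (apply ex_series_lim_0; now exists W).
    apply (is_lim_seq_le_le (fun _ => 0) _ (fun n => w * wt (S n))).
    - intros n. split; [now apply lorentz_pos|].
      eapply Rle_trans; [|apply (lorentz_pair_le w 0 n Hw); lra].
      unfold lorentz_pair. rewrite Rplus_0_l.
      generalize (lorentz_pos w (0 - 2 * PI * INR (S (S n))) Hw). lra.
    - apply is_lim_seq_const.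
    - replace (Finite 0) with (Rbar_mult w 0) by (simpl; f_equal; ring).
      now apply is_lim_seq_scal_l. }
  (* The first [N] pairs cover $2\pi j$ for $-N \le j \le N - 1$; adding the point $2\pi N$, whose
     term tends to 0, makes the range symmetric. *)
  assert (T : forall N, rsum (lorentz_pair w 0) (seq 0 N) - 2 / w + lorentz w (2 * PI * INR N)
     = 2 * rsum (fun k => lorentz w (2 * PI * INR (S k))) (seq 0 N)).
  { induction N as [|N IH].
    - unfold rsum, lorentz; simpl. field. lra.
    - rewrite !rsum_seq_S, Nat.add_0_l. unfold lorentz_pair at 2.
      replace (0 - 2 * PI * INR (S N)) with (- (2 * PI * INR (S N))) by ring.
      rewrite lorentz_opp, Rplus_0_l. lra. }
  apply (is_lim_seq_ext (fun N => / 2 * (rsum (lorentz_pair w 0) (seq 0 N) - 2 / w + lorentz w (2 * PI * INR N)))).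
  { intros N. rewrite T. field. }
  apply (is_lim_seq_scal_l _ (/ 2) (Finite _)).
  apply is_lim_seq_plus'; [|exact Z].
  apply is_lim_seq_minus'; [exact H|apply is_lim_seq_const].
Qed.

(** * Integrals of the Lambert series *)

Lemma continuous_rsum {A} (f : A -> R -> R) l s :
  (forall a, In a l -> continuous (f a) s) -> continuous (fun s => rsum (fun a => f a s) l) s.
Proof.
  intros H. induction l as [|a l IH]; [apply continuous_const|].
  apply (continuous_ext (fun s => f a s + rsum (fun a => f a s) l)); [reflexivity|].
  apply (continuous_plus (f a)); [apply H; simpl; auto|].
  apply IH; intros b Hb; apply H; simpl; auto.
Qed.

Lemma continuous_lambert q v al s : 0 < al -> continuous (fun s => lambert q v (al * exp s)) s.
Proof.
  intros Ha. unfold lambert. apply (continuous_scal_r (/ (2 * INR q))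
    (fun s => rsum (fun h => v h * poisson (al * exp s) (angle q h)) (seq 0 q))).
  apply (continuous_rsum (fun h s => v h * poisson (al * exp s) (angle q h))). intros h _.
  apply (continuous_scal_r (v h) (fun s => poisson (al * exp s) (angle q h))).
  apply (ex_derive_continuous (fun s => poisson (al * exp s) (angle q h))).
  unfold poisson. auto_derive.
  assert (H := poisson_denom_pos (al * exp s) (angle q h) ltac:(apply Rmult_lt_0_compat; [exact Ha|apply exp_pos])).
  lra.
Qed.

Lemma exp_gt_1 w : 0 < w -> 1 < exp w.
Proof. intros Hw. rewrite <- exp_0. now apply exp_increasing. Qed.

Lemma continuous_bose al s : 0 < al -> continuous (fun s => / (exp (al * exp (- s)) - 1)) s.
Proof.
  intros Ha. apply (ex_derive_continuous (fun s => / (exp (al * exp (- s)) - 1))). auto_derive.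
  generalize (exp_gt_1 (al * exp (- s)) ltac:(apply Rmult_lt_0_compat; [exact Ha|apply exp_pos])). lra.
Qed.

Lemma is_series_exp y : 0 < y -> is_series (fun n => exp (- (INR (S n) * y))) (/ (exp y - 1)).
Proof.
  intros Hy. assert (H := is_series_cos_exp y 0 Hy).
  assert (Hey := exp_gt_1 y Hy).
  replace (/ (exp y - 1)) with (- / 2 + / 2 * poisson y 0).
  - revert H. apply is_series_ext_R. intros n. rewrite Rmult_0_r, cos_0. ring.
  - unfold poisson, sinh, cosh. rewrite cos_0, exp_Ropp.
    assert (0 < (exp y - 1) * (exp y - 1)) by (apply Rmult_lt_0_compat; lra).
    field. repeat split; lra.
Qed.

(** From $e^{z/2} \ge (1 + z/4)^2$ one gets $16 e^{z/2} \ge 1 + z^2 \ge z^{3/2}$. *)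
Lemma exp_half_decay z : 0 < z -> exp (- (z / 2)) <= 16 * / (z * sqrt z).
Proof.
  intros Hz. assert (Hr := sqrt_lt_R0 z Hz). assert (Er := sqrt_sqrt z ltac:(lra)).
  set (r := sqrt z) in *.
  assert (H4 : 1 + z / 4 <= exp (z / 4)) by apply exp_ineq1_le.
  assert (H2 : 1 + z ^ 2 <= 16 * exp (z / 2)).
  { replace (z / 2) with (z / 4 + z / 4) by field. rewrite exp_plus. nra. }
  assert (H3 : z * r <= 1 + z ^ 2) by nra.
  rewrite exp_Ropp. assert (He := exp_pos (z / 2)).
  apply Rmult_le_reg_r with (exp (z / 2) * (z * r)); [repeat apply Rmult_lt_0_compat; lra|].
  replace (/ exp (z / 2) * (exp (z / 2) * (z * r))) with (z * r) by (field; lra).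
  replace (16 * / (z * r) * (exp (z / 2) * (z * r))) with (16 * exp (z / 2)) by (field; lra). lra.
Qed.

(** Each exponential is cut into two halves. One half gives $(dy)^{-3/2}(mw)^{-3/2}$, where $yw =
    \alpha^2$ removes [s]; the other, by $d, m \ge 1$, is at most $e^{-\alpha\cosh s} \le
    1/(\alpha\cosh(s/2))$. Hence $256 = 16^2$ and $\alpha^4 = \alpha^3\alpha$. *)
Lemma exp_pair_bound al d m s : 0 < al -> (1 <= d)%nat -> (1 <= m)%nat ->
  exp (- (INR d * (al * exp s))) * exp (- (INR m * (al * exp (- s))))
  <= 256 / al ^ 4 * (wt d * wt m) * / cosh (s / 2).
Proof.
  intros Ha Hd Hm.
  assert (Hd' : 1 <= INR d) by (apply (le_INR 1); lia).
  assert (Hm' : 1 <= INR m) by (apply (le_INR 1); lia).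
  set (y := al * exp s). set (w := al * exp (- s)).
  assert (Hy : 0 < y) by (apply Rmult_lt_0_compat; [exact Ha|apply exp_pos]).
  assert (Hw : 0 < w) by (apply Rmult_lt_0_compat; [exact Ha|apply exp_pos]).
  assert (Eyw : y * w = al * al).
  { unfold y, w. replace (al * exp s * (al * exp (- s))) with (al * al * (exp s * exp (- s))) by ring.
    rewrite <- exp_plus, Rplus_opp_r, exp_0. ring. }
  set (D := INR d) in *. set (M := INR m) in *.
  assert (HDy : 0 < D * y) by (apply Rmult_lt_0_compat; lra).
  assert (HMw : 0 < M * w) by (apply Rmult_lt_0_compat; lra).
  assert (B1 := exp_half_decay (D * y) HDy). assert (B2 := exp_half_decay (M * w) HMw).
  assert (Hc1 := cosh_ge_1 (s / 2)). assert (Hc2 := cosh_half_le s).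
  assert (B3 : exp (- (D * y / 2)) * exp (- (M * w / 2)) <= / (al * cosh (s / 2))).
  { rewrite <- exp_plus. apply Rle_trans with (exp (- (al * cosh s))).
    - assert (E : al * cosh s = (y + w) / 2) by (unfold y, w, cosh; field).
      rewrite E. assert (y <= D * y) by nra. assert (w <= M * w) by nra.
      destruct (Req_dec (- (D * y / 2) + - (M * w / 2)) (- ((y + w) / 2))) as [->|Hne]; [lra|].
      left. apply exp_increasing. lra.
    - eapply Rle_trans; [apply exp_le_inv; nra|]. apply Rinv_le_contravar; nra. }
  assert (E0 : exp (- (D * y)) * exp (- (M * w)) =
    (exp (- (D * y / 2)) * exp (- (M * w / 2))) * (exp (- (D * y / 2)) * exp (- (M * w / 2)))).
  { rewrite <- !exp_plus. f_equal. field. }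
  rewrite E0.
  apply Rle_trans with ((16 * / (D * y * sqrt (D * y)) * (16 * / (M * w * sqrt (M * w)))) * / (al * cosh (s / 2))).
  - apply Rmult_le_compat; try exact B3.
    + apply Rmult_le_pos; left; apply exp_pos.
    + apply Rmult_le_pos; left; apply exp_pos.
    + apply Rmult_le_compat; try assumption; left; apply exp_pos.
  - right. unfold wt. fold D M. rewrite !sqrt_mult by lra.
    assert (Esq : sqrt y * sqrt w = al) by (rewrite <- sqrt_mult, Eyw by lra; apply sqrt_square; lra).
    assert (S1 := sqrt_lt_R0 D ltac:(lra)). assert (S2 := sqrt_lt_R0 M ltac:(lra)).
    assert (S3 := sqrt_lt_R0 y ltac:(lra)). assert (S4 := sqrt_lt_R0 w ltac:(lra)).
    set (sD := sqrt D) in *. set (sM := sqrt M) in *. set (sy := sqrt y) in *. set (sw := sqrt w) in *.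
    replace (256 / al ^ 4) with (256 / (y * w * (sy * sw) * al)).
    2:{ rewrite Eyw, Esq. f_equal. ring. }
    clearbody D M y w sD sM sy sw. field. repeat split; lra.
Qed.

Lemma is_intR_lambert_bose q u v al : cosine_dual q u v -> 0 < al ->
  exists l,
    is_series (fun n => rsum u (divisors (S n)) * (2 * K0 (2 * al * sqrt (INR (S n))))) l /\
    is_intR (fun s => lambert q v (al * exp s) * / (exp (al * exp (- s)) - 1)) l.
Proof.
  intros H Ha. destruct (periodic_bounded u q (cd_q _ _ _ H) (cd_up _ _ _ H)) as [U [HU0 HU]].
  destruct (is_intR_dconv (fun d s => u d * exp (- (INR d * (al * exp s))))
    (fun m s => exp (- (INR m * (al * exp (- s)))))
    (fun s => lambert q v (al * exp s)) (fun s => / (exp (al * exp (- s)) - 1))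
    (fun d m => u d * (2 * K0 (2 * al * sqrt (INR d * INR m)))) (U * (256 / al ^ 4))) as [l [Hs Hi]].
  - intros s. apply (continuous_mult (K := R_AbsRing)); [now apply continuous_lambert|now apply continuous_bose].
  - intros s. assert (Hy : 0 < al * exp s) by (apply Rmult_lt_0_compat; [exact Ha|apply exp_pos]).
    apply (ex_series_le (V := R_CompleteNormedModule) _ (fun n => U * exp (- (INR (S n) * (al * exp s))))).
    + intros n. unfold norm; simpl norm; unfold abs; simpl abs.
      rewrite Rabs_Rabsolu, Rabs_mult, (Rabs_pos_eq (exp _)) by (left; apply exp_pos).
      apply Rmult_le_compat_r; [left; apply exp_pos|apply HU].
    + eexists. apply (is_series_scal_l (V := R_NormedModule) U), is_series_exp, Hy.
  - intros s. apply lambert_exp with (1 := H). apply Rmult_lt_0_compat; [exact Ha|apply exp_pos].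
  - intros s. apply is_series_exp. apply Rmult_lt_0_compat; [exact Ha|apply exp_pos].
  - intros d m Hd Hm.
    apply (is_intR_ext (fun s => u d * exp (- (al * (INR d * exp s + INR m * exp (- s)))))).
    { intros s. rewrite Rmult_assoc, <- exp_plus. f_equal. f_equal. ring. }
    apply is_intR_scal, is_intR_K0; [exact Ha| |]; apply lt_0_INR; lia.
  - intros d m s Hd Hm. rewrite Rmult_assoc, Rabs_mult.
    rewrite (Rabs_pos_eq (exp _ * _)) by (apply Rmult_le_pos; left; apply exp_pos).
    replace (U * (256 / al ^ 4) * (wt d * wt m) * / cosh (s / 2))
      with (U * (256 / al ^ 4 * (wt d * wt m) * / cosh (s / 2))) by ring.
    apply Rmult_le_compat; [apply Rabs_pos| |apply HU|now apply exp_pair_bound].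
    apply Rmult_le_pos; left; apply exp_pos.
  - exists l. split; [|exact Hi]. revert Hs. apply is_series_ext_R. intros n.
    rewrite <- rsum_scal_r. apply rsum_ext. intros d Hd.
    apply in_divisors in Hd. destruct Hd as [m [H1 [H2 [H3 H4]]]].
    rewrite H4, <- mult_INR, <- H3. reflexivity.
Qed.

(** Termwise integration without absolute convergence: for each [s] the terms [f k s] decrease in
    [k], so the tail is at most [2 * C * f N s], and its integral [2 * C * c N] tends to 0. *)
Lemma is_intR_dirichlet (w : nat -> R) C (f : nat -> R -> R) (c : nat -> R) (F : R -> R) l :
  (forall k, Rabs (rsum w (seq 0 k)) <= C) ->
  (forall k s, 0 <= f k s) -> (forall k s, f (S k) s <= f k s) ->
  (forall k, is_intR (f k) (c k)) -> is_lim_seq c 0 ->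
  (forall s, continuous F s) ->
  (forall s, is_series (fun k => w k * f k s) (F s)) ->
  is_series (fun k => w k * c k) l -> is_intR F l.
Proof.
  intros HC Hf Hd Hi Hc0 CF HF Hl.
  apply (is_intR_dominated_lim F (fun N s => rsum (fun k => w k * f k s) (seq 0 N))
    (fun N s => 2 * C * f N s) (fun N => rsum (fun k => w k * c k) (seq 0 N)) (fun N => 2 * C * c N)).
  - exact CF.
  - intros N. apply (is_intR_rsum (fun k s => w k * f k s)). intros k _. now apply is_intR_scal.
  - intros N. now apply is_intR_scal.
  - intros N s. apply (dirichlet_tail w (fun k => f k s)); auto.
  - now apply is_series_rsum.
  - replace (Finite 0) with (Rbar_mult (2 * C) 0) by (simpl; f_equal; ring).
    now apply is_lim_seq_scal_l.
Qed.

Lemma is_lim_seq_inv_S c : is_lim_seq (fun n => c / INR (S n)) 0.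
Proof.
  replace (Finite 0) with (Rbar_mult c 0) by (simpl; f_equal; ring).
  apply (is_lim_seq_scal_l (fun n => / INR (S n))).
  apply (is_lim_seq_incr_1 (fun n => / INR n)).
  replace (Finite 0) with (Rbar_inv p_infty) by reflexivity.
  apply is_lim_seq_inv; [apply is_lim_seq_INR|discriminate].
Qed.

Lemma is_intR_exp_exp al k : 0 < al -> 0 < k ->
  is_intR (fun s => exp (- (k * (al * exp s))) * (exp s / al)) (/ (al ^ 2) / k).
Proof.
  intros Ha Hk.
  assert (Hka : 0 < k * al ^ 2) by (apply Rmult_lt_0_compat; [exact Hk|apply pow_lt; lra]).
  replace (/ al ^ 2 / k) with (0 - - / (k * al ^ 2)) by (field; lra).
  apply (is_intR_antiderivative (fun s => - / (k * al ^ 2) * exp (- (k * (al * exp s))))).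
  - intros s. auto_derive; [auto|]. field. lra.
  - intros s. apply (ex_derive_continuous (fun s => exp (- (k * (al * exp s))) * (exp s / al))).
    auto_derive. auto.
  - assert (L := is_lim_comp_exp_m (fun E => - / (k * al ^ 2) * exp (- (k * (al * E)))) 1 Rlt_0_1).
    cbv beta in L. rewrite !Rmult_0_r, Ropp_0, exp_0, Rmult_1_r in L.
    apply (is_lim_ext (fun s => - / (k * al ^ 2) * exp (- (k * (al * exp (1 * s)))))).
    { intros s. now rewrite Rmult_1_l. }
    apply L. apply (ex_derive_continuous (fun E => - / (k * al ^ 2) * exp (- (k * (al * E))))).
    auto_derive. auto.
  - assert (Hp : 0 < / (k * al ^ 2)) by now apply Rinv_0_lt_compat.
    apply (is_lim_le_le_loc (fun s => - / (k * al ^ 2) * / (k * al) * exp (- (1 * s))) (fun _ => 0)).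
    + exists 0. intros s _. assert (He := exp_pos s).
      assert (Hkal : 0 < k * (al * exp s)) by (repeat apply Rmult_lt_0_compat; lra).
      assert (B := exp_le_inv _ Hkal). assert (B' := exp_pos (- (k * (al * exp s)))).
      rewrite Rmult_1_l, exp_Ropp.
      replace (- / (k * al ^ 2) * / (k * al) * / exp s) with (- / (k * al ^ 2) * / (k * (al * exp s)))
        by (field; lra).
      split; nra.
    + assert (L := is_lim_comp_exp_p (fun E => - / (k * al ^ 2) * / (k * al) * E) 1 Rlt_0_1).
      cbv beta in L. rewrite Rmult_0_r in L. apply L.
      apply (ex_derive_continuous (fun E => - / (k * al ^ 2) * / (k * al) * E)). auto_derive. auto.
    + apply is_lim_const.
Qed.

(** The factor $e^s/\alpha$ is $1/w$ at $w = \alpha e^{-s}$. Termwise integrals are multiples of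
    $u(n)/n$, so the exponential expansion is used with its monotonicity in $n$. *)
Lemma is_intR_lambert_pole q u v al L : cosine_dual q u v -> 0 < al ->
  is_series (fun n => u (S n) / INR (S n)) L ->
  is_intR (fun s => lambert q v (al * exp s) * (exp s / al)) (/ al ^ 2 * L).
Proof.
  intros H Ha HL.
  destruct (partial_sums_bounded u q (cd_q _ _ _ H) (cd_up _ _ _ H) (cd_us _ _ _ H) (cd_u0 _ _ _ H)) as [C HC].
  apply (is_intR_dirichlet (fun k => u (S k)) C
    (fun k s => exp (- (INR (S k) * (al * exp s))) * (exp s / al)) (fun k => / al ^ 2 / INR (S k))).
  - exact HC.
  - intros k s. apply Rmult_le_pos; [left; apply exp_pos|].
    left. apply Rdiv_lt_0_compat; [apply exp_pos|exact Ha].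
  - intros k s. apply Rmult_le_compat_r; [left; apply Rdiv_lt_0_compat; [apply exp_pos|exact Ha]|].
    left. apply exp_increasing. rewrite (S_INR (S k)).
    assert (0 < al * exp s) by (apply Rmult_lt_0_compat; [exact Ha|apply exp_pos]). nra.
  - intros k. apply is_intR_exp_exp; [exact Ha|apply lt_0_INR; lia].
  - apply is_lim_seq_inv_S.
  - intros s. apply (continuous_mult (K := R_AbsRing) _ (fun s => exp s / al)); [now apply continuous_lambert|].
    apply (ex_derive_continuous (fun s => exp s / al)). auto_derive. auto.
  - intros s. apply (is_series_ext_R (fun k => u (S k) * exp (- (INR (S k) * (al * exp s))) * (exp s / al))).
    { intros k. ring. }
    apply (is_series_scal_r (exp s / al)). apply lambert_exp with (1 := H).
    apply Rmult_lt_0_compat; [exact Ha|apply exp_pos].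
  - apply (is_series_ext_R (fun n => / al ^ 2 * (u (S n) / INR (S n)))).
    { intros n. unfold Rdiv. ring. }
    apply (is_series_scal_l (V := R_NormedModule)), HL.
Qed.

Lemma is_intR_lorentz al b : 0 < al -> 0 < b ->
  is_intR (fun s => lorentz (al * exp s) b) (PI / b).
Proof.
  intros Ha Hb. replace (PI / b) with (2 / b * (PI / 2) - 2 / b * 0) by (field; lra).
  apply (is_intR_antiderivative (fun s => 2 / b * atan (al / b * exp (1 * s)))).
  - intros s. auto_derive; [auto|]. unfold lorentz, Rsqr. rewrite !Rmult_1_l.
    assert (0 < al * exp s) by (apply Rmult_lt_0_compat; [exact Ha|apply exp_pos]).
    field. repeat split; try lra; apply Rgt_not_eq; nra.
  - intros s. apply (ex_derive_continuous (fun s => lorentz (al * exp s) b)). unfold lorentz. auto_derive.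
    assert (0 < al * exp s) by (apply Rmult_lt_0_compat; [exact Ha|apply exp_pos]).
    apply Rgt_not_eq. nra.
  - apply (is_lim_scal_l _ (2 / b) m_infty 0). apply is_lim_atan_exp_m; lra.
  - apply (is_lim_scal_l _ (2 / b) p_infty (PI / 2)).
    apply is_lim_atan_exp_p; [now apply Rdiv_lt_0_compat|lra].
Qed.

Lemma angle_pos q n : (0 < q)%nat -> (0 < n)%nat -> 0 < angle q n.
Proof.
  intros Hq Hn. unfold angle. apply Rdiv_lt_0_compat; [|now apply lt_0_INR].
  apply Rmult_lt_0_compat; [generalize PI_RGT_0; lra|now apply lt_0_INR].
Qed.

(** The exponential expansion is of no use here, as $\exp(-n\alpha e^s)$ tends to 1 at $-\infty$;
    the Lorentzian terms are integrable and decrease in $n$. *)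
Lemma is_intR_lambert q u v al L : cosine_dual q u v -> 0 < al ->
  is_series (fun n => v (S n) / INR (S n)) L ->
  is_intR (fun s => lambert q v (al * exp s)) (/ 2 * L).
Proof.
  intros H Ha HL. assert (Hq := cd_q _ _ _ H). assert (Hq' : 0 < INR q) by now apply lt_0_INR.
  assert (P1 := PI_RGT_0).
  assert (Hpos : forall s, 0 < al * exp s) by (intros s; apply Rmult_lt_0_compat; [exact Ha|apply exp_pos]).
  destruct (partial_sums_bounded v q Hq (cd_vp _ _ _ H) (cd_vs _ _ _ H) (cd_v0 _ _ _ H)) as [C HC].
  apply (is_intR_dirichlet (fun k => v (S k)) C
    (fun k s => / INR q * lorentz (al * exp s) (angle q (S k))) (fun k => / 2 / INR (S k))).
  - exact HC.
  - intros k s. apply Rmult_le_pos; [left; now apply Rinv_0_lt_compat|now apply lorentz_pos].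
  - intros k s. apply Rmult_le_compat_l; [left; now apply Rinv_0_lt_compat|].
    unfold lorentz, Rdiv. apply Rmult_le_compat_l; [generalize (Hpos s); lra|].
    assert (A1 := angle_pos q (S k) Hq ltac:(lia)).
    assert (A2 : angle q (S k) <= angle q (S (S k))).
    { unfold angle, Rdiv. apply Rmult_le_compat_r; [left; now apply Rinv_0_lt_compat|].
      apply Rmult_le_compat_l; [lra|]. apply le_INR; lia. }
    generalize (Hpos s). intros Hs. apply Rinv_le_contravar; nra.
  - intros k. assert (Hk : 0 < INR (S k)) by (apply lt_0_INR; lia).
    replace (/ 2 / INR (S k)) with (/ INR q * (PI / angle q (S k))).
    + apply is_intR_scal, is_intR_lorentz; [exact Ha|]. apply angle_pos; lia.
    + unfold angle. field. lra.
  - apply is_lim_seq_inv_S.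
  - intros s. now apply continuous_lambert.
  - intros s. assert (S := lambert_lorentz q u v (al * exp s) H (Hpos s)).
    revert S. apply is_series_ext_R. intros n. unfold Rdiv. ring.
  - apply (is_series_ext_R (fun n => / 2 * (v (S n) / INR (S n)))).
    { intros n. unfold Rdiv. ring. }
    apply (is_series_scal_l (V := R_NormedModule)), HL.
Qed.

(** With $E = e^{2s}$ the integrand is $E/((AE + B)(A + CE))$, and partial fractions give the
    primitive $\ln((AE+B)/(A+CE))/(2(A^2 - BC))$, running from $\ln(B/A)$ to $\ln(A/C)$ before
    division. *)
Lemma is_intR_log A B C : 0 < A -> 0 < B -> 0 < C -> A ^ 2 <> B * C ->
  is_intR (fun s => / ((A * exp (2 * s) + B) * (A * exp (- (2 * s)) + C)))
    (ln (A ^ 2 / (B * C)) / (2 * (A ^ 2 - B * C))).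
Proof.
  intros HA HB HC Hne. set (k := 2 * (A ^ 2 - B * C)). assert (Hk : k <> 0) by (unfold k; lra).
  assert (HBC : 0 < B * C) by now apply Rmult_lt_0_compat.
  replace (ln (A ^ 2 / (B * C)) / k) with (ln (A / C) / k - ln (B / A) / k).
  2:{ replace (A ^ 2 / (B * C)) with (A / C / (B / A)) by (field; lra).
      rewrite (ln_div (A / C) (B / A)); [field; exact Hk| |]; now apply Rdiv_lt_0_compat. }
  apply (is_intR_antiderivative (fun s => ln ((A * exp (2 * s) + B) / (A + C * exp (2 * s))) / k)).
  - intros s. assert (HE := exp_pos (2 * s)).
    assert (H1 : 0 < A * exp (2 * s)) by now apply Rmult_lt_0_compat.
    assert (H2 : 0 < C * exp (2 * s)) by now apply Rmult_lt_0_compat.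
    auto_derive.
    + split; [lra|]. split; [|exact I]. apply Rdiv_lt_0_compat; lra.
    + rewrite exp_Ropp. set (E := exp (2 * s)) in *. unfold k in *. field.
      repeat split; try lra; try (apply Rgt_not_eq; nra).
  - intros s. assert (HE := exp_pos (2 * s)). assert (HE' := exp_pos (- (2 * s))).
    apply (ex_derive_continuous (fun s => / ((A * exp (2 * s) + B) * (A * exp (- (2 * s)) + C)))).
    auto_derive. apply Rgt_not_eq. apply Rmult_lt_0_compat; nra.
  - assert (L := is_lim_comp_exp_m (fun E => ln ((A * E + B) / (A + C * E)) / k) 2 ltac:(lra)).
    cbv beta in L. rewrite !Rmult_0_r, Rplus_0_l, Rplus_0_r in L. apply L.
    apply (ex_derive_continuous (fun E => ln ((A * E + B) / (A + C * E)) / k)). auto_derive.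
    rewrite !Rmult_0_r, Rplus_0_l, Rplus_0_r. repeat split; try lra. now apply Rdiv_lt_0_compat.
  - assert (L := is_lim_comp_exp_p (fun E => ln ((A + B * E) / (A * E + C)) / k) 2 ltac:(lra)).
    cbv beta in L. rewrite !Rmult_0_r, Rplus_0_l, Rplus_0_r in L.
    apply (is_lim_ext (fun s => ln ((A + B * exp (- (2 * s))) / (A * exp (- (2 * s)) + C)) / k)).
    { intros s. assert (HE := exp_pos (2 * s)). rewrite exp_Ropp. f_equal. f_equal.
      assert (H1 : 0 < C * exp (2 * s)) by now apply Rmult_lt_0_compat. field. repeat split; lra. }
    apply L.
    apply (ex_derive_continuous (fun E => ln ((A + B * E) / (A * E + C)) / k)). auto_derive.
    rewrite !Rmult_0_r, Rplus_0_l, Rplus_0_r. repeat split; try lra. now apply Rdiv_lt_0_compat.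
Qed.

Lemma quartic_ge p r : 0 <= p -> 0 <= r -> p * r ^ 3 <= p ^ 4 + r ^ 4.
Proof.
  intros Hp Hr. assert (0 <= r ^ 3) by now apply pow_le.
  assert (0 <= p ^ 4) by now apply pow_le. assert (0 <= r ^ 4) by now apply pow_le.
  destruct (Rle_dec p r).
  - assert (p * r ^ 3 <= r * r ^ 3) by (apply Rmult_le_compat_r; lra). simpl in *. lra.
  - assert (r ^ 3 <= p ^ 3) by (apply pow_incr; lra).
    assert (p * r ^ 3 <= p * p ^ 3) by (apply Rmult_le_compat_l; lra). simpl in *. lra.
Qed.

(** In the square roots $p, r, m, n$ of $y, w, b, c$: $p^4 + m^4 \ge p m^3$ gains $\sqrt y$ for half
    a power of $b$, while the other factor keeps $n^4 \ge k n^3$. The symmetric bound gains $\sqrt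
    w$, and the average of both is the claim; on the curve $y = \alpha e^s$, $w = \alpha e^{-s}$
    that mean of roots is $\sqrt\alpha\cosh(s/2)$. *)
Lemma lorentz_denominators y w b c k : 0 < y -> 0 < w -> 0 < b -> 0 < c ->
  0 < k -> k <= sqrt b -> k <= sqrt c ->
  k * (b * sqrt b) * (c * sqrt c) * ((sqrt y + sqrt w) / 2) <= (y ^ 2 + b ^ 2) * (w ^ 2 + c ^ 2).
Proof.
  intros Hy Hw Hb Hc Hk Kb Kc.
  assert (Sy := sqrt_lt_R0 y Hy). assert (Ey := sqrt_sqrt y ltac:(lra)).
  assert (Sw := sqrt_lt_R0 w Hw). assert (Ew := sqrt_sqrt w ltac:(lra)).
  assert (Sb := sqrt_lt_R0 b Hb). assert (Eb := sqrt_sqrt b ltac:(lra)).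
  assert (Sc := sqrt_lt_R0 c Hc). assert (Ec := sqrt_sqrt c ltac:(lra)).
  set (p := sqrt y) in *. set (r := sqrt w) in *. set (m := sqrt b) in *. set (n := sqrt c) in *.
  rewrite <- Ey, <- Ew, <- Eb, <- Ec.
  replace (k * (m * m * m) * (n * n * n) * ((p + r) / 2))
    with ((k * m ^ 3 * n ^ 3 * p + k * m ^ 3 * n ^ 3 * r) / 2) by field.
  replace (((p * p) ^ 2 + (m * m) ^ 2) * ((r * r) ^ 2 + (n * n) ^ 2))
    with ((p ^ 4 + m ^ 4) * (r ^ 4 + n ^ 4)) by ring.
  assert (m3 : 0 < m ^ 3) by now apply pow_lt. assert (n3 : 0 < n ^ 3) by now apply pow_lt.
  assert (H1 : k * m ^ 3 * n ^ 3 * p <= (p ^ 4 + m ^ 4) * (r ^ 4 + n ^ 4)).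
  { replace (k * m ^ 3 * n ^ 3 * p) with ((p * m ^ 3) * (k * n ^ 3)) by ring.
    apply Rmult_le_compat; [apply Rmult_le_pos; lra|apply Rmult_le_pos; lra|apply quartic_ge; lra|].
    assert (k * n ^ 3 <= n * n ^ 3) by (apply Rmult_le_compat_r; lra).
    assert (0 <= r ^ 4) by (apply pow_le; lra). simpl in *. lra. }
  assert (H2 : k * m ^ 3 * n ^ 3 * r <= (p ^ 4 + m ^ 4) * (r ^ 4 + n ^ 4)).
  { replace (k * m ^ 3 * n ^ 3 * r) with ((k * m ^ 3) * (r * n ^ 3)) by ring.
    apply Rmult_le_compat; [apply Rmult_le_pos; lra|apply Rmult_le_pos; lra| |apply quartic_ge; lra].
    assert (k * m ^ 3 <= m * m ^ 3) by (apply Rmult_le_compat_r; lra).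
    assert (0 <= p ^ 4) by (apply pow_le; lra). simpl in *. lra. }
  lra.
Qed.

Lemma lorentz_pair_bound q al d m s : (0 < q)%nat -> 0 < al -> (1 <= d)%nat -> (1 <= m)%nat ->
  lorentz (al * exp s) (angle q d) * lorentz (al * exp (- s)) (2 * PI * INR m)
  <= 4 * al ^ 2 / (sqrt (2 * PI / INR q) * (2 * PI / INR q * sqrt (2 * PI / INR q))
       * (2 * PI * sqrt (2 * PI)) * sqrt al) * (wt d * wt m) * / cosh (s / 2).
Proof.
  intros Hq Ha Hd Hm. assert (P1 := PI_RGT_0).
  assert (Hq' : 1 <= INR q) by (apply (le_INR 1); lia).
  assert (Hd' : 1 <= INR d) by (apply (le_INR 1); lia).
  assert (Hm' : 1 <= INR m) by (apply (le_INR 1); lia).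
  set (be := 2 * PI / INR q). set (ga := 2 * PI).
  assert (Hbe : 0 < be) by (apply Rdiv_lt_0_compat; lra).
  assert (Hga : 0 < ga) by (unfold ga; lra).
  assert (Hbg : be <= ga).
  { unfold be, ga. apply Rmult_le_reg_r with (INR q); [lra|].
    unfold Rdiv; rewrite Rmult_assoc, Rinv_l by lra. nra. }
  assert (Eb : angle q d = be * INR d) by (unfold angle, be; field; lra).
  set (y := al * exp s). set (w := al * exp (- s)).
  assert (Hy : 0 < y) by (apply Rmult_lt_0_compat; [exact Ha|apply exp_pos]).
  assert (Hw : 0 < w) by (apply Rmult_lt_0_compat; [exact Ha|apply exp_pos]).
  assert (Eyw : y * w = al ^ 2).
  { unfold y, w. replace (al * exp s * (al * exp (- s))) with (al * al * (exp s * exp (- s))) by ring.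
    rewrite <- exp_plus, Rplus_opp_r, exp_0. ring. }
  assert (Esq : forall t, sqrt (al * exp t) = sqrt al * exp (t / 2)).
  { intros t. rewrite sqrt_mult by (try lra; left; apply exp_pos). f_equal.
    replace t with (t / 2 + t / 2) at 1 by field. rewrite exp_plus.
    apply sqrt_square. left; apply exp_pos. }
  assert (Ecosh : (sqrt y + sqrt w) / 2 = sqrt al * cosh (s / 2)).
  { unfold y, w. rewrite !Esq. unfold cosh. replace (- s / 2) with (- (s / 2)) by field. field. }
  rewrite Eb. set (b := be * INR d). set (c := ga * INR m).
  assert (Hb : 0 < b) by (apply Rmult_lt_0_compat; lra).
  assert (Hc : 0 < c) by (apply Rmult_lt_0_compat; lra).
  assert (Kb : sqrt be <= sqrt b) by (apply sqrt_le_1; [lra|lra|unfold b; nra]).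
  assert (Kc : sqrt be <= sqrt c) by (apply sqrt_le_1; [lra|lra|unfold c; nra]).
  assert (Sbe := sqrt_lt_R0 be Hbe). assert (Sga := sqrt_lt_R0 ga Hga). assert (Sal := sqrt_lt_R0 al Ha).
  (* The smallest frequencies are $2\pi/q$ and $2\pi$, so $\sqrt{2\pi/q}$ lies below both square
     roots. *)
  assert (B := lorentz_denominators y w b c (sqrt be) Hy Hw Hb Hc Sbe Kb Kc).
  rewrite Ecosh in B. assert (Hch := cosh_ge_1 (s / 2)).
  assert (Sb : 0 < sqrt b) by (apply sqrt_lt_R0; lra). assert (Sc : 0 < sqrt c) by (apply sqrt_lt_R0; lra).
  assert (Hden : 0 < sqrt be * (b * sqrt b) * (c * sqrt c) * (sqrt al * cosh (s / 2)))
    by (repeat (lra || apply Rmult_lt_0_compat)).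
  replace (lorentz y b * lorentz w c) with (4 * al ^ 2 * / ((y ^ 2 + b ^ 2) * (w ^ 2 + c ^ 2))).
  2:{ unfold lorentz. rewrite <- Eyw. assert (0 < y ^ 2) by (apply pow_lt; lra).
      assert (0 < w ^ 2) by (apply pow_lt; lra).
      assert (0 < b ^ 2) by (apply pow_lt; lra). assert (0 < c ^ 2) by (apply pow_lt; lra).
      clearbody y w b c. field. split; nra. }
  apply Rle_trans with (4 * al ^ 2 * / (sqrt be * (b * sqrt b) * (c * sqrt c) * (sqrt al * cosh (s / 2)))).
  - apply Rmult_le_compat_l; [assert (0 < al ^ 2) by (apply pow_lt; lra); lra|].
    now apply Rinv_le_contravar.
  - right. unfold wt. unfold b, c. rewrite !(sqrt_mult be), !(sqrt_mult ga) by lra.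
    assert (S1 := sqrt_lt_R0 (INR d) ltac:(lra)). assert (S2 := sqrt_lt_R0 (INR m) ltac:(lra)).
    clearbody be ga. field. repeat split; lra.
Qed.

Lemma is_intR_lambert_bose_regular q u v al : cosine_dual q u v -> 0 < al ->
  let c := al ^ 2 * INR q / (4 * PI ^ 2) in
  (forall m, (0 < m)%nat -> c <> INR m) ->
  exists l,
    is_series (fun n => rsum v (divisors (S n)) *
       (ln (INR (S n) / c) / (INR (S n) ^ 2 - c ^ 2))) l /\
    is_intR (fun s => lambert q v (al * exp s) *
       (/ (exp (al * exp (- s)) - 1) - / (al * exp (- s)) + / 2))
      (al ^ 2 * INR q / (4 * PI ^ 4) * l).
Proof.
  intros H Ha c Hc. assert (Hq := cd_q _ _ _ H). assert (Hq' : 0 < INR q) by now apply lt_0_INR.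
  assert (P1 := PI_RGT_0).
  assert (Hc0 : 0 < c).
  { unfold c. apply Rdiv_lt_0_compat; [apply Rmult_lt_0_compat; [apply pow_lt|]; lra|].
    assert (0 < PI ^ 2) by (apply pow_lt; lra). lra. }
  assert (Hpos : forall s, 0 < al * exp s) by (intros s; apply Rmult_lt_0_compat; [exact Ha|apply exp_pos]).
  destruct (periodic_bounded v q Hq (cd_vp _ _ _ H)) as [V [HV0 HV]].
  set (K := 4 * al ^ 2 / (sqrt (2 * PI / INR q) * (2 * PI / INR q * sqrt (2 * PI / INR q))
       * (2 * PI * sqrt (2 * PI)) * sqrt al)).
  set (kap := fun N => al ^ 2 * INR q / (4 * PI ^ 4) * (ln (INR N / c) / (INR N ^ 2 - c ^ 2))).
  destruct (is_intR_dconv (fun d s => v d / INR q * lorentz (al * exp s) (angle q d))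
    (fun m s => lorentz (al * exp (- s)) (2 * PI * INR m))
    (fun s => lambert q v (al * exp s))
    (fun s => / (exp (al * exp (- s)) - 1) - / (al * exp (- s)) + / 2)
    (fun d m => v d * kap (d * m)%nat) (V / INR q * K)) as [l [Hs Hi]].
  - intros s. apply (continuous_mult (K := R_AbsRing)); [now apply continuous_lambert|].
    apply (ex_derive_continuous (fun s => / (exp (al * exp (- s)) - 1) - / (al * exp (- s)) + / 2)).
    auto_derive. generalize (exp_gt_1 _ (Hpos (- s))) (Hpos (- s)). intros; repeat split; lra.
  - intros s. apply (lambert_lorentz_abs q u v); auto.
  - intros s. apply (lambert_lorentz q u v); auto.
  - intros s. apply bose_lorentz; auto.
  - intros d m Hd Hm.
    assert (Hd' : 0 < INR d) by (apply lt_0_INR; lia). assert (Hm' : 0 < INR m) by (apply lt_0_INR; lia).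
    assert (Hdm : 0 < INR (d * m)) by (rewrite mult_INR; now apply Rmult_lt_0_compat).
    assert (Hb : 0 < angle q d) by (apply angle_pos; lia).
    assert (HC : 0 < 2 * PI * INR m) by (apply Rmult_lt_0_compat; lra).
    assert (Hne := Hc (d * m)%nat ltac:(nia)).
    assert (Hne2 : c ^ 2 - INR (d * m) ^ 2 <> 0).
    { replace (c ^ 2 - INR (d * m) ^ 2) with ((c - INR (d * m)) * (c + INR (d * m))) by ring.
      apply Rmult_integral_contrapositive_currified; lra. }
    (* The parameter [c] is scaled so that $A = (4\pi^2/q)c$ and $BC = ((4\pi^2/q)\,dm)^2$ in
       [is_intR_log]: only $dm$ survives, and $A^2 \ne BC$ becomes $c \ne dm$. *)
    assert (EA : al ^ 2 = 4 * PI ^ 2 / INR q * c) by (unfold c; field; lra).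
    assert (EBC : angle q d ^ 2 * (2 * PI * INR m) ^ 2 = (4 * PI ^ 2 / INR q * INR (d * m)) ^ 2)
      by (unfold angle; rewrite mult_INR; field; lra).
    assert (HPq : 0 < 4 * PI ^ 2 / INR q)
      by (apply Rdiv_lt_0_compat; [assert (0 < PI ^ 2) by (apply pow_lt; lra)|]; lra).
    assert (J := is_intR_log (al ^ 2) (angle q d ^ 2) ((2 * PI * INR m) ^ 2)
       ltac:(apply pow_lt; lra) ltac:(apply pow_lt; lra) ltac:(apply pow_lt; lra)).
    rewrite EBC in J.
    assert (HneA : (al ^ 2) ^ 2 <> (4 * PI ^ 2 / INR q * INR (d * m)) ^ 2).
    { rewrite EA. intros E. apply Hne2.
      apply Rmult_eq_reg_l with ((4 * PI ^ 2 / INR q) ^ 2); [|apply Rgt_not_eq, pow_lt; lra].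
      rewrite !Rpow_mult_distr in E. lra. }
    specialize (J HneA).
    apply (is_intR_scal (v d / INR q * (4 * al ^ 2))) in J.
    replace (v d * kap (d * m)%nat) with (v d / INR q * (4 * al ^ 2) *
      (ln ((al ^ 2) ^ 2 / (4 * PI ^ 2 / INR q * INR (d * m)) ^ 2) /
        (2 * ((al ^ 2) ^ 2 - (4 * PI ^ 2 / INR q * INR (d * m)) ^ 2)))).
    + revert J. apply is_intR_ext. intros s. unfold lorentz.
      assert (Ep : exp (2 * s) = exp s * exp s) by (rewrite <- exp_plus; f_equal; ring).
      assert (Em : exp (- (2 * s)) = exp (- s) * exp (- s)) by (rewrite <- exp_plus; f_equal; ring).
      assert (E1 : exp s * exp (- s) = 1) by (rewrite <- exp_plus, Rplus_opp_r; apply exp_0).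
      rewrite Ep, Em.
      assert (G1 := Hpos s). assert (G2 := Hpos (- s)).
      assert (0 < angle q d ^ 2) by (apply pow_lt; lra).
      assert (0 < (2 * PI * INR m) ^ 2) by (apply pow_lt; lra).
      assert (D1 : 0 < al ^ 2 * (exp s * exp s) + angle q d ^ 2) by nra.
      assert (D2 : 0 < al ^ 2 * (exp (- s) * exp (- s)) + (2 * PI * INR m) ^ 2) by nra.
      replace ((al * exp s) ^ 2 + angle q d ^ 2) with (al ^ 2 * (exp s * exp s) + angle q d ^ 2) by ring.
      replace ((al * exp (- s)) ^ 2 + (2 * PI * INR m) ^ 2)
        with (al ^ 2 * (exp (- s) * exp (- s)) + (2 * PI * INR m) ^ 2) by ring.
      set (Q1 := al ^ 2 * (exp s * exp s) + angle q d ^ 2) in *.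
      set (Q2 := al ^ 2 * (exp (- s) * exp (- s)) + (2 * PI * INR m) ^ 2) in *.
      transitivity (v d / INR q * (4 * al ^ 2 * (exp s * exp (- s))) * / (Q1 * Q2)).
      * rewrite E1. ring.
      * field. lra.
    + assert (El : ln ((al ^ 2) ^ 2 / (4 * PI ^ 2 / INR q * INR (d * m)) ^ 2) = - (2 * ln (INR (d * m) / c))).
      { rewrite EA. replace ((4 * PI ^ 2 / INR q * c) ^ 2 / (4 * PI ^ 2 / INR q * INR (d * m)) ^ 2)
          with (/ ((INR (d * m) / c) * (INR (d * m) / c))) by (field; lra).
        assert (0 < INR (d * m) / c) by now apply Rdiv_lt_0_compat.
        rewrite ln_Rinv, ln_mult; try lra. now apply Rmult_lt_0_compat. }
      rewrite El. unfold kap. set (Lg := ln _). rewrite EA.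
      replace ((4 * PI ^ 2 / INR q * c) ^ 2 - (4 * PI ^ 2 / INR q * INR (d * m)) ^ 2)
        with ((4 * PI ^ 2 / INR q) ^ 2 * (c ^ 2 - INR (d * m) ^ 2)) by ring.
      replace (INR (d * m) ^ 2 - c ^ 2) with (- (c ^ 2 - INR (d * m) ^ 2)) by ring.
      set (Dn := c ^ 2 - INR (d * m) ^ 2) in *. clearbody Dn Lg. clear EA. clearbody c. field. lra.
  - intros d m s Hd Hm.
    replace (v d / INR q * lorentz (al * exp s) (angle q d) * lorentz (al * exp (- s)) (2 * PI * INR m))
      with (v d * (/ INR q * (lorentz (al * exp s) (angle q d) * lorentz (al * exp (- s)) (2 * PI * INR m))))
      by (unfold Rdiv; ring).
    replace (V / INR q * K * (wt d * wt m) * / cosh (s / 2))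
      with (V * (/ INR q * (K * (wt d * wt m) * / cosh (s / 2)))) by (unfold Rdiv; ring).
    assert (Hl : 0 <= lorentz (al * exp s) (angle q d) * lorentz (al * exp (- s)) (2 * PI * INR m))
      by (apply Rmult_le_pos; apply lorentz_pos; auto).
    assert (Hiq : 0 < / INR q) by now apply Rinv_0_lt_compat.
    rewrite Rabs_mult, (Rabs_pos_eq (/ INR q * _)) by (apply Rmult_le_pos; lra).
    apply Rmult_le_compat; [apply Rabs_pos|apply Rmult_le_pos; lra|apply HV|].
    apply Rmult_le_compat_l; [lra|]. now apply lorentz_pair_bound.
  - set (k := al ^ 2 * INR q / (4 * PI ^ 4)) in *.
    assert (Hk : 0 < k).
    { apply Rdiv_lt_0_compat; [apply Rmult_lt_0_compat; [apply pow_lt|]; lra|].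
      assert (0 < PI ^ 4) by (apply pow_lt; lra). lra. }
    exists (/ k * l). split.
    + assert (Hs' := is_series_scal_l (/ k) _ _ Hs). revert Hs'.
      apply is_series_ext_R. intros n. change (scal (/ k) ?t) with (/ k * t).
      rewrite <- rsum_scal_r, <- rsum_scal. apply rsum_ext. intros d Hd.
      apply in_divisors in Hd. destruct Hd as [m [H1 [H2 [H3 H4]]]].
      rewrite H4, <- H3. unfold kap.
      generalize (ln (INR (S n) / c) / (INR (S n) ^ 2 - c ^ 2)). intros X. field. lra.
    + rewrite <- Rmult_assoc, Rinv_r, Rmult_1_l by lra. exact Hi.
Qed.

Lemma ex_series_L1 (u : nat -> R) q :
  (0 < q)%nat -> (forall n, u (n + q)%nat = u n) -> rsum u (seq 0 q) = 0 -> u 0%nat = 0 ->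
  ex_series (fun n => u (S n) / INR (S n)).
Proof.
  intros Hq Hp Hs H0. destruct (partial_sums_bounded u q Hq Hp Hs H0) as [C HC].
  apply (ex_series_dirichlet (fun n => u (S n)) (fun n => / INR (S n)) C); auto.
  - intros k. left. apply Rinv_0_lt_compat, lt_0_INR; lia.
  - intros k. apply Rinv_le_contravar; [apply lt_0_INR; lia|apply le_INR; lia].
  - apply (is_lim_seq_ext (fun n => 1 / INR (S n))); [intros n; unfold Rdiv; ring|].
    apply is_lim_seq_inv_S.
Qed.

Lemma koshliakov_cosine_dual q u v al : cosine_dual q u v -> 0 < al ->
  let c := al ^ 2 * INR q / (4 * PI ^ 2) in
  (forall m, (0 < m)%nat -> c <> INR m) ->
  is_series (fun n => rsum u (divisors (S n)) * K0 (2 * al * sqrt (INR (S n))))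
    (/ (2 * al ^ 2) * Series (fun n => u (S n) / INR (S n))
     - / 8 * Series (fun n => v (S n) / INR (S n))
     + al ^ 2 * INR q / (8 * PI ^ 4) *
       Series (fun n => rsum v (divisors (S n)) * (ln (INR (S n) / c) / (INR (S n) ^ 2 - c ^ 2)))).
Proof.
  intros H Ha c Hc. assert (Hq := cd_q _ _ _ H). assert (Hq' : 0 < INR q) by now apply lt_0_INR.
  assert (P1 := PI_RGT_0).
  assert (HLu := Series_correct _ (ex_series_L1 u q Hq (cd_up _ _ _ H) (cd_us _ _ _ H) (cd_u0 _ _ _ H))).
  assert (HLv := Series_correct _ (ex_series_L1 v q Hq (cd_vp _ _ _ H) (cd_vs _ _ _ H) (cd_v0 _ _ _ H))).
  set (Lu := Series (fun n => u (S n) / _)) in *. set (Lv := Series (fun n => v (S n) / _)) in *.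
  destruct (is_intR_lambert_bose q u v al H Ha) as [l1 [S1 I1]].
  assert (I2 := is_intR_lambert_pole q u v al Lu H Ha HLu).
  assert (I3 := is_intR_lambert q u v al Lv H Ha HLv).
  destruct (is_intR_lambert_bose_regular q u v al H Ha Hc) as [T [S4 I4]]. fold c in S4.
  rewrite (is_series_unique _ _ S4).
  assert (I5 := is_intR_plus _ _ _ _ (is_intR_plus _ _ _ _ I2 (is_intR_scal (- / 2) _ _ I3)) I4).
  assert (E : l1 = / al ^ 2 * Lu + - / 2 * (/ 2 * Lv) + al ^ 2 * INR q / (4 * PI ^ 4) * T).
  { apply (is_intR_unique _ _ _ I1). revert I5. apply is_intR_ext. intros s.
    assert (He : exp s / al = / (al * exp (- s))).
    { rewrite exp_Ropp. assert (Hes := exp_pos s). field. lra. }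
    rewrite He. ring. }
  (* The integral over the line is twice the sum with $K_0$, so all coefficients are halved; 1/8
     combines this with the 1/2 of $B$ and the 1/2 of [is_intR_lambert]. *)
  replace (/ (2 * al ^ 2) * Lu - / 8 * Lv + al ^ 2 * INR q / (8 * PI ^ 4) * T) with (/ 2 * l1).
  - assert (S1' := is_series_scal_l (/ 2) _ _ S1).
    revert S1'. apply is_series_ext_R. intros n. unfold scal; simpl; unfold mult; simpl. field.
  - rewrite E. field. lra.
Qed.

(** * Gauss sums of primitive characters *)

(** The same fold as in [d_chi] and [gauss_sum], which are therefore instances by conversion. *)
Definition csum {A : Type} (f : A -> C) (l : list A) : C :=
  fold_right Cplus (RtoC 0) (map f l).

Lemma csum_cons {A} (f : A -> C) a l : csum f (a :: l) = (f a + csum f l)%C.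
Proof. reflexivity. Qed.

Lemma csum_components {A} (f : A -> C) l :
  csum f l = (rsum (fun a => fst (f a)) l, rsum (fun a => snd (f a)) l).
Proof. induction l as [|a l IH]; [reflexivity|]. rewrite csum_cons, IH. reflexivity. Qed.

Lemma csum_ext {A} (f g : A -> C) l : (forall a, In a l -> f a = g a) -> csum f l = csum g l.
Proof.
  intros H; induction l as [|a l IH]; [reflexivity|].
  rewrite !csum_cons, IH, H; simpl; auto. intros b Hb; apply H; simpl; auto.
Qed.

Lemma csum_scal {A} c (f : A -> C) l : csum (fun a => (c * f a)%C) l = (c * csum f l)%C.
Proof.
  induction l as [|a l IH]; [unfold csum; simpl; ring|]. rewrite !csum_cons, IH. ring.
Qed.

Lemma csum_conj {A} (f : A -> C) l : csum (fun a => Cconj (f a)) l = Cconj (csum f l).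
Proof.
  induction l as [|a l IH].
  - unfold csum, Cconj; simpl. unfold RtoC. f_equal. ring.
  - rewrite !csum_cons, IH, Cplus_conj. reflexivity.
Qed.

Lemma csum_plus {A} (f g : A -> C) l : csum (fun a => (f a + g a)%C) l = (csum f l + csum g l)%C.
Proof.
  induction l as [|a l IH]; [unfold csum; simpl; ring|]. rewrite !csum_cons, IH. ring.
Qed.

Lemma csum_0 {A} (l : list A) : csum (fun _ => RtoC 0) l = RtoC 0.
Proof. induction l as [|a l IH]; [reflexivity|]. rewrite csum_cons, IH. ring. Qed.

Lemma csum_swap {A B} (f : A -> B -> C) l m :
  csum (fun a => csum (f a) m) l = csum (fun b => csum (fun a => f a b) l) m.
Proof.
  induction l as [|a l IH].
  - symmetry. apply csum_0.
  - rewrite csum_cons, IH, <- csum_plus. apply csum_ext; intros b _; now rewrite csum_cons.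
Qed.

Lemma csum_perm {A} (f : A -> C) l l' : Permutation l l' -> csum f l = csum f l'.
Proof.
  induction 1 as [|a l l' _ IH|a b l|l l' l'' _ IH1 _ IH2]; rewrite ?csum_cons.
  - reflexivity.
  - now rewrite IH.
  - ring.
  - now rewrite IH1.
Qed.

Lemma csum_map {A B} (h : A -> B) (f : B -> C) l : csum f (map h l) = csum (fun a => f (h a)) l.
Proof. unfold csum; now rewrite map_map. Qed.

Lemma csum_single {A} (f : A -> C) l a :
  NoDup l -> In a l -> (forall b, In b l -> b <> a -> f b = RtoC 0) -> csum f l = f a.
Proof.
  intros Hn Ha H. induction Hn as [|b l Hb Hn IH]; [destruct Ha|].
  rewrite csum_cons. destruct Ha as [->|Ha].
  - rewrite (csum_ext f (fun _ => RtoC 0) l), csum_0; [ring|].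
    intros c Hc. apply H; [simpl; auto|]. intros ->; contradiction.
  - rewrite IH; [|exact Ha|intros c Hc; apply H; simpl; auto].
    rewrite H; [ring|simpl; auto|]. intros ->; contradiction.
Qed.

Lemma Cmult_integral (z w : C) : (z * w)%C = RtoC 0 -> z = RtoC 0 \/ w = RtoC 0.
Proof.
  intros H. destruct (classic (z = RtoC 0)) as [Hz|Hz]; [now left|].
  right. apply NNPP. intros Hw. exact (Cmult_neq_0 z w Hz Hw H).
Qed.

Lemma periodicZ {A} (f : Z -> A) q : (forall n, f (n + q)%Z = f n) -> forall k n, f (n + k * q)%Z = f n.
Proof.
  intros Hp k. induction k as [|k IH|k IH] using Z.peano_ind; intros n.
  - f_equal; lia.
  - rewrite <- (IH n), <- (Hp (n + k * q)%Z). f_equal; lia.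
  - rewrite <- (IH n). rewrite <- (Hp (n + Z.pred k * q)%Z). f_equal; lia.
Qed.

Lemma periodicZ_cong {A} (f : Z -> A) q n m :
  (forall n, f (n + q)%Z = f n) -> (q | n - m)%Z -> f n = f m.
Proof.
  intros Hp [k Hk]. rewrite <- (periodicZ f q Hp k m). f_equal; lia.
Qed.

Definition residues (q : Z) : list Z := map Z.of_nat (seq 0 (Z.to_nat q)).

Lemma in_residues q n : (0 < q)%Z -> (In n (residues q) <-> (0 <= n < q)%Z).
Proof.
  intros Hq. unfold residues. rewrite in_map_iff. split.
  - intros [k [<- Hk]]. apply in_seq in Hk. lia.
  - intros Hn. exists (Z.to_nat n). rewrite in_seq. lia.
Qed.

Lemma NoDup_residues q : NoDup (residues q).
Proof.
  apply FinFun.Injective_map_NoDup; [|apply seq_NoDup]. intros a b; lia.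
Qed.

(** An injective self-map of the finite set of residues is a permutation, so injectivity modulo [q]
    suffices and no inverse has to be given. *)
Lemma csum_reindex q (f g : Z -> C) (s : Z -> Z) : (0 < q)%Z ->
  (forall n, f (n + q)%Z = f n) ->
  (forall a b, (0 <= a < q)%Z -> (0 <= b < q)%Z -> (q | s a - s b)%Z -> a = b) ->
  (forall n, g n = f (s n)) ->
  csum g (residues q) = csum f (residues q).
Proof.
  intros Hq Hp Hinj Hg.
  rewrite (csum_ext g (fun n => f ((s n) mod q)%Z)).
  - rewrite <- (csum_map (fun n => ((s n) mod q)%Z) f). apply csum_perm. apply Permutation_map_same_l.
    + apply FinFun.Injective_map_NoDup_in; [|apply NoDup_residues].
      intros a b Ha Hb E. apply in_residues in Ha, Hb; auto. apply Hinj; auto.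
      pose proof (Z.div_mod (s a) q). pose proof (Z.div_mod (s b) q).
      exists (s a / q - s b / q)%Z. lia.
    + intros n Hn. apply in_map_iff in Hn. destruct Hn as [k [<- _]].
      apply in_residues; [exact Hq|]. now apply Z.mod_pos_bound.
  - intros n _. rewrite Hg. apply periodicZ_cong with q; [exact Hp|].
    pose proof (Z.div_mod (s n) q). exists (s n / q)%Z. lia.
Qed.

Lemma csum_mul_coprime q (f : Z -> C) n : (0 < q)%Z -> Z.gcd n q = 1%Z ->
  (forall n, f (n + q)%Z = f n) ->
  csum (fun k => f (n * k)%Z) (residues q) = csum f (residues q).
Proof.
  intros Hq Hg Hp. apply (csum_reindex q f _ (fun k => (n * k)%Z)); auto.
  intros a b Ha Hb Hd. rewrite <- Z.mul_sub_distr_l in Hd.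
  apply Z.gauss in Hd; [|now rewrite Z.gcd_comm].
  destruct Hd as [k Hk]. assert (k = 0)%Z by nia. lia.
Qed.

Definition eZ (q j : Z) : C :=
  (cos (2 * PI * IZR j / IZR q), sin (2 * PI * IZR j / IZR q)).

Lemma eZ_plus q j k : eZ q (j + k) = (eZ q j * eZ q k)%C.
Proof.
  unfold eZ, Cmult; simpl. rewrite plus_IZR.
  replace (2 * PI * (IZR j + IZR k) / IZR q)
    with (2 * PI * IZR j / IZR q + 2 * PI * IZR k / IZR q) by (unfold Rdiv; ring).
  rewrite cos_plus, sin_plus. f_equal; ring.
Qed.

Lemma eZ_period q j : (0 < q)%Z -> eZ q (j + q) = eZ q j.
Proof.
  intros Hq. rewrite eZ_plus.
  assert (E : eZ q q = RtoC 1).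
  { unfold eZ. assert (0 < IZR q) by (apply IZR_lt; lia).
    replace (2 * PI * IZR q / IZR q) with (2 * PI) by (field; lra).
    now rewrite cos_2PI, sin_2PI. }
  rewrite E. ring.
Qed.

Lemma eZ_cong q j k : (0 < q)%Z -> (q | j - k)%Z -> eZ q j = eZ q k.
Proof. intros Hq. apply periodicZ_cong. intros n. now apply eZ_period. Qed.

Lemma eZ_eq_1 q j : (0 < q)%Z -> eZ q j = RtoC 1 -> (q | j)%Z.
Proof.
  intros Hq H. apply NNPP. intros Hn.
  assert (Hq' : 0 < IZR q) by (apply IZR_lt; lia). assert (P1 := PI_RGT_0).
  assert (Hm : (0 < j mod q < q)%Z).
  { assert (B := Z.mod_pos_bound j q Hq).
    assert (j mod q <> 0)%Z by (intros E; apply Hn; apply Z.mod_divide; lia). lia. }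
  rewrite (eZ_cong q j (j mod q) Hq) in H.
  2:{ pose proof (Z.div_mod j q). exists (j / q)%Z. lia. }
  set (r := (j mod q)%Z) in *. unfold eZ in H. injection H as H _.
  assert (Hr : 0 < IZR r < IZR q) by (split; apply IZR_lt; lia).
  set (t := PI * IZR r / IZR q).
  replace (2 * PI * IZR r / IZR q) with (2 * t) in H by (unfold t; field; lra).
  rewrite cos_2a_sin in H.
  assert (0 < sin t).
  { apply sin_gt_0.
    - unfold t. apply Rdiv_lt_0_compat; [apply Rmult_lt_0_compat|]; lra.
    - unfold t. apply Rmult_lt_reg_r with (IZR q); [lra|].
      unfold Rdiv. rewrite Rmult_assoc, Rinv_l by lra. nra. }
  nra.
Qed.

(** Shifting $h$ by 1 multiplies the sum by $e^{2\pi i j/q}$ and leaves it unchanged, so it vanishes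
    unless that factor is 1. *)
Lemma csum_eZ q j : (0 < q)%Z ->
  csum (fun h => eZ q (h * j)) (residues q) = if Zdivide_dec q j then RtoC (IZR q) else RtoC 0.
Proof.
  intros Hq. destruct (Zdivide_dec q j) as [Hd|Hd].
  - rewrite (csum_ext _ (fun _ => RtoC 1)).
    + unfold residues. rewrite csum_map.
      assert (E : forall s n, csum (fun _ : nat => RtoC 1) (seq s n) = RtoC (INR n)).
      { intros s n. revert s. induction n as [|n IH]; intros s; [reflexivity|].
        simpl seq. rewrite csum_cons, IH, S_INR, RtoC_plus. ring. }
      rewrite E, INR_IZR_INZ, Z2Nat.id by lia. reflexivity.
    + intros h _. rewrite (eZ_cong q (h * j) 0 Hq).
      * unfold eZ. unfold Rdiv. rewrite Rmult_0_r, Rmult_0_l, cos_0, sin_0. reflexivity.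
      * rewrite Z.sub_0_r. now apply Z.divide_mul_r.
  - set (S := csum (fun h => eZ q (h * j)) (residues q)).
    assert (E : (eZ q j * S)%C = S).
    { unfold S. rewrite <- csum_scal.
      apply (csum_reindex q (fun h => eZ q (h * j)) _ (fun h => (h + 1)%Z) Hq).
      - intros n. apply eZ_cong; [exact Hq|]. exists j. ring.
      - intros a b Ha Hb [k Hk]. assert (k = 0)%Z by nia. lia.
      - intros n. rewrite <- eZ_plus. f_equal. ring. }
    assert (E' : ((eZ q j - 1) * S)%C = RtoC 0).
    { transitivity (eZ q j * S - S)%C; [ring|]. rewrite E. ring. }
    destruct (Cmult_integral _ _ E') as [H|H]; [|exact H].
    exfalso. apply Hd, eZ_eq_1; [exact Hq|].
    replace (eZ q j) with ((eZ q j - 1) + 1)%C by ring. rewrite H. ring.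
Qed.


(** A periodic function is bounded, whereas $|\chi(n^k)| = |\chi(n)|^k$ would be unbounded if
    $|\chi(n)| > 1$. *)
Lemma char_bounded_1 q chi n : is_dirichlet_char q chi -> Cmod (chi n) <= 1.
Proof.
  intros (Hq & Hm & Hp & Hz & H1).
  destruct (periodic_bounded (fun k => Cmod (chi (Z.of_nat k))) (Z.to_nat q)) as [B [_ HB]].
  { lia. }
  { intros k. f_equal. rewrite <- (Hp (Z.of_nat k)). f_equal. lia. }
  assert (HB' : forall n, Cmod (chi n) <= B).
  { intros m. rewrite (periodicZ_cong chi q m (m mod q) Hp).
    - rewrite <- (Z2Nat.id (m mod q)) by (apply Z.mod_pos_bound; lia).
      eapply Rle_trans; [apply Rle_abs|apply HB].
    - pose proof (Z.div_mod m q). exists (m / q)%Z. lia. }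
  assert (Hpow : forall k, Cmod (chi (n ^ Z.of_nat k)%Z) = Cmod (chi n) ^ k).
  { induction k as [|k IH]; [simpl; rewrite H1; apply Cmod_1|].
    rewrite Nat2Z.inj_succ, Z.pow_succ_r by lia. rewrite Hm, Cmod_mult, IH. reflexivity. }
  apply Rnot_lt_le. intros Hgt.
  destruct (Pow_x_infinity (Cmod (chi n)) ltac:(rewrite Rabs_pos_eq; lra) (B + 1)) as [N HN].
  specialize (HN N (le_n _)). rewrite <- Hpow, Rabs_pos_eq in HN by apply Cmod_ge_0.
  specialize (HB' (n ^ Z.of_nat N)%Z). lra.
Qed.

(** For an inverse $m$ of $n$ modulo $q$ one has $|\chi(m)||\chi(n)| = 1$ with both factors at most
    1, hence $|\chi(n)| = 1$. *)
Lemma char_conj_inv q chi n : is_dirichlet_char q chi -> Z.gcd n q = 1%Z ->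
  (chi n * Cconj (chi n))%C = RtoC 1.
Proof.
  intros H Hg. assert (B1 := char_bounded_1 q chi n H).
  destruct (Z.gcd_bezout n q 1 Hg) as [m [k Hb]].
  assert (B2 := char_bounded_1 q chi m H).
  destruct H as (Hq & Hm & Hp & Hz & H1).
  assert (E : (chi m * chi n)%C = RtoC 1).
  { rewrite <- Hm, <- H1. apply periodicZ_cong with q; [exact Hp|]. exists (- k)%Z. lia. }
  apply (f_equal Cmod) in E. rewrite Cmod_mult, Cmod_1 in E.
  assert (M : Cmod (chi n) = 1).
  { generalize (Cmod_ge_0 (chi n)) (Cmod_ge_0 (chi m)). intros. nra. }
  rewrite <- Cmod2_conj, M. f_equal. ring.
Qed.

Lemma char_eZ_periodic q chi h : is_dirichlet_char q chi ->
  forall n, (chi (n + q)%Z * eZ q ((n + q) * h))%C = (chi n * eZ q (n * h))%C.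
Proof.
  intros (Hq & Hm & Hp & Hz & H1) n. rewrite Hp. f_equal. apply eZ_cong; [lia|]. exists h. ring.
Qed.

Lemma gauss_sum_residues q chi : is_dirichlet_char q chi ->
  gauss_sum q chi = csum (fun k => (chi k * eZ q (k * 1))%C) (residues q).
Proof.
  intros H. assert (Hs := char_eZ_periodic q chi 1 H). destruct H as (Hq & Hm & Hp & Hz & H1).
  set (F := fun k => (chi k * eZ q (k * 1))%C) in *.
  assert (E : gauss_sum q chi = csum (fun k => F (Z.of_nat k)) (seq 1 (Z.to_nat q))).
  { unfold gauss_sum. apply csum_ext. intros k _. unfold F, e_q, eZ. rewrite Z.mul_1_r.
    now rewrite <- INR_IZR_INZ. }
  rewrite E. unfold residues. rewrite csum_map, <- seq_shift, csum_map.
  rewrite <- !(csum_map Z.of_nat (fun n => F n)) .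
  transitivity (csum (fun n => F (n + 1)%Z) (residues q)).
  { unfold residues. rewrite csum_map. apply csum_ext. intros k _. f_equal. lia. }
  apply (csum_reindex q F _ (fun k => (k + 1)%Z)); [lia|exact Hs| |reflexivity].
  intros a b Ha Hb [k Hk]. assert (k = 0)%Z by nia. lia.
Qed.

(* For h not coprime to q, primitivity provides n = 1 mod q / gcd h q with chi n <> 1, and
   multiplying the summation variable by n leaves the sum unchanged, so it vanishes. *)
Lemma gauss_sum_twisted q chi h : is_dirichlet_char q chi -> is_primitive q chi ->
  csum (fun k => (chi k * eZ q (k * h))%C) (residues q) = (gauss_sum q chi * Cconj (chi h))%C.
Proof.
  intros H Hprim. rewrite (gauss_sum_residues q chi H).
  destruct (Z.eq_dec (Z.gcd h q) 1) as [Hg|Hg].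
  - assert (Hi := char_conj_inv q chi h H Hg).
    set (W := csum (fun k => (chi k * eZ q (k * h))%C) (residues q)).
    assert (E : (chi h * W)%C = csum (fun k => (chi k * eZ q (k * 1))%C) (residues q)).
    { rewrite <- (csum_mul_coprime q _ h); [|destruct H; lia|exact Hg|now apply char_eZ_periodic].
      unfold W. rewrite <- csum_scal. apply csum_ext. intros k _.
      destruct H as (Hq & Hm & _). rewrite Hm. rewrite Cmult_assoc. f_equal. f_equal. ring. }
    rewrite <- E. transitivity (W * (chi h * Cconj (chi h)))%C; [rewrite Hi; ring|ring].
  - assert (Hq : (0 < q)%Z) by (destruct H; lia).
    assert (Hz : chi h = RtoC 0) by (destruct H as (_ & _ & _ & Hz & _); now apply Hz).
    rewrite Hz. set (W := csum (fun k => (chi k * eZ q (k * h))%C) (residues q)).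
    replace (Cconj (RtoC 0)) with (RtoC 0) by (unfold Cconj, RtoC; simpl; f_equal; ring).
    rewrite Cmult_0_r.
    assert (Hg0 := Z.gcd_nonneg h q).
    destruct (Z.gcd_divide_r h q) as [d Hd]. destruct (Z.gcd_divide_l h q) as [h' Hh'].
    generalize dependent (Z.gcd h q). intros g Hg Hg0 Hd Hh'.
    assert (g <> 0)%Z by (intros E; rewrite E in Hd; lia).
    assert (Hgp : (1 < g)%Z) by lia.
    assert (Hdp : (1 <= d)%Z) by nia.
    destruct (Hprim d Hdp) as [n [Hn1 [Hn2 Hn3]]]; [exists g; lia|nia|].
    assert (E : (chi n * W)%C = W).
    { unfold W at 2. rewrite <- (csum_mul_coprime q _ n Hq Hn1 (char_eZ_periodic q chi h H)).
      unfold W. rewrite <- csum_scal. apply csum_ext. intros k _.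
      destruct H as (_ & Hm & _). rewrite Hm, Cmult_assoc. f_equal.
      apply eZ_cong; [exact Hq|].
      pose proof (Z.div_mod n d). pose proof (Z.div_mod 1 d).
      exists (- (k * h' * (n / d - 1 / d)))%Z.
      assert (Hnd : (n - 1 = d * (n / d - 1 / d))%Z) by lia.
      replace (k * h - n * k * h)%Z with (- (k * h * (n - 1)))%Z by ring.
      rewrite Hnd, Hd. rewrite Hh' at 1. ring. }
    assert (E' : ((chi n - 1) * W)%C = RtoC 0).
    { transitivity (chi n * W - W)%C; [ring|]. rewrite E. ring. }
    destruct (Cmult_integral _ _ E') as [Hc|Hc]; [|exact Hc].
    exfalso. apply Hn3. replace (chi n) with ((chi n - 1) + 1)%C by ring. rewrite Hc. ring.
Qed.

(** Each $\tau(\chi)\bar\chi(h)$ is opened as a twisted sum over $k$. Orthogonality in $h$ leaves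
    the single residue $k \equiv -d$, and evenness gives $\chi(-d) = \chi(d)$. *)
Lemma char_fourier q chi d : is_dirichlet_char q chi -> is_even_char chi -> is_primitive q chi ->
  (RtoC (IZR q) * chi d)%C
  = csum (fun h => (gauss_sum q chi * Cconj (chi h) * eZ q (h * d))%C) (residues q).
Proof.
  intros H Hev Hprim.
  rewrite (csum_ext _ (fun h => csum (fun k => (chi k * eZ q (h * (k + d)))%C) (residues q))).
  2:{ intros h _. rewrite <- gauss_sum_twisted by assumption.
      rewrite Cmult_comm, <- csum_scal. apply csum_ext. intros k _.
      replace (h * (k + d))%Z with (k * h + h * d)%Z by ring. rewrite eZ_plus. ring. }
  assert (Hq : (0 < q)%Z) by (destruct H; lia).
  rewrite csum_swap.
  rewrite (csum_ext _ (fun k => (chi k * (if Zdivide_dec q (k + d) then RtoC (IZR q) else RtoC 0))%C)).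
  2:{ intros k _. now rewrite csum_scal, csum_eZ. }
  rewrite (csum_single _ (residues q) ((- d) mod q)%Z (NoDup_residues q)).
  - assert (D : (q | (- d) mod q + d)%Z).
    { pose proof (Z.div_mod (- d) q). exists (- (- d / q))%Z. lia. }
    destruct (Zdivide_dec q ((- d) mod q + d)) as [_|N]; [|contradiction].
    destruct H as (_ & Hm & Hp & _).
    rewrite (periodicZ_cong chi q ((- d) mod q) (-1 * d) Hp).
    + rewrite Hm, Hev. ring.
    + destruct D as [k Hk]. exists k. lia.
  - apply in_residues; [exact Hq|]. now apply Z.mod_pos_bound.
  - intros k Hk Hne. apply in_residues in Hk; [|exact Hq].
    destruct (Zdivide_dec q (k + d)) as [[j Hj]|_]; [|ring].
    exfalso. apply Hne. apply Z.mod_unique_pos with (- j)%Z; lia.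
Qed.

(** Average of the Fourier expansions at $d$ and $-d$. The kernel becomes real, as the passage to
    real and imaginary parts requires. *)
Lemma char_cosine q chi d : is_dirichlet_char q chi -> is_even_char chi -> is_primitive q chi ->
  (RtoC (IZR q) * chi d)%C
  = csum (fun h => (gauss_sum q chi * Cconj (chi h) * RtoC (fst (eZ q (h * d))))%C) (residues q).
Proof.
  intros H Hev Hprim.
  assert (E1 := char_fourier q chi d H Hev Hprim).
  assert (E2 := char_fourier q chi (-1 * d) H Hev Hprim).
  assert (Ed : chi (-1 * d)%Z = chi d) by (destruct H as (_ & Hm & _); rewrite Hm, Hev; ring).
  rewrite Ed in E2.
  assert (E3 : (RtoC 2 * (RtoC (IZR q) * chi d))%C =
    (RtoC 2 * csum (fun h => (gauss_sum q chi * Cconj (chi h) * RtoC (fst (eZ q (h * d))))%C) (residues q))%C).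
  { transitivity (RtoC (IZR q) * chi d + RtoC (IZR q) * chi d)%C; [ring|].
    rewrite E1 at 1. rewrite E2. rewrite <- csum_plus, <- csum_scal.
    apply csum_ext. intros h _.
    assert (Ee : (eZ q (h * d) + eZ q (h * (-1 * d)))%C = (RtoC 2 * RtoC (fst (eZ q (h * d))))%C).
    { unfold eZ. replace (h * (-1 * d))%Z with (- (h * d))%Z by ring. rewrite opp_IZR.
      replace (2 * PI * - IZR (h * d) / IZR q) with (- (2 * PI * IZR (h * d) / IZR q)) by (unfold Rdiv; ring).
      rewrite cos_neg, sin_neg. unfold Cplus, Cmult, RtoC; simpl. f_equal; ring. }
    rewrite <- Cmult_plus_distr_l, Ee. ring. }
  assert (N : RtoC 2 <> RtoC 0) by (intros E; injection E; lra).
  assert (E4 : (RtoC 2 * (RtoC (IZR q) * chi d -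
    csum (fun h => (gauss_sum q chi * Cconj (chi h) * RtoC (fst (eZ q (h * d))))%C) (residues q)))%C = RtoC 0).
  { match goal with |- (_ * (?a - ?b))%C = _ => transitivity (RtoC 2 * a - RtoC 2 * b)%C; [ring|] end.
    rewrite E3. ring. }
  destruct (Cmult_integral _ _ E4) as [E|E]; [contradiction|].
  match goal with |- ?a = ?b => transitivity ((a - b) + b)%C; [ring|] end. rewrite E. ring.
Qed.

Lemma char_sum_0 q chi : is_dirichlet_char q chi -> ~ is_principal q chi ->
  csum chi (residues q) = RtoC 0.
Proof.
  intros H Hnp. apply not_all_ex_not in Hnp. destruct Hnp as [n Hn].
  apply imply_to_and in Hn. destruct Hn as [Hg Hn].
  destruct H as (Hq & Hm & Hp & _).
  assert (E : (chi n * csum chi (residues q))%C = csum chi (residues q)).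
  { rewrite <- (csum_mul_coprime q chi n) at 2 by (auto; lia). rewrite <- csum_scal.
    apply csum_ext. intros k _. now rewrite Hm. }
  assert (E' : ((chi n - 1) * csum chi (residues q))%C = RtoC 0).
  { transitivity (chi n * csum chi (residues q) - csum chi (residues q))%C; [ring|]. rewrite E. ring. }
  destruct (Cmult_integral _ _ E') as [Hc|Hc]; [|exact Hc].
  exfalso. apply Hn. replace (chi n) with ((chi n - 1) + 1)%C by ring. rewrite Hc. ring.
Qed.

(** Since $\gcd(0, q) = q$, only $q = 1$ could fail, and modulo 1 the character is constant and
    hence principal. *)
Lemma char_0 q chi : is_dirichlet_char q chi -> ~ is_principal q chi -> chi 0%Z = RtoC 0.
Proof.
  intros (Hq & Hm & Hp & Hz & H1) Hnp. apply Hz. simpl.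
  rewrite Z.abs_eq by lia. intros ->. apply Hnp. intros n _. rewrite <- H1.
  apply periodicZ_cong with 1%Z; [exact Hp|]. apply Z.divide_1_l.
Qed.

Definition char_dual (q : Z) (chi : Z -> C) (n : nat) : C :=
  (gauss_sum q chi * Cconj (chi (Z.of_nat n)))%C.

(** The projection [p] treats both components at once; all that enters is that it is additive and
    commutes with real factors. *)
Lemma char_cosine_dual q chi (p : C -> R) :
  (p = fst \/ p = snd) ->
  is_dirichlet_char q chi -> ~ is_principal q chi -> is_even_char chi -> is_primitive q chi ->
  cosine_dual (Z.to_nat q) (fun n => p (chi (Z.of_nat n))) (fun n => p (char_dual q chi n)).
Proof.
  intros Hproj H Hnp Hev Hprim.
  assert (p_scal : forall z r, p (z * RtoC r)%C = p z * r).
  { intros z r. destruct Hproj as [-> | ->]; unfold Cmult, RtoC; simpl; ring. }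
  assert (p_csum : forall (f : nat -> C) l, p (csum f l) = rsum (fun n => p (f n)) l).
  { intros f l. rewrite csum_components. destruct Hproj as [-> | ->]; reflexivity. }
  assert (p_0 : p (RtoC 0) = 0) by (destruct Hproj as [-> | ->]; reflexivity).
  assert (C0 := char_0 q chi H Hnp). assert (CS := char_sum_0 q chi H Hnp).
  assert (Hq : (0 < q)%Z) by (destruct H; lia).
  assert (Hq' : 0 < IZR q) by (apply IZR_lt; lia).
  assert (Hp : forall n, chi (n + q)%Z = chi n) by apply H.
  assert (CC : Cconj (RtoC 0) = RtoC 0) by (unfold Cconj, RtoC; simpl; f_equal; ring).
  assert (Hper : forall n, chi (Z.of_nat (n + Z.to_nat q)) = chi (Z.of_nat n)).
  { intros n. rewrite <- (Hp (Z.of_nat n)). f_equal. lia. }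
  split.
  - lia.
  - change (Z.of_nat 0) with 0%Z. now rewrite C0.
  - unfold char_dual. change (Z.of_nat 0) with 0%Z. now rewrite C0, CC, Cmult_0_r.
  - intros n. now rewrite Hper.
  - intros n. unfold char_dual. now rewrite Hper.
  - rewrite <- p_csum. unfold residues in CS. rewrite csum_map in CS. now rewrite CS.
  - rewrite <- p_csum. unfold char_dual. rewrite csum_scal, csum_conj.
    unfold residues in CS. rewrite csum_map in CS. now rewrite CS, CC, Cmult_0_r.
  - intros h Hh. unfold char_dual. do 3 f_equal.
    rewrite (periodicZ_cong chi q _ (-1 * Z.of_nat h) Hp); [|exists 1%Z; lia].
    destruct H as (_ & Hm & _). rewrite Hm, Hev. ring.
  - intros d. assert (E := char_cosine q chi (Z.of_nat d) H Hev Hprim).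
    apply (f_equal p) in E. rewrite Cmult_comm, p_scal in E.
    unfold residues in E. rewrite csum_map, p_csum in E.
    assert (EN : INR (Z.to_nat q) = IZR q) by (rewrite INR_IZR_INZ, Z2Nat.id by lia; reflexivity).
    rewrite EN. apply Rmult_eq_reg_r with (IZR q); [|lra]. rewrite E.
    rewrite (Rmult_comm (/ _)), Rmult_assoc, Rinv_l, Rmult_1_r by lra.
    apply rsum_ext. intros h _. rewrite p_scal. unfold char_dual. f_equal.
    unfold eZ, angle. simpl. rewrite EN, mult_IZR, <- !INR_IZR_INZ. f_equal. unfold Rdiv. ring.
Qed.

(** Otherwise the Fourier expansion of $q\chi(1) = q$ would vanish. *)
Lemma gauss_sum_neq_0 q chi :
  is_dirichlet_char q chi -> is_even_char chi -> is_primitive q chi -> gauss_sum q chi <> RtoC 0.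
Proof.
  intros H Hev Hprim E. assert (F := char_fourier q chi 1 H Hev Hprim).
  rewrite (csum_ext _ (fun _ => RtoC 0)), csum_0 in F by (intros h _; rewrite E; ring).
  destruct H as (Hq & _ & _ & _ & H1). rewrite H1, Cmult_1_r in F. injection F as F.
  apply (eq_IZR q 0) in F. lia.
Qed.

(** * Complex series by components and assembly of the theorem *)

(** A complex factor mixes the two components, and [Series] splits a sum only when both parts
    converge, whence the two hypotheses. *)
Lemma CSeries_scal (z : C) (b : nat -> C) :
  ex_series (fun n => fst (b n)) -> ex_series (fun n => snd (b n)) ->
  CSeries (fun n => (z * b n)%C) = (z * CSeries b)%C.
Proof.
  intros H1 H2.
  assert (G : forall k (f : nat -> R), ex_series f -> ex_series (fun n => k * f n))
    by (intros k f; apply (ex_series_scal_l k f)).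
  unfold CSeries, Cmult; simpl. f_equal; rewrite <- !Series_scal_l.
  - apply Series_minus; now apply G.
  - apply Series_plus; now apply G.
Qed.

Lemma CSeries_ext (a b : nat -> C) : (forall n, a n = b n) -> CSeries a = CSeries b.
Proof. intros H. unfold CSeries. f_equal; apply Series_ext; intros n; now rewrite H. Qed.

Lemma is_series_C (a : nat -> C) l1 l2 :
  is_series (fun n => fst (a n)) l1 -> is_series (fun n => snd (a n)) l2 ->
  is_series a ((l1, l2) : C).
Proof.
  intros H1 H2. unfold is_series in *.
  assert (E : forall n, sum_n a n = (sum_n (fun n => fst (a n)) n, sum_n (fun n => snd (a n)) n) :> C).
  { induction n as [|n IH]; [rewrite !sum_O; apply surjective_pairing|].
    rewrite !sum_Sn, IH. reflexivity. }
  apply filterlim_locally. intros eps.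
  generalize (proj1 (filterlim_locally _ _) H1 eps) (proj1 (filterlim_locally _ _) H2 eps).
  intros F1 F2. generalize (filter_and _ _ F1 F2). apply filter_imp.
  intros n [B1 B2]. rewrite E. split; assumption.
Qed.

Lemma ex_series_divisor_log q u v al : cosine_dual q u v -> 0 < al ->
  let c := al ^ 2 * INR q / (4 * PI ^ 2) in
  (forall m, (0 < m)%nat -> c <> INR m) ->
  ex_series (fun n => rsum v (divisors (S n)) * (ln (INR (S n) / c) / (INR (S n) ^ 2 - c ^ 2))).
Proof.
  intros H Ha c Hc. destruct (is_intR_lambert_bose_regular q u v al H Ha Hc) as [l [Hl _]]. now exists l.
Qed.

Theorem theorem2p9 (q : Z) (chi : Z -> C) (a x : R) :
  is_dirichlet_char q chi ->
  ~ is_principal q chi ->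
  is_even_char chi ->
  is_primitive q chi ->
  0 < a -> 0 < x ->
  (forall m : nat, (0 < m)%nat -> a ^ 2 * IZR q * x / (16 * PI ^ 2) <> INR m) ->
  let c := a ^ 2 * IZR q * x / (16 * PI ^ 2) in
  is_series
    (fun n : nat =>
       Cmult (d_chi chi (S n)) (RtoC (K0 (a * sqrt (INR (S n) * x)))))
    (Cplus
       (Cminus
          (Cmult (RtoC (2 / (a ^ 2 * x))) (L1 chi))
          (Cmult (Cdiv (gauss_sum q chi) (RtoC 8)) (L1 (conj_char chi))))
       (Cmult (RtoC (a ^ 2 * IZR q * x / (32 * PI ^ 4)))
          (Cmult (gauss_sum q chi)
             (CSeries (fun n : nat =>
                Cmult (d_chi (conj_char chi) (S n))
                  (RtoC (ln (INR (S n) / c) / (INR (S n) ^ 2 - c ^ 2)))))))).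
Proof.
  intros H Hnp Hev Hprim Ha Hx Hc c.
  assert (Hq : (0 < q)%Z) by (destruct H; lia).
  assert (P1 := PI_RGT_0).
  set (al := a * sqrt x / 2).
  assert (Sx := sqrt_lt_R0 x Hx). assert (Ex := sqrt_sqrt x ltac:(lra)).
  assert (Hal : 0 < al) by (unfold al; apply Rdiv_lt_0_compat; [now apply Rmult_lt_0_compat|lra]).
  assert (Eal : al ^ 2 = a ^ 2 * x / 4) by (unfold al; rewrite <- Ex at 2; field).
  assert (EN : INR (Z.to_nat q) = IZR q) by (rewrite INR_IZR_INZ, Z2Nat.id by lia; reflexivity).
  assert (Ec : al ^ 2 * INR (Z.to_nat q) / (4 * PI ^ 2) = c) by (unfold c; rewrite Eal, EN; field; lra).
  assert (Hc' : forall m, (0 < m)%nat -> al ^ 2 * INR (Z.to_nat q) / (4 * PI ^ 2) <> INR m)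
    by (intros m Hm; rewrite Ec; now apply Hc).
  set (tau := gauss_sum q chi).
  assert (Htau : tau <> RtoC 0) by now apply gauss_sum_neq_0.
  assert (D1 := char_cosine_dual q chi fst (or_introl eq_refl) H Hnp Hev Hprim).
  assert (D2 := char_cosine_dual q chi snd (or_intror eq_refl) H Hnp Hev Hprim).
  assert (K1 := koshliakov_cosine_dual _ _ _ al D1 Hal Hc').
  assert (K2 := koshliakov_cosine_dual _ _ _ al D2 Hal Hc').
  assert (T1 := ex_series_divisor_log _ _ _ al D1 Hal Hc').
  assert (T2 := ex_series_divisor_log _ _ _ al D2 Hal Hc').
  rewrite Ec in K1, K2, T1, T2.
  assert (M1 := ex_series_L1 _ _ (cd_q _ _ _ D1) (cd_vp _ _ _ D1) (cd_vs _ _ _ D1) (cd_v0 _ _ _ D1)).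
  assert (M2 := ex_series_L1 _ _ (cd_q _ _ _ D2) (cd_vp _ _ _ D2) (cd_vs _ _ _ D2) (cd_v0 _ _ _ D2)).
  set (Lw := CSeries (fun n => (char_dual q chi (S n) * RtoC (/ INR (S n)))%C)).
  set (Tw := CSeries (fun n => (csum (char_dual q chi) (divisors (S n)) *
      RtoC (ln (INR (S n) / c) / (INR (S n) ^ 2 - c ^ 2)))%C)).
  assert (fst_r : forall z r, fst (z * RtoC r)%C = fst z * r) by (intros; simpl; ring).
  assert (snd_r : forall z r, snd (z * RtoC r)%C = snd z * r) by (intros; simpl; ring).
  assert (csum1 : forall (f : nat -> C) l, fst (csum f l) = rsum (fun n => fst (f n)) l)
    by (intros; now rewrite csum_components).
  assert (csum2 : forall (f : nat -> C) l, snd (csum f l) = rsum (fun n => snd (f n)) l)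
    by (intros; now rewrite csum_components).
  assert (EL : (tau * L1 (conj_char chi))%C = Lw).
  (* Convergence is at hand for the components of $\tau(\chi)\bar\chi$, so $\bar\chi$ is written as
     $\tau(\chi)^{-1}$ times it before the scalar is pulled out. *)
  { unfold L1. rewrite (CSeries_ext _ (fun n => (/ tau * (char_dual q chi (S n) * RtoC (/ INR (S n))))%C)).
    - rewrite CSeries_scal.
      + fold Lw. rewrite Cmult_assoc, Cinv_r by exact Htau. ring.
      + revert M1. apply ex_series_ext. intros n. now rewrite fst_r.
      + revert M2. apply ex_series_ext. intros n. now rewrite snd_r.
    - intros n. unfold conj_char, char_dual, Cdiv. fold tau.
      rewrite RtoC_inv by (apply not_0_INR; lia). field. split; [|exact Htau].
      intros E. apply RtoC_inj in E. exact (not_0_INR (S n) ltac:(lia) E). }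
  assert (ET : (tau * CSeries (fun n => (d_chi (conj_char chi) (S n) *
      RtoC (ln (INR (S n) / c) / (INR (S n) ^ 2 - c ^ 2)))%C))%C = Tw).
  { rewrite (CSeries_ext _ (fun n => (/ tau * (csum (char_dual q chi) (divisors (S n)) *
      RtoC (ln (INR (S n) / c) / (INR (S n) ^ 2 - c ^ 2))))%C)).
    - rewrite CSeries_scal.
      + fold Tw. rewrite Cmult_assoc, Cinv_r by exact Htau. ring.
      + revert T1. apply ex_series_ext. intros n. now rewrite fst_r, csum1.
      + revert T2. apply ex_series_ext. intros n. now rewrite snd_r, csum2.
    - intros n. assert (E : csum (char_dual q chi) (divisors (S n)) = (tau * d_chi (conj_char chi) (S n))%C).
      { unfold char_dual. fold tau. now rewrite csum_scal. }
      rewrite E. field. exact Htau. }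
  rewrite ET.
  replace (tau / RtoC 8 * L1 (conj_char chi))%C with (RtoC (/ 8) * Lw)%C.
  2:{ rewrite <- EL, RtoC_inv by lra. unfold Cdiv. ring. }
  match goal with |- is_series _ ?r => rewrite (surjective_pairing r) end.
  assert (EK : forall n, K0 (2 * al * sqrt (INR (S n))) = K0 (a * sqrt (INR (S n) * x))).
  { intros n. f_equal. rewrite sqrt_mult by (try lra; apply pos_INR). unfold al. field. }
  assert (R1 : forall k1 k2 k3 X Y Z, fst (RtoC k1 * X - RtoC k2 * Y + RtoC k3 * Z)%C
    = k1 * fst X - k2 * fst Y + k3 * fst Z) by (intros; simpl; ring).
  assert (R2 : forall k1 k2 k3 X Y Z, snd (RtoC k1 * X - RtoC k2 * Y + RtoC k3 * Z)%C
    = k1 * snd X - k2 * snd Y + k3 * snd Z) by (intros; simpl; ring).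
  assert (Q1 : 2 / (a ^ 2 * x) = / (2 * al ^ 2)) by (rewrite Eal; field; lra).
  assert (Q2 : a ^ 2 * IZR q * x / (32 * PI ^ 4) = al ^ 2 * INR (Z.to_nat q) / (8 * PI ^ 4))
    by (rewrite Eal, EN; field; lra).
  assert (EL1 : L1 chi = CSeries (fun n => (chi (Z.of_nat (S n)) * RtoC (/ INR (S n)))%C)).
  { apply CSeries_ext. intros n. rewrite RtoC_inv by (apply not_0_INR; lia). reflexivity. }
  rewrite R1, R2, Q1, Q2, EL1.
  assert (F1 : forall (b : nat -> C) (g : nat -> R), (forall n, fst (b n) = g n) -> fst (CSeries b) = Series g)
    by (intros b g E; now apply Series_ext).
  assert (F2 : forall (b : nat -> C) (g : nat -> R), (forall n, snd (b n) = g n) -> snd (CSeries b) = Series g)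
    by (intros b g E; now apply Series_ext).
  apply is_series_C.
  - rewrite (F1 _ (fun n => fst (chi (Z.of_nat (S n))) / INR (S n)) (fun n => fst_r _ _)).
    unfold Lw. rewrite (F1 _ (fun n => fst (char_dual q chi (S n)) / INR (S n)) (fun n => fst_r _ _)).
    unfold Tw. rewrite (F1 _ (fun n => rsum (fun n => fst (char_dual q chi n)) (divisors (S n)) *
       (ln (INR (S n) / c) / (INR (S n) ^ 2 - c ^ 2)))) by (intros n; now rewrite fst_r, csum1).
    revert K1. apply is_series_ext_R. intros n. rewrite fst_r, EK. f_equal.
    symmetry. apply (csum1 (fun n => chi (Z.of_nat n))).
  - rewrite (F2 _ (fun n => snd (chi (Z.of_nat (S n))) / INR (S n)) (fun n => snd_r _ _)).
    unfold Lw. rewrite (F2 _ (fun n => snd (char_dual q chi (S n)) / INR (S n)) (fun n => snd_r _ _)).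
    unfold Tw. rewrite (F2 _ (fun n => rsum (fun n => snd (char_dual q chi n)) (divisors (S n)) *
       (ln (INR (S n) / c) / (INR (S n) ^ 2 - c ^ 2)))) by (intros n; now rewrite snd_r, csum2).
    revert K2. apply is_series_ext_R. intros n. rewrite snd_r, EK. f_equal.
    symmetry. apply (csum2 (fun n => chi (Z.of_nat n))).
Qed.
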